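(* Let $d\ge 2$ and $n\ge d+1$ be integers, let $\beta_1,\ldots,\beta_n>-1$, and let $a,b$ be real numbers. Let $X_1,\ldots,X_n$ be independent random vectors in $\mathbb{R}^d$ such that $X_i$ has density $f_{d,\beta_i}$, and let $\mathcal{P}=\mathrm{conv}(X_1,\ldots,X_n)$. For a polytope $P\subset\mathbb{R}^d$ let $$T_{a,b}^{d-1,d}(P)=\sum_{F\in\mathcal{F}_{d-1}(P)}\mathrm{dist}^a(F,0)\,\mathrm{Vol}_{d-1}^b(F),$$ where $\mathcal{F}_{d-1}(P)$ is the set of facets of $P$. Then \begin{align*} \mathbb{E}\,T_{a,b}^{d-1,d}(\mathcal{P}) &= d!\,\kappa_d\sum_{1\le i_1<\cdots<i_d\le n}\ \prod_{k=1}^{d}\frac{c_{d,\beta_{i_k}}}{c_{d-1,\beta_{i_k}}}\cdot\mathbb{E}\left(\Delta_{d-1}^{(\beta_{i_1},\ldots,\beta_{i_d})}\right)^{b+1}\\ &\quad\times\int_{-1}^{1}|h|^a(1-h^2)^{\sum_{k=1}^{d}\beta_{i_k}+\frac{d-1}{2}(d+b+1)}\prod_{k\notin\{i_1,\ldots,i_d\}}F_{\beta_k+\frac{d-1}{2}}(h)\,\mathrm{d}h, \end{align*} where $\Delta_{d-1}^{(\gamma_1,\ldots,\gamma_d)}=\mathrm{Vol}_{d-1}(\mathrm{conv}(Y_1,\ldots,Y_d))$ for independent random vectors $Y_1,\ldots,Y_d$ in $\mathbb{R}^{d-1}$ with $Y_k$ having density $f_{d-1,\gamma_k}$.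
   Context: For $m\ge1$ and $\beta>-1$, the beta density on $\mathbb{R}^m$ is $f_{m,\beta}(x)=c_{m,\beta}(1-|x|^2)^{\beta}$ for $|x|\le 1$ (and $0$ otherwise), where $c_{m,\beta}=\frac{\Gamma(\frac m2+\beta+1)}{\pi^{m/2}\Gamma(\beta+1)}$. For $\gamma>-1$, $F_{\gamma}(h)=c_{1,\gamma}\int_{-1}^{h}(1-x^2)^{\gamma}\,\mathrm{d}x$, $h\in[-1,1]$. $\kappa_d$ denotes the volume of the $d$-dimensional unit ball; $\mathrm{dist}(F,0)$ is the Euclidean distance from the origin to $F$. An empty product is $1$.
   Formalization: dist(F,0) is taken as the distance from the origin to the affine hull of the facet F, not to F itself; with the distance to F the formula fails, e.g. for d=2, n=3, a=1, b=0. *)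

(* Defs.v *)
From HB Require Import structures.
From mathcomp Require Import all_boot all_order all_algebra.
From mathcomp Require Import all_classical all_reals all_analysis.
Set Implicit Arguments. Unset Strict Implicit. Unset Printing Implicit Defensive.
Import Order.TTheory GRing.Theory Num.Theory.
Import numFieldNormedType.Exports.
Local Open Scope classical_set_scope.
Local Open Scope ring_scope.

Section Defs.
Variable R : realType.

Definition edot (m : nat) (u v : 'rV[R]_m) : R := \sum_(j < m) u 0 j * v 0 j.
Definition enorm (m : nat) (v : 'rV[R]_m) : R := Num.sqrt (edot v v).

(* iint k F integrates F over the first k coordinates (0..k-1) w.r.t. the
   one-dimensional Lebesgue measure, the remaining coordinates set to 0. *)
Fixpoint iint (k : nat) (F : (nat -> R) -> \bar R) {struct k} : \bar R :=
  match k with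
  | 0 => F (fun _ => 0)
  | k'.+1 => (\int[@lebesgue_measure R]_(t in setT)
                iint k' (fun v => F (fun i => if i == k' then t else v i)))%E
  end.

Definition leb_int (m : nat) (F : 'rV[R]_m -> \bar R) : \bar R :=
  iint m (fun v => F (\row_(j < m) v j)).

Definition pts_int (k m : nat) (G : ('I_k -> 'rV[R]_m) -> \bar R) : \bar R :=
  iint (k * m) (fun v => G (fun i => \row_(j < m) v (i * m + j)%N)).

Definition leb_vol (m : nat) (A : set 'rV[R]_m) : \bar R :=
  leb_int (fun x => (\1_A x : R)%:E).

Definition Gamma (s : R) : R :=
  fine (\int[@lebesgue_measure R]_(t in [set t : R | (0 < t)%R])
          (powR t (s - 1) * expR (- t))%R%:E)%E.

Definition cbeta (m : nat) (beta : R) : R :=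
  Gamma (m%:R / 2 + beta + 1) / (powR pi (m%:R / 2) * Gamma (beta + 1)).

Definition fbeta (m : nat) (beta : R) (x : 'rV[R]_m) : R :=
  if enorm x <= 1 then cbeta m beta * powR (1 - enorm x ^+ 2) beta else 0.

Definition Fgamma (gamma h : R) : R :=
  cbeta 1 gamma *
  fine (\int[@lebesgue_measure R]_(x in `[(-1)%R, h]%classic)
          (powR (1 - x ^+ 2) gamma)%R%:E)%E.

Definition kappa (m : nat) : R :=
  fine (leb_vol [set x : 'rV[R]_m | enorm x <= 1]).

Definition conv_pts (m k : nat) (x : 'I_k -> 'rV[R]_m) : set 'rV[R]_m :=
  [set y | exists w : 'I_k -> R, (forall i, 0 <= w i) /\
                                \sum_(i < k) w i = 1 /\
                                y = \sum_(i < k) w i *: x i].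

Definition aff_hull (m : nat) (A : set 'rV[R]_m) : set 'rV[R]_m :=
  [set y | exists (k : nat) (z : 'I_k -> 'rV[R]_m) (w : 'I_k -> R),
             (forall i, A (z i)) /\ \sum_(i < k) w i = 1 /\
             y = \sum_(i < k) w i *: z i].

Definition aff_indep (m k : nat) (z : 'I_k.+1 -> 'rV[R]_m) : Prop :=
  \rank (\matrix_(i < k, j < m) (z (lift ord0 i) - z ord0) 0 j) = k.

(* F is a facet of the convex set P of R^m: F is the intersection of P with
   a supporting hyperplane, and F has affine dimension m - 1 (it contains m
   affinely independent points; it lies in a hyperplane so its dimension is
   at most m - 1). *)
Definition is_facet (m : nat) (P F : set 'rV[R]_m) : Prop :=
  (exists (u : 'rV[R]_m) (t : R), u != 0 /\
      (forall y, P y -> edot u y <= t) /\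
      F = P `&` [set y | edot u y = t]) /\
  (exists z : 'I_m.-1.+1 -> 'rV[R]_m, (forall i, F (z i)) /\ aff_indep z).

Definition dist0 (m : nat) (A : set 'rV[R]_m) : R :=
  inf [set enorm y | y in A].

(* (m-1)-dimensional volume of a set F lying in an affine hyperplane of R^m:
   the (m-1)-dimensional Lebesgue measure of F read in the coordinates of an
   affine isometric parametrisation z |-> p + z *m M of aff F
   (M has orthonormal rows). *)
Definition hyp_param (m : nat) (F : set 'rV[R]_m) : 'rV[R]_m * 'M[R]_(m.-1, m) :=
  xget (0, 0) [set pM : 'rV[R]_m * 'M[R]_(m.-1, m) |
                 pM.2 *m pM.2^T = 1%:M /\
                 aff_hull F = [set pM.1 + z *m pM.2 | z in [set: 'rV[R]_m.-1]]].

Definition facet_vol (m : nat) (F : set 'rV[R]_m) : R :=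
  fine (leb_vol [set z : 'rV[R]_m.-1 | F ((hyp_param F).1 + z *m (hyp_param F).2)]).

Definition Tab (m : nat) (a b : R) (P : set 'rV[R]_m) : R :=
  (\sum_(F \in [set F | is_facet P F]) powR (dist0 (aff_hull F)) a * powR (facet_vol F) b)%R.

Definition EDelta_pow (k m : nat) (gamma : 'I_k -> R) (p : R) : \bar R :=
  pts_int (fun y : 'I_k -> 'rV[R]_m =>
    (powR (fine (leb_vol (conv_pts y))) p * \prod_(j < k) @fbeta m (gamma j) (y j))%:E).

End Defs.

Arguments fbeta {R} m beta x.
Arguments EDelta_pow {R} k m gamma p.
Arguments kappa {R} m.

(* Main.v *)
(** In d = m + 1 dimensions almost every hyperplane is a graph
    x_0 = s + <p, x'>; its unit normal is (1, -p)/r with r = sqrt(1 + |p|^2), and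
    its signed distance to the origin is h = s/r.  Outside a null set the points
    are in general position, so the facets are the simplices conv(x_I), I an
    increasing d-tuple of indices, such that all other points lie strictly on one
    side of the hyperplane (s, p) through x_I.

    For fixed I, replacing the heights x_{I_j,0} by (s, p) has Jacobian
    |det (1, x'_{I_j})|, which is m! times the volume of the projected simplex;
    this affine Blaschke-Petkantschin argument is the source of the power b + 1.
    A rotation taking the hyperplane to {x_0 = h} and a scaling by sqrt(1 - h^2)
    turn the densities f_{d,beta} on it into multiples of f_{d-1,beta}, and each
    remaining point contributes F(h) or F(-h) for the two sides.  What is left of
    the integrand is r^-(d+1) times a function of h; with ds = r dh the integral
    of r^-d over p produces d kappa_d / 2, and the substitution h -> -h identifies
    the two sides. *)
Require Import Defs.
From HB Require Import structures.
From mathcomp Require Import all_boot all_order all_algebra all_fingroup.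
From mathcomp Require Import all_classical all_reals all_analysis.
From mathcomp Require Import measurable_realfun lebesgue_integral_fubini.
From mathcomp Require Import ring lra zify.
Set Implicit Arguments. Unset Strict Implicit. Unset Printing Implicit Defensive.
Import Order.TTheory GRing.Theory Num.Theory.
Import numFieldNormedType.Exports.
Local Open Scope classical_set_scope.
Local Open Scope ring_scope.

(** The expectation is an iterated one-dimensional integral in [\bar R], and [a], [b] are arbitrary
    reals, so both sides may be [+oo]. The proof therefore works with nonnegative integrands and
    Tonelli's theorem; finiteness is proved only where [fine] must lose nothing ([Gamma], [Fgamma],
    [kappa], volumes). For fixed tails x' the heights of the [d] points are linear in [(s, p)].
    Hence the Blaschke-Petkantschin step, like the rotation and the scaling, is an affine
    substitution, and an LUP factorisation reduces it to [t |-> c t + b] in a single variable.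
    Spherical coordinates and surface measures do not occur: the direction of the normal is encoded
    by [p], and the ball volume is recovered from an integral over [p]. The one special integral is
    that of [(1 - t^2)^s] over [-1, 1], obtained from Gamma integrals; the normalisation, the slices
    and the marginals of the beta densities follow from it by induction on the dimension. Values
    fixed by convention (powers of 0, inverses of singular matrices, degenerate hulls) matter only
    on null sets. *)

Section Meas.
Context d (T : measurableType d) (R : realType).
Implicit Types f g : T -> R.

Lemma measurable_indb (b : T -> bool) :
  measurable_fun setT b -> measurable_fun setT (fun x => (b x)%:R : R).
Proof.
move=> mb; rewrite (_ : (fun x => _) = (\1_(b @^-1` [set true]) : T -> R)).
  by apply: measurable_indic; rewrite -[X in measurable X]setTI; exact: mb.
apply/funext => x; rewrite indicE; case: (boolP (b x)) => bx.
  by rewrite mem_set.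
by rewrite memNset//= (negbTE bx).
Qed.

Lemma measurable_ifR (b : T -> bool) f g : measurable_fun setT b ->
  measurable_fun setT f -> measurable_fun setT g ->
  measurable_fun setT (fun x => if b x then f x else g x).
Proof.
move=> mb mf mg.
rewrite (_ : (fun x => _) = (fun x => (b x)%:R * f x + (1 - (b x)%:R) * g x)).
  apply: measurable_funD; apply: measurable_funM => //; first exact: measurable_indb.
  by apply: measurable_funB => //; exact: measurable_indb.
by apply/funext => x; case: (b x); rewrite /= ?mul1r ?subrr ?mul0r ?addr0 ?subr0 ?mul1r ?add0r.
Qed.

Lemma measurable_pow f p : measurable_fun setT f -> measurable_fun setT (fun x => f x `^ p).
Proof. by move=> mf; exact: (measurableT_comp (measurable_powR p) mf). Qed.

Lemma measurable_exp f : measurable_fun setT f -> measurable_fun setT (fun x => expR (f x)).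
Proof. by move=> mf; exact: (measurableT_comp (@measurable_expR R) mf). Qed.

Lemma measurable_normr f : measurable_fun setT f -> measurable_fun setT (fun x => `|f x|).
Proof. by move=> mf; exact: (measurableT_comp (@normr_measurable R setT) mf). Qed.

Lemma measurable_inv f : measurable_fun setT f -> measurable_fun setT (fun x => (f x)^-1).
Proof.
(* Squaring makes the base nonnegative, where the power -1 is the inverse; where [f x] is 0 both
   sides are 0, since [0^-1] is 0. *)
move=> mf; rewrite (_ : (fun x => _) = (fun x => f x * ((f x ^+ 2) `^ (-1)))).
  by apply: measurable_funM => //; apply: measurable_pow; exact: measurable_funX.
apply/funext => x; have [->|fx0] := eqVneq (f x) 0; first by rewrite invr0 mul0r.
by rewrite powR_inv1 ?sqr_ge0// expr2 invfM mulrA divff// mul1r.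
Qed.

Lemma measurable_sqrtr f : measurable_fun setT f -> measurable_fun setT (fun x => Num.sqrt (f x)).
Proof.
(* On negative arguments [Num.sqrt] is 0 while [powR] is not; the indicator makes up for this. *)
move=> mf; rewrite (_ : (fun x => _) = (fun x => (0 <= f x)%R%:R * (f x) `^ (2^-1))).
  apply: measurable_funM; last exact: measurable_pow.
  by apply: measurable_indb; exact: measurable_fun_ler.
apply/funext => x; case: (lerP 0 (f x)) => fx /=; first by rewrite mul1r powR12_sqrt.
by rewrite mul0r ler0_sqrtr// ltW.
Qed.

Lemma measurable_prodb (I : Type) (s : seq I) (P : pred I) (F : I -> T -> R) :
  (forall i, measurable_fun setT (F i)) ->
  measurable_fun setT (fun x => \prod_(i <- s | P i) F i x).
Proof.
move=> mF; elim: s => [|i s IH].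
  by rewrite (_ : (fun x => _) = cst 1)//; apply/funext => x; rewrite big_nil.
rewrite (_ : (fun x => _) = (fun x => (if P i then F i x else 1) * \prod_(i <- s | P i) F i x)).
  by apply: measurable_funM => //; case: (P i).
by apply/funext => x; rewrite big_cons; case: (P i); rewrite ?mul1r.
Qed.

Lemma measurable_sumb (I : Type) (s : seq I) (P : pred I) (F : I -> T -> R) :
  (forall i, measurable_fun setT (F i)) ->
  measurable_fun setT (fun x => \sum_(i <- s | P i) F i x).
Proof.
move=> mF; elim: s => [|i s IH].
  by rewrite (_ : (fun x => _) = cst 0)//; apply/funext => x; rewrite big_nil.
rewrite (_ : (fun x => _) = (fun x => (if P i then F i x else 0) + \sum_(i <- s | P i) F i x)).
  by apply: measurable_funD => //; case: (P i).
by apply/funext => x; rewrite big_cons; case: (P i); rewrite ?add0r.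
Qed.

Lemma measurable_EF f : measurable_fun setT f -> measurable_fun setT (fun x => (f x)%:E).
Proof. by move=> mf; exact/measurable_EFinP. Qed.

Lemma measurable_lt f g : measurable_fun setT f -> measurable_fun setT g ->
  measurable_fun setT (fun x => f x < g x).
Proof. exact: measurable_fun_ltr. Qed.

Lemma measurable_le f g : measurable_fun setT f -> measurable_fun setT g ->
  measurable_fun setT (fun x => f x <= g x).
Proof. exact: measurable_fun_ler. Qed.

Lemma measurable_eqb f g : measurable_fun setT f -> measurable_fun setT g ->
  measurable_fun setT (fun x => f x == g x).
Proof. exact: measurable_fun_eqr. Qed.

Lemma measurable_neb f g : measurable_fun setT f -> measurable_fun setT g ->
  measurable_fun setT (fun x => f x != g x).
Proof. by move=> mf mg; apply: measurable_neg; exact: measurable_fun_eqr. Qed.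

End Meas.

Ltac meas := repeat first
  [ exact: measurable_cst | exact: measurable_id | assumption
  | apply: measurable_EF | apply: emeasurable_funD | apply: emeasurable_funM
  | apply: measurable_sumb => ? | apply: measurable_prodb => ?
  | apply: measurable_inv | apply: measurable_exp | apply: measurable_pow
  | apply: measurable_sqrtr | apply: measurable_normr
  | apply: measurable_funX
  | apply: measurable_funB
  | apply: measurable_funD | apply: measurable_funM
  | apply: measurable_funN
  | apply: measurable_ifR
  | apply: measurable_indb
  | apply: measurable_lt | apply: measurable_le | apply: measurable_eqb | apply: measurable_neb
  | apply: measurable_and | apply: measurable_or ].

(** * Iterated integrals over families of real variables *)

(* The coordinates of all points are variables indexed by [V]; a state assigns
   them real values.  [st] carries the sigma-algebra generated by the
   coordinates, so that Tonelli's theorem can be used one variable at a time. *)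
Definition cylinders (R : realType) (V : Type) : set (set (V -> R)) :=
  [set A | exists a (B : set R), measurable B /\ A = [set v | B (v a)]].

Definition st (R : realType) (V : Type) : Type := V -> R.

HB.instance Definition _ (R : realType) (V : Type) :=
  Measurable.copy (st R V) (g_sigma_algebraType (@cylinders R V)).

Section States.
Variable R : realType.
Local Notation mu := (@lebesgue_measure R).

Lemma measurable_coord (V : Type) (a : V) :
  measurable_fun setT (fun v : st R V => v a).
Proof.
move=> _ B mB; rewrite setTI; apply: sub_sigma_algebra.
by exists a, B.
Qed.

Lemma measurable_st (V : Type) d (T : measurableType d) (f : T -> st R V) :
  (forall a, measurable_fun setT (fun x => f x a)) -> measurable_fun setT f.
Proof.
move=> mf; apply: (@measurability _ _ T (st R V) setT f (@cylinders R V)) => //.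
move=> _ [_ [a [B [mB ->]]] <-].
exact: (mf a).
Qed.

Section Upd.
Variable V : eqType.
Implicit Types (v : V -> R) (a b : V) (t : R).

Definition upd v a t : V -> R := fun b => if b == a then t else v b.

Lemma updE v a t b : upd v a t b = if b == a then t else v b.
Proof. by []. Qed.

Lemma upd_same v a t t' : upd (upd v a t) a t' = upd v a t'.
Proof. by apply/funext => b; rewrite /upd; case: eqP. Qed.

Lemma updC v a b t t' : a != b -> upd (upd v a t) b t' = upd (upd v b t') a t.
Proof.
move=> ab; apply/funext => c; rewrite /upd.
by case: (eqVneq c b) => [->|//]; rewrite eq_sym (negbTE ab).
Qed.

Lemma measurable_upd a :
  measurable_fun setT (fun x : st R V * R => (upd x.1 a x.2 : st R V)).
Proof.
apply: measurable_st => b; rewrite /upd; case: (b == a).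
  exact: measurable_snd.
exact: (measurableT_comp (measurable_coord b) measurable_fst).
Qed.

Lemma measurable_upd2 v a : measurable_fun setT (fun t : R => (upd v a t : st R V)).
Proof.
apply: measurable_st => b; rewrite /upd; case: (b == a) => //.
Qed.

Local Open Scope ereal_scope.

(* Integrates over the variables in [s], outermost first; the variables outside
   [s] keep their values in [v]. *)
Fixpoint II (s : seq V) (F : (V -> R) -> \bar R) v : \bar R :=
  match s with
  | [::] => F v
  | a :: s' => \int[mu]_t II s' F (upd v a t)
  end.

Implicit Types (F G : (V -> R) -> \bar R) (s : seq V).

Definition mea (F : (V -> R) -> \bar R) := @measurable_fun _ _ (st R V) (\bar R) setT F.

Lemma II_cat s1 s2 F : II (s1 ++ s2) F = II s1 (II s2 F).
Proof.
apply/funext => v; elim: s1 v => [//|a s1 IH] v /=.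
by apply: eq_integral => t _; rewrite IH.
Qed.

Lemma II_ge0 s F v : (forall v, 0 <= F v) -> 0 <= II s F v.
Proof.
move=> F0; elim: s v => [//|a s IH] v /=; apply: integral_ge0 => t _; exact: IH.
Qed.

Lemma mea_II1 a F : mea F -> (forall v, 0 <= F v) ->
  mea (fun v => \int[mu]_t F (upd v a t)).
Proof.
move=> mF F0.
apply: (measurable_fun_fubini_tonelli_F (m2 := mu)
  (fun x : st R V * R => F (upd x.1 a x.2))) => //.
exact: (measurableT_comp mF (measurable_upd a)).
Qed.

Lemma mea_II s F : mea F -> (forall v, 0 <= F v) -> mea (II s F).
Proof.
move=> mF F0; elim: s => [//|a s IH] /=; apply: mea_II1 => // v; exact: II_ge0.
Qed.

Lemma mea_sec F v a : mea F -> measurable_fun setT (fun t : R => F (upd v a t)).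
Proof. by move=> mF; exact: (measurableT_comp mF (measurable_upd2 v a)). Qed.

Lemma mea_sec2 F v a b : mea F ->
  measurable_fun setT (fun x : R * R => F (upd (upd v a x.1) b x.2)).
Proof.
move=> mF.
have mg : measurable_fun setT (fun x : R * R => (upd (upd v a x.1) b x.2 : st R V)).
  apply: measurable_st => c; rewrite /upd; case: (c == b); first exact: measurable_snd.
  by case: (c == a); [exact: measurable_fst | exact: measurable_cst].
exact: (measurableT_comp mF mg).
Qed.

Lemma II_swap a b s F : mea F -> (forall v, 0 <= F v) ->
  II (a :: b :: s) F = II (b :: a :: s) F.
Proof.
move=> mF F0; have [->//|ab] := eqVneq a b.
apply/funext => v /=.
rewrite (fubini_tonelli (m1 := mu) (m2 := mu)
  (fun x : measurableTypeR R * measurableTypeR R => II s F (upd (upd v a x.1) b x.2)))/=.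
- by apply: eq_integral => t _; apply: eq_integral => t' _; rewrite updC.
- by apply: mea_sec2; exact: mea_II.
- by move=> x; exact: II_ge0.
Qed.

Lemma II_rem a s F : a \in s -> mea F -> (forall v, 0 <= F v) ->
  II s F = II (a :: rem a s) F.
Proof.
move=> + mF F0; elim: s => [//|b s IH]; rewrite inE /=.
have [->//|ba /= sa] := eqVneq b a.
transitivity (II [:: b] (II s F)); first by [].
by rewrite (IH sa) -II_cat/= -/(II [:: b, a & rem a s] F) II_swap.
Qed.

(** Takes the place of Fubini for a product measure: Tonelli swaps adjacent variables, and such
    swaps generate all orders. Any block of variables can thus be made innermost or outermost. *)
Lemma II_perm s1 s2 F : perm_eq s1 s2 -> mea F -> (forall v, 0 <= F v) ->
  II s1 F = II s2 F.
Proof.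
move=> + mF F0; elim: s1 s2 => [|a s1 IH] s2.
  by rewrite perm_sym => /perm_nilP ->.
move=> p12; have as2 : a \in s2 by rewrite -(perm_mem p12) mem_head.
rewrite (II_rem as2)//.
have /IH p : perm_eq s1 (rem a s2).
  by rewrite -(perm_cons a); apply: (perm_trans p12); exact: perm_to_rem.
by rewrite -cat1s II_cat p -II_cat.
Qed.

(** Inside [II s] only states that agree with [v] off [s] occur, so outer variables count as
    constants when integrands are compared. *)
Lemma eq_II s F G v : (forall u, (forall b, b \notin s -> u b = v b) -> F u = G u) ->
  II s F v = II s G v.
Proof.
elim: s v => [|a s IH] v FG /=; first exact: FG.
apply: eq_integral => t _; apply: IH => u uv; apply: FG => b.
rewrite inE negb_or => /andP[ba bs]; rewrite uv// /upd (negbTE ba)//.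
Qed.

Lemma II_off s F v v' : (forall b, b \notin s -> v b = v' b) -> II s F v = II s F v'.
Proof.
elim: s v v' => [|a s IH] v v' vv' /=; first by congr F; apply/funext => b; apply: vv'.
apply: eq_integral => t _; apply: IH => b bs; rewrite /upd.
by case: (eqVneq b a) => // ba; apply: vv'; rewrite inE negb_or ba.
Qed.

Lemma II_ext s F G : F =1 G -> II s F = II s G.
Proof. by move=> /funext ->. Qed.

Lemma II_updC s F v a t : a \notin s -> II s F (upd v a t) = II s (fun u => F (upd u a t)) v.
Proof.
elim: s v => [//|b s IH] v; rewrite inE negb_or => /andP[ab as_] /=.
by apply: eq_integral => t' _; rewrite updC// IH.
Qed.

Lemma II_scale s F (k : \bar R) v : mea F -> (forall v, 0 <= F v) -> 0 <= k ->
  II s (fun u => k * F u) v = k * II s F v.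
Proof.
move=> mF F0 k0; elim: s v => [//|a s IH] v /=.
under eq_integral do rewrite IH.
rewrite ge0_integralZl//; last by move=> *; exact: II_ge0.
by apply: mea_sec; exact: mea_II.
Qed.

Lemma II_factor s F G v : mea F -> (forall v, 0 <= F v) -> 0 <= G v ->
  (forall u, (forall b, b \notin s -> u b = v b) -> G u = G v) ->
  II s (fun u => G u * F u) v = G v * II s F v.
Proof.
move=> mF F0 G0 Gv; rewrite -II_scale//; apply: eq_II => u uv; rewrite (Gv u)//.
Qed.

Lemma II_sum s (I : Type) (r : seq I) (P : pred I) (F : I -> (V -> R) -> \bar R) v :
  (forall i, P i -> mea (F i)) -> (forall i v, P i -> 0 <= F i v) ->
  II s (fun u => \sum_(i <- r | P i) F i u) v = \sum_(i <- r | P i) II s (F i) v.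
Proof.
move=> mF F0; elim: s v => [//|a s IH] v /=.
under eq_integral do rewrite IH.
transitivity (\int[mu]_t \sum_(i <- r) (if P i then II s (F i) (upd v a t) else 0)).
  by apply: eq_integral => t _; rewrite big_mkcond.
rewrite ge0_integral_sum//.
- by rewrite [RHS]big_mkcond; apply: eq_bigr => i _; case: (P i) => //; rewrite integral0.
- by move=> i; case Pi: (P i) => //; apply: mea_sec; apply: mea_II; [exact: mF|move=> *; exact: F0].
- by move=> i t _; case Pi: (P i) => //; apply: II_ge0 => *; exact: F0.
Qed.

Lemma II_add s F G v : mea F -> mea G -> (forall v, 0 <= F v) -> (forall v, 0 <= G v) ->
  II s (fun u => F u + G u) v = II s F v + II s G v.
Proof.
move=> mF mG F0 G0; elim: s v => [//|a s IH] v /=.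
under eq_integral do rewrite IH.
by rewrite ge0_integralD//; (try by move=> *; exact: II_ge0); by apply: mea_sec; exact: mea_II.
Qed.

Lemma II_blind s1 s F v v' :
  (forall u u', (forall b, b \notin s1 -> u b = u' b) -> F u = F u') ->
  (forall b, b \notin s1 -> v b = v' b) -> II s F v = II s F v'.
Proof.
move=> Fs; elim: s v v' => [|a s IH] v v' vv' /=; first exact: Fs.
apply: eq_integral => t _; apply: IH => b bs; rewrite /upd.
by case: (b == a) => //; exact: vv'.
Qed.

(** The form in which independence enters: each factor ignores the variables of the other block. *)
Lemma II_prod s1 s2 F G v : mea F -> mea G -> (forall v, 0 <= F v) -> (forall v, 0 <= G v) ->
  (forall u u', (forall b, b \notin s2 -> u b = u' b) -> F u = F u') ->
  (forall u u', (forall b, b \notin s1 -> u b = u' b) -> G u = G u') ->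
  II (s1 ++ s2) (fun u => F u * G u) v = II s1 F v * II s2 G v.
Proof.
move=> mF mG F0 G0 Fs Gs; rewrite II_cat muleC -II_scale//; last exact: II_ge0.
apply: eq_II => u uv; rewrite II_factor//; last by move=> u' uu'; apply: Fs.
by rewrite muleC (@II_blind s1 s2 _ u v).
Qed.

End Upd.
End States.

(** * One-dimensional substitution and exceptional null sets *)

Section Affine1.
Variable R : realType.
Local Notation mu := (@lebesgue_measure R).
Local Open Scope ereal_scope.

Lemma measurable_affine (c b : R) :
  measurable_fun setT (fun t : measurableTypeR R => (c * t + b)%R : measurableTypeR R).
Proof. by apply: measurable_funD => //; exact: mulrl_measurable. Qed.

(** [|c|] times the push-forward of [mu] under [t |-> c t + b] agrees with [mu] on half-open
    intervals, hence everywhere by uniqueness of Lebesgue measure. Later substitutions reduce to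
    this one and to reorderings of variables. *)
Lemma integral_affine (f : R -> \bar R) (c b : R) : c != 0%R ->
  measurable_fun setT f -> (forall t, 0 <= f t) ->
  \int[mu]_t f t = `|c|%:E * \int[mu]_t f (c * t + b)%R.
Proof.
move=> c0 mf f0.
pose phi := fun t : measurableTypeR R => (c * t + b)%R : measurableTypeR R.
have mphi : measurable_fun setT phi by exact: measurable_affine.
pose nu := [the measure _ _ of pushforward mu phi : set (measurableTypeR R) -> \bar R].
have c1 : (0 <= `|c|)%R by [].
pose nu' := mscale (NngNum c1) (nu mphi).
have nuE A : measurable A -> mu A = nu' A.
  move=> mA; apply: lebesgue_measure_unique => //.
  move=> _ [[x y]] /= _ <-.
  rewrite /nu' /mscale /=.
  (* For negative [c] the preimage of an interval open on the left and closed on the right is closed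
     on the left and open on the right, hence the two shapes. *)
  have -> : pushforward mu phi `]x, y]%classic =
    mu [set` if (0 < c)%R then `]((x - b) / c)%R, ((y - b) / c)%R] else `[((y - b) / c)%R, ((x - b) / c)%R[].
    rewrite /pushforward; congr (mu _); apply/seteqP; split => t /=; rewrite /phi.
      case: ltP => c0'; rewrite !in_itv/= => /andP[]; rewrite -ltrBlDr -lerBrDr.
        by rewrite ltr_pdivrMr// ler_pdivlMr// mulrC => -> ->.
      have {}c0' : (c < 0)%R by rewrite lt_neqAle c0.
      by rewrite ltr_ndivlMr// ler_ndivrMr// (mulrC t) => -> ->.
    case: ltP => c0'; rewrite !in_itv/= -ltrBlDr -lerBrDr => /andP[].
      by rewrite ltr_pdivrMr// ler_pdivlMr// mulrC => -> ->.
    have {}c0' : (c < 0)%R by rewrite lt_neqAle c0.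
    by rewrite ltr_ndivlMr// ler_ndivrMr// (mulrC t) => -> ->.
  rewrite [LHS]lebesgue_measure_itv/=.
  case: (ltP 0%R c) => c0'.
    rewrite lebesgue_measure_itv/= !lte_fin ltr_pM2r ?invr_gt0// ltrD2r.
    case: ifP => xy; last by rewrite mule0.
    rewrite gtr0_norm// -!EFinD -EFinM; congr EFin.
    by field.
  have {}c0' : (c < 0)%R by rewrite lt_neqAle c0.
  rewrite lebesgue_measure_itv/= !lte_fin ltr_nM2r ?invr_lt0// ltrD2r.
  case: ifP => xy; last by rewrite mule0.
  rewrite ltr0_norm// -!EFinD -EFinM; congr EFin.
  by field.
transitivity (\int[nu']_t f t).
  by apply: eq_measure_integral => A mA _; exact: nuE.
rewrite ge0_integral_mscale//; congr (_ * _).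
by rewrite ge0_integral_pushforward.
Qed.

End Affine1.

Section AE.
Variable R : realType.
Local Notation mu := (@lebesgue_measure R).
Local Open Scope ereal_scope.
Import HBNNSimple.

(* [f] and [g] need not be measurable: the integral of a nonnegative function is
   a supremum over the simple functions below it.  Hence [Tab] can be
   replaced by an a.e. equal measurable function without being proved measurable. *)
Lemma le_lower_integral (f g h : R -> \bar R) :
  measurable_fun setT h -> (forall t, 0 <= h t) -> \int[mu]_t h t = 0 ->
  (forall t, 0 <= f t) -> (forall t, 0 <= g t) ->
  (forall t, h t = 0 -> f t = g t) -> \int[mu]_t f t <= \int[mu]_t g t.
Proof.
move=> mh h0 ih f0 g0 fg.
pose N : set R := [set t | h t = 0].
have mN : measurable N.
  have := mh measurableT [set 0] (emeasurable_set1 _); rewrite setTI.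
  by congr (measurable _); apply/seteqP; split.
have muNC : mu (~` N) = 0.
  have : \int[mu]_t `|h t| = 0.
    by rewrite -[RHS]ih; apply: eq_integral => t _; rewrite gee0_abs.
  move/(ae_eq_integral_abs mu measurableT mh) => [A [mA A0 sA]].
  apply/eqP; rewrite eq_le measure_ge0 andbT -A0.
  apply: le_measure; rewrite ?inE//; first exact: measurableC.
  move=> t /= Nt; apply: sA => /= H; apply: Nt; exact: H.
rewrite [leLHS]ge0_integralTE//.
apply: ge_ereal_sup => /= x [k /= kf <-].
rewrite -integralT_nnsfun.
rewrite (_ : \int[mu]_t (k t)%:E = \int[mu]_t ((k t)%:E * (\1_N t)%:E)); last first.
  apply: ae_eq_integral => //.
  - by apply: measurableT_comp => //.
  - apply: emeasurable_funM; first by apply: measurableT_comp => //.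
    by apply: measurableT_comp => //; exact: measurable_indic.
  - exists (~` N); split => //; first exact: measurableC.
    move=> t /= H Nt; apply: H => _; rewrite indicE mem_set// mule1 //.
have mN1 : measurable_fun setT (\1_N : R -> R) by exact: measurable_indic.
pose k' : {nnsfun measurableTypeR R >-> R} := proj_nnsfun k mN.
rewrite (_ : (fun t => _) = (fun t => (k' t)%:E)); last first.
  by apply/funext => t; rewrite -EFinM /k' /= /mindic.
rewrite integralT_nnsfun [leRHS]ge0_integralTE//.
apply: ereal_sup_ubound; exists k' => //= t.
rewrite /k' /= /mindic indicE; have [tN|tN] := boolP (t \in N).
  by rewrite mulr1 -fg//; exact: set_mem.
by rewrite mulr0.
Qed.

Lemma lower_integral_ae (f g h : R -> \bar R) :
  measurable_fun setT h -> (forall t, 0 <= h t) -> \int[mu]_t h t = 0 ->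
  (forall t, 0 <= f t) -> (forall t, 0 <= g t) ->
  (forall t, h t = 0 -> f t = g t) -> \int[mu]_t f t = \int[mu]_t g t.
Proof.
move=> mh h0 ih f0 g0 fg; apply/eqP; rewrite eq_le.
rewrite (le_lower_integral mh)//= (le_lower_integral mh)// => t ht.
by rewrite fg.
Qed.

(** The exceptional set is coded by a measurable [Z] with integral 0. Then the inner integral of [Z]
    vanishes for almost every value of the outer variable, which is just what the induction over the
    variables needs. *)
Lemma II_ae (V : eqType) (s : seq V) (F G Z : (V -> R) -> \bar R) v :
  mea Z -> (forall u, 0 <= Z u) -> (forall u, 0 <= F u) -> (forall u, 0 <= G u) ->
  II s Z v = 0 -> (forall u, Z u = 0 -> F u = G u) -> II s F v = II s G v.
Proof.
move=> mZ Z0 F0 G0 + FG; elim: s v => [|a s IH] v /= IZ; first exact: FG.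
apply: (@lower_integral_ae _ _ (fun t => II s Z (upd v a t))) => //.
- by apply: mea_sec; exact: mea_II.
- by move=> t; exact: II_ge0.
- by move=> t; exact: II_ge0.
- by move=> t; exact: II_ge0.
- by move=> t; exact: IH.
Qed.

Lemma II_map (V V' : eqType) (g : V' -> V) (s : seq V') (G : (V' -> R) -> \bar R) v :
  injective g -> II (map g s) (fun u => G (u \o g)) v = II s G (v \o g).
Proof.
move=> gi; elim: s v => [//|a s IH] v /=.
apply: eq_integral => t _; rewrite IH; congr (II s G _).
by apply/funext => b; rewrite /upd /= (inj_eq gi).
Qed.

Lemma II_affine1 (V : eqType) (a : V) (F : (V -> R) -> \bar R) (c : R) (b : (V -> R) -> R) v :
  c != 0%R -> mea F -> (forall u, 0 <= F u) ->
  (forall u t, b (upd u a t) = b u) ->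
  II [:: a] F v = `|c|%:E * II [:: a] (fun u => F (upd u a (c * u a + b u)%R)) v.
Proof.
move=> c0 mF F0 bE /=; rewrite (@integral_affine R (fun t => F (upd v a t)) c (b v))//; last first.
  exact: mea_sec.
by congr (_ * _); apply: eq_integral => t _; rewrite bE updE eqxx upd_same.
Qed.

Lemma mea_comp (V V' : eqType) (F : (V -> R) -> \bar R) (phi : (V' -> R) -> (V -> R)) :
  mea F -> (forall a, measurable_fun setT (fun u : st R V' => phi u a)) ->
  mea (fun u => F (phi u)).
Proof.
move=> mF mphi; have mp : measurable_fun setT (phi : st R V' -> st R V) by exact: measurable_st.
exact: (measurableT_comp mF mp).
Qed.
End AE.

(** * Linear changes of variables *)

Section Linear.
Variables (R : realType) (V : eqType) (m : nat) (a : 'I_m -> V).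
Hypothesis ai : injective a.
Local Notation mu := (@lebesgue_measure R).

Definition setv (v : V -> R) (w : 'I_m -> R) : V -> R :=
  fun b => if [pick i | a i == b] is Some i then w i else v b.

Lemma setv_in v w i : setv v w (a i) = w i.
Proof.
rewrite /setv; case: pickP => [j /eqP/ai ->//|/(_ i)]; by rewrite eqxx.
Qed.

Lemma setv_out v w b : (forall i, a i != b) -> setv v w b = v b.
Proof. by move=> ab; rewrite /setv; case: pickP => // j; rewrite (negbTE (ab j)). Qed.

Lemma eq_state (u u' : V -> R) : (forall i, u (a i) = u' (a i)) ->
  (forall b, (forall i, a i != b) -> u b = u' b) -> u = u'.
Proof.
move=> H1 H2; apply/funext => b.
case: (pickP (fun i => a i == b)) => [i /eqP <-//|H].
by apply: H2 => i; rewrite H.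
Qed.

Definition lin (A : 'M[R]_m) (u : V -> R) : V -> R :=
  setv u (fun i => \sum_j A i j * u (a j)).

Lemma lin_in A u i : lin A u (a i) = \sum_j A i j * u (a j).
Proof. exact: setv_in. Qed.

Lemma lin_out A u b : (forall i, a i != b) -> lin A u b = u b.
Proof. exact: setv_out. Qed.

Lemma lin_mul A B u : lin A (lin B u) = lin (A *m B) u.
Proof.
apply: eq_state => [i|b Hb]; last by rewrite !lin_out.
rewrite !lin_in; under eq_bigr do rewrite lin_in mulr_sumr.
rewrite exchange_big /=; apply: eq_bigr => k _; rewrite mxE mulr_suml.
by apply: eq_bigr => j _; rewrite mulrA.
Qed.

Lemma measurable_lin A b : measurable_fun setT (fun u : st R V => lin A u b).
Proof.
rewrite /lin /setv; case: pickP => [i _|_]; last exact: measurable_coord.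
apply: measurable_sum => j; apply: measurable_funM => //; exact: measurable_coord.
Qed.

Definition avars := map a (enum 'I_m).

Lemma avars_uniq : uniq avars. Proof. by rewrite map_inj_uniq ?enum_uniq. Qed.

Lemma mem_avars i : a i \in avars. Proof. by apply: map_f; rewrite mem_enum. Qed.

Lemma notin_avars b : b \notin avars -> forall i, a i != b.
Proof. by move=> + i; apply: contraNneq => <-; exact: mem_avars. Qed.

Local Open Scope ereal_scope.

(** A predicate on matrices that is closed under products, so that it need only be checked on the
    factors of an LUP decomposition. *)
Definition linok (A : 'M[R]_m) := forall F v, mea F -> (forall u, 0 <= F u) ->
  II avars F v = `|\det A|%R%:E * II avars (fun u => F (lin A u)) v.

Lemma linok_mul A B : linok A -> linok B -> linok (A *m B).
Proof.
move=> okA okB F v mF F0; rewrite okA// (okB (fun u => F (lin A u)))//; last first.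
  by apply: mea_comp => // b; exact: measurable_lin.
rewrite muleA -EFinM -normrM -det_mulmx; congr (_ * _).
by apply: eq_II => u _; rewrite lin_mul.
Qed.

Lemma linok_perm (s : 'S_m) : linok (perm_mx s).
Proof.
move=> F v mF F0.
rewrite det_perm normrX normrN1 expr1n mul1e.
(* [g] permutes the variables [a i] by [s] and fixes all others; it is injective on [V], and the
   permutation matrix merely renames variables along it. *)
pose g b := if [pick i | a i == b] is Some i then a (s i) else b.
have ga i : g (a i) = a (s i).
  by rewrite /g; case: pickP => [j /eqP/ai ->//|/(_ i)]; rewrite eqxx.
have go b : (forall i, a i != b) -> g b = b.
  by move=> ab; rewrite /g; case: pickP => // j; rewrite (negbTE (ab j)).
have gi : injective g.
  move=> b c; case: (pickP (fun i => a i == b)) => [i /eqP <-|Hb]; case: (pickP (fun i => a i == c)) => [j /eqP <-|Hc].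
  - by rewrite !ga => /ai/perm_inj ->.
  - rewrite ga go => [H|k]; last by rewrite Hc.
    by move: (Hc (s i)); rewrite H eqxx.
  - rewrite ga go => [H|k]; last by rewrite Hb.
    by move: (Hb (s j)); rewrite H eqxx.
  - by rewrite !go => // k; rewrite ?Hb ?Hc.
have -> : (fun u => F (lin (perm_mx s) u)) = (fun u => F (u \o g)).
  apply/funext => u; congr F; apply: eq_state => [i|b Hb]; last by rewrite lin_out//= go.
  rewrite lin_in/= ga (bigD1 (s i))//= big1 ?addr0; first by rewrite !mxE eqxx mul1r.
  by move=> j js; rewrite !mxE eq_sym (negbTE js) mul0r.
have ps : perm_eq avars (map g avars).
  apply: uniq_perm; [exact: avars_uniq | by rewrite (map_inj_uniq gi) avars_uniq |].
  move=> b; apply/mapP/mapP => [[i _ ->]|[c /mapP[i _ ->] ->]].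
    by exists (a (s^-1%g i)); rewrite ?mem_avars// ga permKV.
  by rewrite ga; exists (s i); rewrite ?mem_enum.
rewrite [RHS](congr1 (fun f => f v) (II_perm ps _ _))//; last first.
  by apply: mea_comp => // b; exact: measurable_coord.
rewrite II_map//; apply: II_off => b bs; rewrite /= go//; exact: notin_avars.
Qed.

(** With [a k] innermost the map is a one-variable affine substitution with slope [A k k]; the other
    variables only contribute to the constant term. *)
Lemma linok_row (A : 'M[R]_m) k : (forall i j, i != k -> A i j = (i == j)%:R) ->
  A k k != 0%R -> linok A.
Proof.
move=> A1 Ak F v mF F0.
have detA : \det A = A k k.
  rewrite (expand_det_col _ k) (bigD1 k)//= big1 ?addr0 => [|i ik]; last first.
    by rewrite A1// (negbTE ik) mul0r.
  rewrite /cofactor addnn -signr_odd odd_double expr0 mul1r.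
  rewrite (_ : row' k (col' k A) = 1%:M) ?det1 ?mulr1//.
  apply/matrixP => i j; rewrite !mxE A1; last by rewrite eq_sym neq_lift.
  by rewrite (inj_eq lift_inj).
have ak := mem_avars k.
have mlin : mea (fun u => F (lin A u)).
  by apply: mea_comp => // b; exact: measurable_lin.
pose s' := rem (a k) avars.
have ps : perm_eq avars (s' ++ [:: a k]).
  by apply: (perm_trans (perm_to_rem ak)); rewrite cats1 perm_sym perm_rcons.
rewrite !(II_perm ps)// !II_cat detA -II_scale//; last 2 first.
- by apply: mea_II.
- by move=> u; exact: II_ge0.
apply: eq_II => u _.
rewrite (@II_affine1 _ _ _ F (A k k) (fun u => \sum_(j | j != k) A k j * u (a j))%R)//; last first.
  move=> w t; apply: eq_bigr => j jk; rewrite updE (inj_eq ai) (negbTE jk)//.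
congr (_ * _); apply: eq_II => w _; congr F; apply: eq_state => [i|b Hb].
  rewrite lin_in updE (inj_eq ai); case: (eqVneq i k) => [->|ik].
    by rewrite [RHS](bigD1 k).
  rewrite (bigD1 i)//= A1// eqxx mul1r big1 ?addr0// => j ji.
  by rewrite A1// eq_sym (negbTE ji) mul0r.
rewrite lin_out// updE; case: eqP => // bk; by move: (Hb k); rewrite bk eqxx.
Qed.

(** The ranking [r] covers lower and upper triangular matrices at once. [TK K] keeps the rows of
    rank at least [K] and has identity rows elsewhere; rows are inserted one at a time, from the
    highest rank downwards. *)
Lemma linok_triangular (r : 'I_m -> nat) (T : 'M[R]_m) : injective r ->
  (forall i j, i != j -> (r i <= r j)%N -> T i j = 0%R) -> (forall i, T i i != 0%R) ->
  linok T.
Proof.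
move=> ri T0 Td.
pose TK K : 'M[R]_m := \matrix_(i, j) if (K <= r i)%N then T i j else (i == j)%:R.
have [N rN] : exists N, forall i, (r i < N)%N.
  by exists (\max_i r i).+1 => i; rewrite ltnS; exact: leq_bigmax.
suff H k : (k <= N)%N -> linok (TK (N - k)%N).
  have := H N (leqnn N); rewrite subnn.
  by congr linok; apply/matrixP => i j; rewrite mxE.
elim: k => [_|k IH kN].
  rewrite subn0 (_ : TK N = perm_mx 1); first exact: linok_perm.
  by apply/matrixP => i j; rewrite !mxE leqNgt rN /= perm1.
have {}IH := IH (ltnW kN).
case: (pickP (fun i => r i == (N - k.+1)%N)) => [i /eqP ik|Hk]; last first.
  rewrite (_ : TK _ = TK (N - k)%N)//; apply/matrixP => i j; rewrite !mxE.
  congr (if _ then _ else _); apply/idP/idP => h; last by lia.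
  by move: (Hk i) => /eqP; lia.
(* Row [i] of [T] involves only [i] and indices of lower rank, whose rows in [TK (N - k)] are still
   those of the identity; so left multiplication by [E] inserts row [i] unchanged. *)
pose E : 'M[R]_m := \matrix_(i', j) if i' == i then T i j else (i' == j)%:R.
rewrite (_ : TK _ = E *m TK (N - k)%N); last first.
  apply/matrixP => i' j; rewrite !mxE; have [->|i'i] := eqVneq i' i.
    rewrite ik leqnn (bigD1 j)//= !mxE eqxx.
    rewrite big1 ?addr0 => [|l lj]; last first.
      rewrite !mxE eqxx (negbTE lj); case: ifP => h; last by rewrite mulr0.
      by rewrite T0 ?mul0r//; [apply: contraTneq h => <-; lia|lia].
    case: ifP => h; last by rewrite eqxx mulr1.
    have [ij|ij] := eqVneq i j; last by rewrite T0 ?mul0r//; lia.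
    by move: h; rewrite -ij; lia.
  rewrite (bigD1 i')//= big1 ?addr0 => [|l li']; last first.
    by rewrite !mxE (negbTE i'i) eq_sym (negbTE li') mul0r.
  rewrite !mxE (negbTE i'i) eqxx mul1r; congr (if _ then _ else _).
  apply/idP/idP => h; last by lia.
  have : r i' != r i by apply: contraNneq i'i => /ri ->.
  by lia.
apply: linok_mul => //; apply: (@linok_row _ i) => [i' j i'i|]; rewrite mxE ?eqxx//.
by rewrite (negbTE i'i).
Qed.

End Linear.

Section LinearMain.
Variables (R : realType) (V : eqType).
Local Open Scope ereal_scope.

Theorem II_lin (m : nat) (a : 'I_m -> V) (A : 'M[R]_m) F v : injective a ->
  A \in unitmx -> mea F -> (forall u, 0 <= F u) ->
  II (avars a) F v = `|\det A|%R%:E * II (avars a) (fun u => F (lin a A u)) v.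
Proof.
move=> ai uA; suff H : linok a A by move=> mF F0; exact: H.
(* The LUP decomposition concerns matrices of positive size; the empty matrix is a permutation
   matrix. *)
case: m a ai A uA => [|m] a ai A uA.
  rewrite (_ : A = perm_mx 1); first exact: linok_perm.
  by apply/matrixP => -[].
have := cormen_lup_correct A.
have := @cormen_lup_perm _ _ A; have := @cormen_lup_lower _ _ A; have := @cormen_lup_upper _ _ A.
have := @cormen_lup_detL _ _ A.
case: cormen_lup => [[P L U]] /= detL Uu Ll /is_perm_mxP[s ->] PA.
have -> : A = perm_mx s^-1 *m (L *m U).
  by rewrite -[L *m U]/(L * U)%R -PA mulmxA -perm_mxM mulVg perm_mx1 mul1mx.
apply: linok_mul => //; first exact: linok_perm.
have uU : forall i, U i i != 0%R.
  have := uA; rewrite unitmxE unitfE => dA.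
  have : \det U != 0%R.
    have : \det (perm_mx s *m A) = \det (L *m U) by rewrite -[L *m U]/(L * U)%R -PA.
    rewrite !det_mulmx detL mul1r => <-; rewrite mulf_neq0// det_perm signr_eq0//.
  rewrite -det_tr det_trig; last first.
    by apply/is_trig_mxP => i j ij; rewrite mxE Uu.
  by move=> /prodf_neq0 H i; have := H i isT; rewrite mxE.
apply: linok_mul => //.
  apply: (@linok_triangular _ _ _ _ _ (fun i => nat_of_ord i)) => //; first exact: ord_inj.
    by move=> i j ij ij'; rewrite Ll// (negbTE ij).
  by move=> i; rewrite Ll// eqxx oner_neq0.
apply: (@linok_triangular _ _ _ _ _ (fun i : 'I_m.+1 => (m - i)%N)) => //.
  by move=> i j ij; apply: ord_inj; have := ltn_ord i; have := ltn_ord j; lia.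
move=> i j ij h; apply: Uu; have := ltn_ord i; have := ltn_ord j.
by move: ij; rewrite -val_eqE /=; lia.
Qed.

End LinearMain.

(** * Affine substitutions and the iterated integrals of the statement *)

Section Aff.
Variables (R : realType).
Local Notation mu := (@lebesgue_measure R).
Local Open Scope ereal_scope.

Lemma II_translate (V : eqType) (s : seq V) (F : (V -> R) -> \bar R) (c v : V -> R) :
  mea F -> (forall u, 0 <= F u) ->
  II s (fun u => F (fun b => u b + c b)%R) v = II s F (fun b => v b + c b)%R.
Proof.
move=> mF F0; elim: s v => [//|a s IH] v /=.
rewrite [RHS](@integral_affine R _ 1 (c a))//; last 2 first.
- by apply: mea_sec; exact: mea_II.
- by move=> t; exact: II_ge0.
rewrite normr1 mul1e; apply: eq_integral => t _; rewrite IH; congr (II s F _).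
by apply/funext => b; rewrite /upd; case: eqP => // ->; rewrite mul1r.
Qed.

Definition aff (V : eqType) (m : nat) (a : 'I_m -> V) (A : 'M[R]_m) (c : 'I_m -> R) (u : V -> R) :=
  setv a u (fun i => \sum_j A i j * u (a j) + c i)%R.

Lemma aff_in (V : eqType) (m : nat) (a : 'I_m -> V) A c u i : injective a ->
  aff a A c u (a i) = (\sum_j A i j * u (a j) + c i)%R.
Proof. by move=> ai; exact: setv_in. Qed.

Lemma aff_out (V : eqType) (m : nat) (a : 'I_m -> V) A c u b : (forall i, a i != b) ->
  aff a A c u b = u b.
Proof. exact: setv_out. Qed.

Lemma measurable_setv (V : eqType) (m : nat) (a : 'I_m -> V) (w : (V -> R) -> 'I_m -> R) b :
  (forall i, measurable_fun setT (fun u : st R V => w u i)) ->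
  measurable_fun setT (fun u : st R V => setv a u (w u) b).
Proof.
move=> mw; rewrite /setv; case: pickP => [i _|_]; [exact: mw|exact: measurable_coord].
Qed.

Lemma measurable_aff (V : eqType) (m : nat) (a : 'I_m -> V) A c b :
  measurable_fun setT (fun u : st R V => aff a A c u b).
Proof.
apply: measurable_setv => i; apply: measurable_funD => //.
apply: measurable_sum => j; apply: measurable_funM => //; exact: measurable_coord.
Qed.

Lemma II_aff (V : eqType) (m : nat) (a : 'I_m -> V) (A : 'M[R]_m) c F v : injective a ->
  A \in unitmx -> mea F -> (forall u, 0 <= F u) ->
  II (avars a) F v = `|\det A|%R%:E * II (avars a) (fun u => F (aff a A c u)) v.
Proof.
move=> ai uA mF F0.
pose c' := setv a (fun=> 0%R) c.
transitivity (II (avars a) (fun u => F (fun b => u b + c' b)%R) v).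
  rewrite II_translate//; apply: II_off => b bs.
  by rewrite /c' setv_out ?addr0//; exact: notin_avars.
rewrite (II_lin _ ai uA)//; last first.
  apply: (@mea_comp _ _ _ F (fun u b => u b + c' b)%R) => // b.
  by apply: measurable_funD => //; exact: measurable_coord.
congr (_ * _); apply: eq_II => u _; congr F; apply: (eq_state (a := a)) => [i|b Hb].
  by rewrite aff_in// lin_in// /c' setv_in.
by rewrite aff_out// lin_out// /c' setv_out// addr0.
Qed.

Definition mint (W : finType) (F : (W -> R) -> \bar R) : \bar R := II (enum W) F (fun=> 0%R).

(** [iint] has its last coordinate outermost, hence the reversed list. *)
Lemma iintE k (F : (nat -> R) -> \bar R) : iint k F = II (rev (iota 0 k)) F (fun=> 0%R).
Proof.
elim: k F => [//|k IH] F.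
rewrite -addn1 iotaD add0n rev_cat /= addn1 /=; apply: eq_integral => t _.
rewrite II_updC ?IH// mem_rev mem_iota add0n ltnn andbF//.
Qed.

Lemma mint_ge0 (W : finType) (F : (W -> R) -> \bar R) : (forall u, 0 <= F u) -> 0 <= mint F.
Proof. by move=> F0; exact: II_ge0. Qed.

Lemma II_mint (V : eqType) (W : finType) (g : W -> V) (F : (W -> R) -> \bar R) s v :
  injective g -> perm_eq s (map g (enum W)) -> mea F -> (forall u, 0 <= F u) ->
  II s (fun u => F (u \o g)) v = mint F.
Proof.
move=> gi ps mF F0; rewrite (II_perm ps)//; last first.
  by apply: (@mea_comp _ _ _ F (fun u => u \o g)) => // b; exact: measurable_coord.
by rewrite II_map//; apply: II_off => b; rewrite mem_enum.
Qed.

Definition pt (k m : nat) (u : 'I_k * 'I_m -> R) (i : 'I_k) : 'rV[R]_m := \row_j u (i, j).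

Definition enc (k m : nat) (x : 'I_k * 'I_m) : nat := (x.1 * m + x.2)%N.

Lemma enc_inj k m : injective (@enc k m).
Proof.
move=> [i j] [i' j']; rewrite /enc/= => H.
have m0 : (0 < m)%N by apply: leq_ltn_trans (ltn_ord j).
have Hi : i = i' :> nat.
  have := congr1 (fun x => x %/ m)%N H.
  by rewrite !divnMDl// !divn_small// !addn0.
have Hj : j = j' :> nat by move: H; rewrite Hi => /addnI.
by congr pair; apply: ord_inj.
Qed.

Lemma perm_enc k m : perm_eq (rev (iota 0 (k * m))) (map (@enc k m) (enum {: 'I_k * 'I_m})).
Proof.
apply: uniq_perm; rewrite ?rev_uniq ?iota_uniq ?(map_inj_uniq (@enc_inj k m)) ?enum_uniq// => x.
rewrite mem_rev mem_iota add0n /=; apply/idP/mapP => [xkm|[[i j] _ ->]]; last first.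
  rewrite /enc/=; have := ltn_ord i; have := ltn_ord j; nia.
have m0 : (0 < m)%N by case: m xkm => //; rewrite muln0.
have xi : (x %/ m < k)%N by rewrite ltn_divLR.
have xj : (x %% m < m)%N by rewrite ltn_mod.
by exists (Ordinal xi, Ordinal xj); rewrite ?mem_enum// /enc /= -divn_eq.
Qed.

Lemma pts_intE k m (G : ('I_k -> 'rV[R]_m) -> \bar R) :
  mea (fun u => G (pt u)) -> (forall x, 0 <= G x) ->
  pts_int G = mint (fun u => G (pt u)).
Proof.
move=> mG G0; rewrite /pts_int iintE.
transitivity (II (rev (iota 0 (k * m))) (fun u => G (pt (u \o @enc k m))) (fun=> 0%R)).
  by apply: eq_II => u _; congr G; apply/funext => i; apply/rowP => j; rewrite !mxE.
apply: (@II_mint _ _ (@enc k m) (fun u => G (pt u))) => //; [exact: enc_inj|exact: perm_enc].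
Qed.

Lemma pts_int_ae k m (G H : ('I_k -> 'rV[R]_m) -> \bar R) (Z : ('I_k * 'I_m -> R) -> \bar R) :
  mea Z -> (forall u, 0 <= Z u) -> (forall x, 0 <= G x) -> (forall x, 0 <= H x) ->
  mint Z = 0 -> (forall u, Z u = 0 -> G (pt u) = H (pt u)) -> pts_int G = pts_int H.
Proof.
move=> mZ Z0 G0 H0 IZ GH; rewrite /pts_int !iintE.
apply: (@II_ae _ _ _ _ _ (fun u => Z (u \o @enc k m))) => //.
- by apply: (@mea_comp _ _ _ Z (fun u => u \o @enc k m)) => // b; exact: measurable_coord.
- rewrite -IZ; apply: (@II_mint _ _ (@enc k m)) => //; [exact: enc_inj|exact: perm_enc].
- move=> u Zu; have := GH _ Zu.
  have -> // : pt (u \o @enc k m) = (fun i => \row_j u (i * m + j)%N).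
  by apply/funext => i; apply/rowP => j; rewrite !mxE.
Qed.

Lemma leb_intE m (F : 'rV[R]_m -> \bar R) :
  mea (fun u : 'I_m -> R => F (\row_j u j)) -> (forall x, 0 <= F x) ->
  leb_int F = mint (fun u : 'I_m -> R => F (\row_j u j)).
Proof.
move=> mF F0; rewrite /leb_int iintE.
apply: (@II_mint _ _ (@nat_of_ord m) (fun u => F (\row_j u j))) => //; first exact: ord_inj.
apply: uniq_perm; rewrite ?rev_uniq ?iota_uniq ?(map_inj_uniq (@ord_inj m)) ?enum_uniq// => x.
rewrite mem_rev mem_iota add0n /=; apply/idP/mapP => [xm|[j _ ->]//].
by exists (Ordinal xm); rewrite ?mem_enum.
Qed.

End Aff.

Ltac iside := try solve [ by meas | by move=> *; rewrite ?lee_fin ?mulr_ge0 ?powR_ge0 ?expR_ge0 ].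

(** * Gamma and beta integrals *)

Section GammaFun.
Variable R : realType.
Local Notation mu := (@lebesgue_measure R).
Implicit Types s t : R.
Local Open Scope ereal_scope.

Lemma pow1R s : (1 `^ s = 1)%R.
Proof. by rewrite powR1. Qed.

Definition gint s : \bar R := \int[mu]_t ((0 < t)%R%:R * (t `^ (s - 1) * expR (- t)))%R%:E.

Lemma GammaE s : Gamma s = fine (gint s).
Proof.
rewrite /Gamma integral_mkcond; congr fine; apply: eq_integral => t _.
rewrite patchE; case: ifPn => [/set_mem /= ->|]; first by rewrite mul1r.
by rewrite notin_setE /= => /negP/negbTE ->; rewrite mul0r.
Qed.

Lemma halfX_cvg t : (0 < t)%R -> exists N, forall n, (N <= n)%N -> ((2^-1) ^+ n < t)%R.
Proof.
move=> t0; exists (Num.bound t^-1) => n nN.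
rewrite exprVn invf_plt ?posrE ?exprn_gt0//.
apply: (lt_le_trans (archi_boundP _)); first by rewrite invr_ge0 ltW.
rewrite -natrX ler_nat; apply: (leq_trans nN); exact/ltnW/ltn_expl.
Qed.

Definition pstep s n t : R := (((2^-1) ^+ n < t <= 1)%R%:R * t `^ (s - 1))%R.

Lemma pstep_ge0 s n t : (0 <= pstep s n t)%R.
Proof. by rewrite mulr_ge0 ?powR_ge0. Qed.

Lemma measurable_pstep s n : measurable_fun setT (fun t : R => (pstep s n t)%:E).
Proof. by rewrite /pstep; meas. Qed.

(** Self-similarity replaces an antiderivative: the part on []1/2, 1]] is at most [M], and halving
    the variable maps the rest to [q] times the previous truncation, with [q = 2^-s < 1]. The bound
    is the geometric series [M / (1 - q)]. *)
Lemma int_pstep s n : (0 < s)%R ->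
  \int[mu]_t (pstep s n t)%:E <= ((1 + (2^-1) `^ (s - 1)) / (1 - (2^-1) `^ s))%R%:E.
Proof.
move=> s0; set M := (1 + _)%R; set q := ((2^-1) `^ s)%R.
have q1 : (q < 1)%R.
  by rewrite -[ltRHS](pow1R s) gt0_ltr_powR ?nnegrE//; lra.
have M0 : (0 <= M)%R by rewrite addr_ge0// powR_ge0.
have q0 : (0 < 1 - q)%R by rewrite subr_gt0.
elim: n => [|n IH].
  rewrite (_ : (fun t => _) = cst 0%E); last first.
    apply/funext => t; rewrite /pstep expr0 /=; congr EFin.
    by case: ltrP => h; rewrite mul0r.
  by rewrite integral0 lee_fin divr_ge0// ltW.
pose f1 t := pstep s 1 t.
pose f2 t : R := (((2^-1) ^+ n.+1 < t <= 2^-1)%R%:R * t `^ (s - 1))%R.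
have f20 t : (0 <= f2 t)%R by rewrite mulr_ge0 ?powR_ge0.
have mf2 : measurable_fun setT (fun t : R => (f2 t)%:E) by rewrite /f2; meas.
have le1 : ((2^-1 : R) ^+ n.+1 <= 2^-1)%R.
  by rewrite -[leRHS]expr1 ler_wiXn2l//; lra.
rewrite (_ : (fun t => _) = (fun t => (f1 t)%:E + (f2 t)%:E)); last first.
  apply/funext => t; rewrite -EFinD; congr EFin; rewrite /f1 /f2 /pstep expr1 -mulrDl; congr (_ * _)%R.
  rewrite -natrD; congr (_%:R).
  case: (ltrP (2^-1)%R t) => h; case: (lerP t 1%R) => h'; rewrite ?andbT ?andbF//=.
    by rewrite (le_lt_trans le1 h).
  by exfalso; lra.
have p0 k : forall t, [set: R] t -> 0 <= (pstep s k t)%:E.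
  by move=> t _; rewrite lee_fin pstep_ge0.
rewrite ge0_integralD//; try solve [exact: measurable_pstep | exact: p0 | by move=> ? _; rewrite lee_fin].
have h1 : \int[mu]_t (f1 t)%:E <= M%:E.
  apply: (@le_trans _ _ (\int[mu]_t (M%:E * (\1_(`]0%R, 1%R]%classic) t)%:E))); last first.
    rewrite ge0_integralZl_EFin//.
    - by rewrite integral_indic//= setIT lebesgue_measure_itv/= lte_fin ltr01 oppr0 adde0 mule1.
    - by apply: measurable_EF; apply: measurable_indic.
  apply: ge0_le_integral => //.
  - by move=> t _; rewrite lee_fin pstep_ge0.
  - exact: measurable_pstep.
  - by apply: measurable_funeM; apply: measurable_EF; apply: measurable_indic.
  - move=> t _; rewrite -EFinM lee_fin /f1 /pstep expr1 indicE mem_setE in_itv/=.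
    case: (ltrP (2^-1)%R t) => h; last by rewrite mul0r mulr_ge0.
    case: (lerP t 1%R) => h' /=; last by rewrite mul0r mulr_ge0.
    have t0 : (0 < t)%R by lra.
    rewrite t0/= mul1r mulr1 /M.
    have [s1|s1] := lerP 0 (s - 1)%R.
      apply: (@le_trans _ _ 1%R); last by rewrite lerDl powR_ge0.
      by rewrite -[leRHS](pow1R (s - 1)%R) ge0_ler_powR// nnegrE; lra.
    apply: (@le_trans _ _ ((2^-1) `^ (s - 1))%R); last by rewrite lerDr.
    have [p p_ge0 ->] : exists2 p, (0 <= p)%R & (s - 1 = - p)%R by exists (1 - s)%R; lra.
    rewrite !powRN lef_pV2 ?posrE ?powR_gt0//.
    by rewrite ge0_ler_powR// ?nnegrE; lra.
have h20 : (2^-1 != 0 :> R)%R by rewrite invr_eq0 pnatr_eq0.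
rewrite (@integral_affine R (fun t => (f2 t)%:E) (2^-1)%R 0%R)//.
have -> : (fun t => (f2 (2^-1 * t + 0)%R)%:E) = (fun t => ((2^-1) `^ (s - 1))%R%:E * (pstep s n t)%:E).
  apply/funext => t; rewrite -EFinM; congr EFin; rewrite /f2 /pstep addr0 exprS.
  rewrite ltr_pM2l// -[X in (_ <= X)%R]mulr1 ler_pM2l// mulrCA.
  case: ltrP => h; last by rewrite !mul0r.
  congr (_ * _)%R; rewrite powRM//; apply: ltW; apply: le_lt_trans h; exact: exprn_ge0.
rewrite ge0_integralZl_EFin ?powR_ge0//; try solve [exact: measurable_pstep | exact: p0 | by move=> ? _; rewrite lee_fin].
rewrite muleA -EFinM ger0_norm// mulr_powRB1//.
apply: (@le_trans _ _ (M%:E + q%:E * (M / (1 - q))%:E)).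
  by apply: leeD => //; apply: lee_pmul => //; rewrite ?lee_fin ?powR_ge0// integral_ge0// => t _; rewrite lee_fin pstep_ge0.
rewrite -EFinM -EFinD lee_fin le_eqVlt; apply/orP; left; apply/eqP.
field; lra.
Qed.

Lemma int_powR01_lty s : (0 < s)%R ->
  \int[mu]_t ((0 < t <= 1)%R%:R * t `^ (s - 1))%R%:E < +oo.
Proof.
move=> s0.
have -> : (fun t => ((0 < t <= 1)%R%:R * t `^ (s - 1))%R%:E) = (fun t => limn (fun n => (pstep s n t)%:E)).
  apply/funext => t; apply/esym/cvg_lim => //.
  have [t0|t0] := lerP t 0%R.
    rewrite (_ : (fun n => _) = cst (0 * t `^ (s - 1))%R%:E); first exact: cvg_cst.
    apply/funext => n; rewrite /pstep; case: ltrP => // h; exfalso.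
    by have := lt_le_trans h t0; rewrite ltNge exprn_ge0.
  have [N HN] := halfX_cvg t0.
  rewrite -(cvg_shiftn N)/= (_ : (fun n => _) = cst ((true && (t <= 1))%R%:R * t `^ (s - 1))%R%:E); first exact: cvg_cst.
  by apply/funext => n; rewrite /pstep HN// leq_addl.
rewrite monotone_convergence//; last 3 first.
- by move=> n; exact: measurable_pstep.
- by move=> n t _; rewrite lee_fin pstep_ge0.
- move=> t _ m n mn; rewrite lee_fin /pstep ler_wpM2r ?powR_ge0// ler_nat.
  case: (ltrP ((2^-1) ^+ m)%R t) => // h.
  rewrite (_ : ((2^-1) ^+ n < t)%R) ?leqnn//; apply: le_lt_trans h.
  by rewrite ler_wiXn2l//; lra.
apply: le_lt_trans (ltry _); apply: lime_le; last by apply: nearW => n; apply: int_pstep.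
apply: ereal_nondecreasing_is_cvgn => m n mn; apply: ge0_le_integral => //.
- by move=> t _; rewrite lee_fin pstep_ge0.
- exact: measurable_pstep.
- exact: measurable_pstep.
- move=> t _; rewrite lee_fin /pstep ler_wpM2r ?powR_ge0// ler_nat.
  case: (ltrP ((2^-1) ^+ m)%R t) => // h.
  rewrite (_ : ((2^-1) ^+ n < t)%R) ?leqnn//; apply: le_lt_trans h.
  by rewrite ler_wiXn2l//; lra.
Qed.


Lemma gint_integrand_ge0 s t : 0 <= ((0 < t)%R%:R * (t `^ (s - 1) * expR (- t)))%R%:E.
Proof. by rewrite lee_fin !mulr_ge0 ?powR_ge0 ?expR_ge0. Qed.

(** For a natural [N >= p], apply [1 + x <= expR x] to [x = t / (2 N)] and take the [N]-th power. *)
Lemma powR_le_expR p : exists2 K, (0 <= K)%R & forall t, (1 <= t)%R -> (t `^ p <= K * expR (t / 2))%R.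
Proof.
have [N [N0 pN]] : exists N, (0 < N)%N /\ (p <= N%:R)%R.
  exists (Num.bound `|p|).+1; split => //.
  apply: (le_trans (ler_norm p)); apply: ltW; apply: (lt_trans (archi_boundP (normr_ge0 p))).
  by rewrite ltr_nat.
exists ((2 * N%:R) ^+ N)%R; first by rewrite exprn_ge0// mulr_ge0.
move=> t t1; apply: (@le_trans _ _ (t ^+ N)%R).
  by rewrite -powR_mulrn; [exact: ler_powR|lra].
have N0' : (0 < N%:R :> R)%R by rewrite ltr0n.
have -> : (expR (t / 2) = expR (t / (2 * N%:R)) ^+ N)%R.
  by rewrite -expRM_natl; congr expR; field; rewrite lt0r_neq0.
have hA : (0 <= 2 * N%:R * expR (t / (2 * N%:R)))%R by rewrite !mulr_ge0 ?expR_ge0.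
have hB : (0 <= t)%R by lra.
rewrite -exprMn lerXn2r//.
have := expR_ge1Dx (t / (2 * N%:R)).
rewrite -[X in (_ <= X)%R -> _](mulKf (lt0r_neq0 N0')) => h.
rewrite -ler_pdivrMl ?mulr_gt0//; apply: le_trans (expR_ge1Dx _).
by rewrite mulrC lerDr.
Qed.

(** Near 0 the integrand is at most [t^(s-1)]; beyond 1 it is at most [K expR (- t / 2)], which is
    [2 K] times the exponential density of rate 1/2. *)
Lemma gint_lty s : (0 < s)%R -> gint s < +oo.
Proof.
move=> s0; have [K K0 HK] := powR_le_expR (s - 1).
have h20 : (0 < 2^-1 :> R)%R by lra.
have E0 (t : R) : (0 <= exponential_pdf (2^-1) t)%R by apply: exponential_pdf_ge0; lra.
have mE : measurable_fun setT (fun t => exponential_pdf (2^-1 : R) t).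
  by apply: measurable_exponential_pdf; lra.
apply: (@le_lt_trans _ _ (\int[mu]_t (((0 < t <= 1)%R%:R * t `^ (s - 1))%R%:E
    + (2 * K)%:E * (exponential_pdf (2^-1) t)%:E))).
  apply: ge0_le_integral => //.
  - by move=> t _; exact: gint_integrand_ge0.
  - by meas.
  - by apply: emeasurable_funD; [by meas|apply: measurable_funeM; meas].
  move=> t _; rewrite -EFinM -EFinD lee_fin.
  have [t0|t0] := ltrP 0%R t; last by rewrite !mul0r addr_ge0// !mulr_ge0.
  have [t1|t1] := lerP t 1%R => /=; rewrite !mul1r.
    rewrite -[leLHS]addr0 lerD// ?mulr_ge0//.
    by rewrite ler_piMr ?powR_ge0// -expR0 ler_expR; lra.
  rewrite mul0r add0r exponential_pdfE ?(ltW t0)//.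
  apply: (@le_trans _ _ (K * expR (t / 2) * expR (- t))%R).
    by rewrite ler_wpM2r ?expR_ge0//; apply: HK; exact: ltW.
  have -> : (2 * K * (2^-1 * expR (- 2^-1 * t)) = K * expR (- 2^-1 * t))%R by field.
  rewrite -mulrA ler_wpM2l// -expRD ler_expR; lra.
rewrite ge0_integralD//; iside.
rewrite ge0_integralZl_EFin ?mulr_ge0//; iside.
by rewrite integral_exponential_pdf// mule1 lte_add_pinfty ?ltry// int_powR01_lty.
Qed.

Lemma gint_gt0 s : 0 < gint s.
Proof.
rewrite lt_neqAle integral_ge0 ?andbT; last by move=> t _; exact: gint_integrand_ge0.
apply/eqP => /esym H.
have mf : measurable_fun setT (fun t : R => ((0 < t)%R%:R * (t `^ (s - 1) * expR (- t)))%R%:E) by meas.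
have : \int[mu]_t `|((0 < t)%R%:R * (t `^ (s - 1) * expR (- t)))%R%:E| = 0.
  by rewrite -[RHS]H; apply: eq_integral => t _; rewrite gee0_abs//; exact: gint_integrand_ge0.
move/(ae_eq_integral_abs mu measurableT mf) => [A [mA A0 sA]].
have : mu `]0%R, 1%R]%classic <= mu A.
  apply: le_measure; rewrite ?inE//.
  move=> t /=; rewrite in_itv/= => /andP[t0 _]; apply: sA => /= /(_ Logic.I) /eqP.
  rewrite t0 mul1r eqe mulf_eq0 powR_eq0 gt_eqF//= => /eqP h.
  by have := expR_gt0 (- t); rewrite h ltxx.
by rewrite A0 lebesgue_measure_itv/= lte_fin ltr01 oppr0 adde0 lee_fin ler10.
Qed.

Lemma Gamma_gt0 s : (0 < s)%R -> (0 < Gamma s)%R.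
Proof.
move=> s0; rewrite GammaE fine_gt0// gint_gt0/=; exact: gint_lty.
Qed.

Lemma Gamma_gint s : (0 < s)%R -> (Gamma s)%:E = gint s.
Proof.
move=> s0; rewrite GammaE fineK// ge0_fin_numE; first exact: gint_lty.
exact/ltW/gint_gt0.
Qed.

Definition bint s : \bar R := \int[mu]_t ((t ^+ 2 < 1)%R%:R * (1 - t ^+ 2) `^ s)%R%:E.

(* Both sides are the integral of (y - x^2)^s e^-y over the region x^2 < y. *)
Lemma gauss_gamma_bint s : (-1 < s)%R ->
  (Num.sqrt pi)%:E * gint (s + 1) = gint (s + 3 / 2) * bint s.
Proof.
move=> s1.
pose f (x : measurableTypeR R * measurableTypeR R) : \bar R :=
  ((x.1 ^+ 2 < x.2)%R%:R * ((x.2 - x.1 ^+ 2) `^ s * expR (- x.2)))%R%:E.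
have mf : measurable_fun setT f by rewrite /f; meas; try exact: measurable_fst; exact: measurable_snd.
have f0 x : 0 <= f x by rewrite lee_fin !mulr_ge0 ?powR_ge0 ?expR_ge0.
transitivity (\int[mu]_t \int[mu]_y f (t, y)).
  have g0 : 0 <= gint (s + 1) by exact/ltW/gint_gt0.
  rewrite -integralT_gauss muleC -ge0_integralZl//; iside.
  apply: eq_integral => t _.
  rewrite muleC /gint -ge0_integralZl//; iside.
  (* The shift by [t^2] splits [expR (- y)] into the Gaussian in [t] and the Gamma integrand. *)
  rewrite [LHS](@integral_affine R _ 1%R (- t ^+ 2)%R)//; iside.
  rewrite normr1 mul1e; apply: eq_integral => y _.
  rewrite -EFinM /f /= mul1r addrK; congr EFin.
  rewrite subr_gt0 mulrCA; congr (_ * _)%R; rewrite mulrCA; congr (_ * _)%R.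
  by rewrite /gauss_fun -expRD; congr expR; ring.
rewrite (fubini_tonelli (m1 := mu) (m2 := mu))//.
have b0 : 0 <= bint s by apply: integral_ge0 => t _; rewrite lee_fin mulr_ge0 ?powR_ge0.
rewrite muleC /gint -ge0_integralZl//; iside.
apply: eq_integral => y _; rewrite muleC.
have [y0|y0] := ltrP 0%R y; last first.
  rewrite mul0r mul0e; apply: integral0_eq => t _; rewrite /f/=.
  by rewrite ltNge (le_trans y0 (sqr_ge0 _)) mul0r.
have sy0 : (0 < Num.sqrt y)%R by rewrite sqrtr_gt0.
(* In the other order, scaling [x] by [Num.sqrt y] turns the slice [x^2 < y] into the interval of
   [bint], with the factor [y^(s + 1/2)]. *)
rewrite (@integral_affine R _ (Num.sqrt y) 0%R) ?lt0r_neq0//; iside.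
rewrite -ge0_integralZl//; iside.
rewrite mul1r -ge0_integralZl_EFin//; iside.
apply: eq_integral => t _; rewrite /f /= -!EFinM addr0 exprMn sqr_sqrtr ?(ltW y0)//.
congr EFin; rewrite -[X in (_ < X)%R]mulr1 ltr_pM2l//.
rewrite ger0_norm ?(ltW sy0)//.
have [t1|t1] := ltrP (t ^+ 2)%R 1%R; last by rewrite !mul0r !mulr0.
rewrite !mul1r -{2}[y]mulr1 -mulrBr powRM ?(ltW y0)//; last by lra.
rewrite -powR12_sqrt ?(ltW y0)//.
have -> : (s + 3 / 2 - 1 = s + 2^-1)%R by lra.
rewrite powRD ?(gt_eqF y0) ?implybT//.
by ring.
Qed.

Lemma bintE s : (-1 < s)%R ->
  bint s = (Num.sqrt pi * Gamma (s + 1) / Gamma (s + 3 / 2))%R%:E.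
Proof.
move=> s1; have := gauss_gamma_bint s1.
have G1 : (0 < Gamma (s + 1))%R by apply: Gamma_gt0; lra.
have G2 : (0 < Gamma (s + 3 / 2))%R by apply: Gamma_gt0; lra.
have [h1 h2] : ((0 < s + 1) /\ (0 < s + 3 / 2))%R by split; lra.
rewrite -!Gamma_gint//.
have b0 : 0 <= bint s by apply: integral_ge0 => t _; rewrite lee_fin mulr_ge0 ?powR_ge0.
(* Division is legitimate once [bint s = +oo] is excluded; it would make the finite left-hand side
   infinite. *)
case: (bint s) b0 => [b _|_|//].
  by rewrite -!EFinM => -[->]; congr EFin; field; rewrite gt_eqF.
by rewrite mulry gtr0_sg// mul1e -EFinM.
Qed.

End GammaFun.

(** * Integrals over row vectors and slices of the beta densities *)

Section Lint.
Variable R : realType.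
Local Notation mu := (@lebesgue_measure R).

Definition rv m (u : 'I_m -> R) : 'rV[R]_m := \row_j u j.

Definition mrow m (G : 'rV[R]_m -> \bar R) := mea (fun u => G (rv u)).

Definition Lint m (G : 'rV[R]_m -> \bar R) : \bar R := mint (fun u => G (rv u)).

(** Serves both for a point with height [t] and tail [w] and, with [t = 1], for the homogeneous
    coordinates of [w]. *)
Definition hv m (t : R) (w : 'rV[R]_m) : 'rV[R]_m.+1 := row_mx (t%:M : 'rV_1) w.

Lemma hv0 m t (w : 'rV[R]_m) : hv t w 0 ord0 = t.
Proof.
rewrite /hv (_ : ord0 = lshift m (ord0 : 'I_1)); last exact: val_inj.
by rewrite (@row_mxEl _ _ 1) mxE eqxx mulr1n.
Qed.

Lemma hvS m t (w : 'rV[R]_m) j : hv t w 0 (lift ord0 j) = w 0 j.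
Proof.
rewrite /hv (_ : lift ord0 j = rshift 1 j); last exact: val_inj.
by rewrite (@row_mxEr _ _ 1).
Qed.

Lemma hvP m (x : 'rV[R]_m.+1) : x = hv (x 0 ord0) (\row_j x 0 (lift ord0 j)).
Proof.
apply/rowP => i; case: (unliftP ord0 i) => [j ->|->].
  by rewrite hvS mxE.
by rewrite hv0.
Qed.

Lemma edot_hv m t s (w v : 'rV[R]_m) : edot (hv t w) (hv s v) = t * s + edot w v.
Proof.
rewrite /edot big_ord_recl !hv0; congr (_ + _).
by apply: eq_bigr => i _; rewrite !hvS.
Qed.

Lemma edotE m (u v : 'rV[R]_m) : edot u v = (u *m v^T) 0 0.
Proof. by rewrite /edot mxE; apply: eq_bigr => j _; rewrite mxE. Qed.

Lemma edot_ge0 m (u : 'rV[R]_m) : 0 <= edot u u.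
Proof. by apply: sumr_ge0 => j _; rewrite -expr2 sqr_ge0. Qed.

Lemma enorm_ge0 m (u : 'rV[R]_m) : 0 <= enorm u.
Proof. exact: sqrtr_ge0. Qed.

Lemma enorm_sqr m (u : 'rV[R]_m) : enorm u ^+ 2 = edot u u.
Proof. by rewrite sqr_sqrtr// edot_ge0. Qed.

Lemma enorm_le1 m (u : 'rV[R]_m) : (enorm u <= 1) = (edot u u <= 1).
Proof. by rewrite -[X in _ <= X]sqrtr1 ler_psqrt// ?nnegrE// edot_ge0. Qed.

Lemma fbetaE m b (x : 'rV[R]_m) :
  fbeta m b x = if edot x x <= 1 then cbeta m b * (1 - edot x x) `^ b else 0.
Proof. by rewrite /fbeta enorm_le1 enorm_sqr. Qed.

Lemma measurable_edot m d (T : measurableType d) (x y : T -> 'rV[R]_m) :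
  (forall j, measurable_fun setT (fun t => x t 0 j)) ->
  (forall j, measurable_fun setT (fun t => y t 0 j)) ->
  measurable_fun setT (fun t => edot (x t) (y t)).
Proof. by move=> mx my; rewrite /edot; meas. Qed.

Lemma measurable_fbeta m b d (T : measurableType d) (x : T -> 'rV[R]_m) :
  (forall j, measurable_fun setT (fun t => x t 0 j)) ->
  measurable_fun setT (fun t => fbeta m b (x t)).
Proof.
move=> mx; have mxx : measurable_fun setT (fun t => edot (x t) (x t)) by exact: measurable_edot.
rewrite (_ : (fun t => _) = fun t => if edot (x t) (x t) <= 1 then cbeta m b * (1 - edot (x t) (x t)) `^ b else 0).
  by meas.
by apply/funext => t; rewrite fbetaE.
Qed.

Local Open Scope ereal_scope.

(** Disposes of finitely many points such as [h = 1] and [h = -1], where a power of 0 has a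
    conventional value. *)
Lemma integral_off_seq (s : seq R) (f g : R -> \bar R) :
  (forall t, 0 <= f t) -> (forall t, 0 <= g t) ->
  (forall t, t \notin s -> f t = g t) -> \int[mu]_t f t = \int[mu]_t g t.
Proof.
move=> f0 g0 fg; have mS : measurable ([set` s] : set R).
  exact: (countable_measurable (@measurable_set1 R) (finite_set_countable (finite_seq s))).
apply: (@lower_integral_ae _ _ _ (fun t => (\1_([set` s]) t : R)%:E)) => //.
- by apply: measurable_EF; exact: measurable_indic.
- by rewrite integral_indic//= setIT (countable_lebesgue_measure0 (finite_set_countable (finite_seq s))).
- move=> t; rewrite indicE; case: (boolP (t \in _)) => [_ /eqP|ts _]; first by rewrite eqe oner_eq0.
  by apply: fg; apply: contra ts => ts; rewrite inE.
Qed.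

Definition scons m (t : R) (w : 'I_m -> R) : 'I_m.+1 -> R :=
  fun i => if unlift ord0 i is Some j then w j else t.

Lemma rv_scons m t (w : 'I_m -> R) : rv (scons t w) = hv t (rv w).
Proof.
apply/rowP => i; rewrite mxE /scons; case: (unliftP ord0 i) => [j ->|->].
  by rewrite hvS mxE.
by rewrite hv0.
Qed.

Lemma scons_eta m (u : 'I_m.+1 -> R) : u = scons (u ord0) (u \o lift ord0).
Proof.
by apply/funext => i; rewrite /scons; case: (unliftP ord0 i) => [j ->|->].
Qed.

Lemma measurable_scons m t i : measurable_fun setT (fun w : st R 'I_m => scons t w i).
Proof. by rewrite /scons; case: (unlift ord0 i) => [j|//]; exact: measurable_coord. Qed.

Lemma mint_consl m (F : ('I_m.+1 -> R) -> \bar R) : mea F -> (forall u, 0 <= F u) ->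
  mint F = \int[mu]_t mint (fun w : 'I_m -> R => F (scons t w)).
Proof.
move=> mF F0; rewrite /mint enum_ordSl /=; apply: eq_integral => t _.
rewrite -[RHS](@II_mint R 'I_m.+1 'I_m (lift ord0) (fun w => F (scons t w))
  [seq lift ord0 i | i <- enum 'I_m] (upd (fun=> 0%R) ord0 t))//; last 2 first.
- exact: lift_inj.
- by apply: (@mea_comp _ _ _ F (scons t)) => // b; exact: measurable_scons.
apply: eq_II => u uv; rewrite {1}(scons_eta u) uv ?updE//.
by apply/mapP => -[j _].
Qed.

Lemma mint_consr m (F : ('I_m.+1 -> R) -> \bar R) : mea F -> (forall u, 0 <= F u) ->
  mint F = mint (fun w : 'I_m -> R => \int[mu]_t F (scons t w)).
Proof.
move=> mF F0; rewrite /mint enum_ordSl.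
rewrite (_ : _ :: _ = [:: ord0] ++ [seq lift ord0 i | i <- enum 'I_m])//.
rewrite (II_perm (permEl (perm_catC _ _)))// II_cat.
rewrite (@II_ext _ _ _ _ (fun u => \int[mu]_t F (scons t (u \o lift ord0)))); last first.
  move=> u /=; apply: eq_integral => t _; congr F; rewrite [LHS]scons_eta updE eqxx.
  by congr (scons t _); apply/funext => j.
have mF' : measurable_fun setT (fun x : st R 'I_m * measurableTypeR R => F (scons x.2 x.1)).
  have mg : measurable_fun setT (fun x : st R 'I_m * measurableTypeR R => (scons x.2 x.1 : st R 'I_m.+1)).
    apply: measurable_st => b; rewrite /scons; case: (unlift ord0 b) => [j|].
      exact: (measurableT_comp (measurable_coord j) measurable_fst).
    exact: measurable_snd.
  exact: (measurableT_comp mF mg).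
apply: (@II_mint R 'I_m.+1 'I_m (lift ord0) (fun w => \int[mu]_t F (scons t w))) => //.
- exact: lift_inj.
- exact: (measurable_fun_fubini_tonelli_F (m2 := mu) (fun x : st R 'I_m * measurableTypeR R => F (scons x.2 x.1))).
- by move=> u; exact: integral_ge0.
Qed.

Lemma Lint_consl m (G : 'rV[R]_m.+1 -> \bar R) : mrow G -> (forall x, 0 <= G x) ->
  Lint G = \int[mu]_t Lint (fun w : 'rV[R]_m => G (hv t w)).
Proof.
move=> mG G0; rewrite /Lint mint_consl//; apply: eq_integral => t _.
by congr mint; apply/funext => w; rewrite rv_scons.
Qed.

Lemma Lint_consr m (G : 'rV[R]_m.+1 -> \bar R) : mrow G -> (forall x, 0 <= G x) ->
  Lint G = Lint (fun w : 'rV[R]_m => \int[mu]_t G (hv t w)).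
Proof.
move=> mG G0; rewrite /Lint mint_consr//; congr mint; apply/funext => w.
by apply: eq_integral => t _; rewrite rv_scons.
Qed.

Lemma mrow_comp m k (G : 'rV[R]_m -> \bar R) (phi : 'rV[R]_k -> 'rV[R]_m) : mrow G ->
  (forall j, measurable_fun setT (fun u : st R 'I_k => phi (rv u) 0%R j)) ->
  mrow (fun x => G (phi x)).
Proof.
move=> mG mphi; rewrite /mrow.
rewrite (_ : (fun u => _) = (fun u => G (rv (fun j => phi (rv u) 0%R j)))).
  exact: (@mea_comp _ _ _ (fun u => G (rv u)) (fun u j => phi (rv u) 0%R j)).
by apply/funext => u; congr G; apply/rowP => j; rewrite mxE.
Qed.

Lemma mrow_hv m (G : 'rV[R]_m.+1 -> \bar R) t : mrow G -> mrow (fun w => G (hv t w)).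
Proof.
move=> mG; apply: mrow_comp => // j; case: (unliftP ord0 j) => [i ->|->].
  rewrite (_ : (fun u => _) = fun u : st R 'I_m => u i); first exact: measurable_coord.
  by apply/funext => u; rewrite hvS mxE.
by rewrite (_ : (fun u => _) = fun u : st R 'I_m => t)//; apply/funext => u; rewrite hv0.
Qed.

Lemma measurable_rvaff m k (A : 'M[R]_(k, m)) (c : 'rV[R]_m) j :
  measurable_fun setT (fun u : st R 'I_k => (rv u *m A + c)%R 0%R j).
Proof.
rewrite (_ : (fun u => _) = fun u : st R 'I_k => (\sum_i u i * A i j + c 0 j)%R).
  apply: measurable_funD => //; apply: measurable_sumb => i.
  by apply: measurable_funM => //; exact: measurable_coord.
by apply/funext => u; rewrite !mxE; congr (_ + _)%R; apply: eq_bigr => i _; rewrite !mxE.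
Qed.

Lemma Lint_aff m (G : 'rV[R]_m -> \bar R) (A : 'M[R]_m) (c : 'rV[R]_m) :
  A \in unitmx -> mrow G -> (forall x, 0 <= G x) ->
  Lint G = `|\det A|%R%:E * Lint (fun x => G (x *m A + c)%R).
Proof.
move=> uA mG G0; rewrite /Lint /mint.
have -> : enum 'I_m = avars (fun i : 'I_m => i) by rewrite /avars map_id.
(* Row vectors are multiplied from the right, while [aff] lets the matrix act on the list of
   variables from the left; hence the transpose. *)
rewrite (@II_aff R _ m (fun i => i) A^T (fun i => c 0%R i))//; last by rewrite unitmx_tr.
rewrite det_tr; congr (_ * _); apply: eq_II => u _; congr G; apply/rowP => j.
rewrite mxE (@aff_in _ _ _ (fun i : 'I_m => i))// !mxE; congr (_ + _)%R.
by apply: eq_bigr => i _; rewrite !mxE mulrC.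
Qed.

Lemma Lint_scale m (G : 'rV[R]_m -> \bar R) (c : R) :
  c != 0%R -> mrow G -> (forall x, 0 <= G x) ->
  Lint G = (`|c| ^+ m)%R%:E * Lint (fun x => G (c *: x)%R).
Proof.
move=> c0 mG G0; rewrite (@Lint_aff _ _ c%:M 0%R)//; last first.
  by rewrite unitmxE det_scalar unitfE expf_neq0.
rewrite det_scalar normrX; congr (_ * _); congr Lint; apply/funext => x.
by rewrite addr0 mul_mx_scalar.
Qed.

Lemma Lint_ge0 m (G : 'rV[R]_m -> \bar R) : (forall x, 0 <= G x) -> 0 <= Lint G.
Proof. by move=> G0; apply: mint_ge0. Qed.

Lemma LintZ m (G : 'rV[R]_m -> \bar R) k : mrow G -> (forall x, 0 <= G x) -> 0 <= k ->
  Lint (fun x => k * G x) = k * Lint G.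
Proof. by move=> mG G0 k0; rewrite /Lint /mint -II_scale. Qed.

End Lint.

Section Slices.
Variable R : realType.
Local Notation mu := (@lebesgue_measure R).

Lemma cbeta_gt0 m (b : R) : -1 < b -> 0 < cbeta m b.
Proof.
move=> b1; rewrite /cbeta divr_gt0 ?mulr_gt0 ?powR_gt0 ?pi_gt0//; apply: Gamma_gt0; last lra.
have : 0 <= m%:R / 2 :> R by rewrite divr_ge0.
lra.
Qed.

Lemma fbeta_ge0 m (b : R) x : -1 < b -> 0 <= fbeta m b x.
Proof. by move=> b1; rewrite /fbeta; case: ifP => // _; rewrite mulr_ge0 ?powR_ge0 ?ltW ?cbeta_gt0. Qed.

(** [Gamma (b + 1)] cancels, and the numerator of the constant in dimension [m] is the Gamma factor
    in the denominator of the one-dimensional constant. This is why slicing shifts the parameter by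
    [m / 2]. *)
Lemma cbeta_ratio m (b : R) : -1 < b ->
  cbeta m.+1 b / cbeta m b = cbeta 1 (b + m%:R / 2).
Proof.
move=> b1; have m0 : 0 <= m%:R / 2 :> R by rewrite divr_ge0.
have G1 : 0 < Gamma (b + 1) by apply: Gamma_gt0; lra.
have G2 : 0 < Gamma (m%:R / 2 + b + 1) by apply: Gamma_gt0; lra.
rewrite /cbeta.
have -> : m.+1%:R / 2 + b + 1 = 1 / 2 + (b + m%:R / 2) + 1 :> R by rewrite -natr1; field.
have -> : b + m%:R / 2 + 1 = m%:R / 2 + b + 1 :> R by ring.
have -> : m.+1%:R / 2 = m%:R / 2 + 1 / 2 :> R by rewrite -natr1; field.
rewrite powRD ?(gt_eqF (pi_gt0 R)) ?implybT//.
have p1 : 0 < pi `^ (m%:R / 2) :> R by rewrite powR_gt0 ?pi_gt0.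
have p2 : 0 < pi `^ (1 / 2) :> R by rewrite powR_gt0 ?pi_gt0.
move: G1 G2 p1 p2; move: (Gamma (b + 1)) (Gamma (m%:R / 2 + b + 1)) (Gamma (1 / 2 + _ + 1)).
move: (pi `^ (m%:R / 2)) (pi `^ (1 / 2)) => {m0} P Q A B C A0 B0 P0 Q0.
by field; rewrite (gt_eqF A0) (gt_eqF B0) (gt_eqF P0) (gt_eqF Q0).
Qed.

Lemma bint_cbeta (g : R) : -1 < g -> (bint g = ((cbeta 1 g)^-1)%:E)%E.
Proof.
move=> g1; rewrite bintE// /cbeta; congr EFin.
have G1 : 0 < Gamma (g + 1) by apply: Gamma_gt0; lra.
have G2 : 0 < Gamma (g + 3 / 2) by apply: Gamma_gt0; lra.
have -> : 1 / 2 + g + 1 = g + 3 / 2 by field.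
rewrite mul1r powR12_sqrt ?pi_ge0// invf_div//.
Qed.

(** Rests on [1 - t^2 - (1 - t^2) |y|^2 = (1 - t^2) (1 - |y|^2)]. *)
Lemma fbeta_slice m (b t : R) (y : 'rV[R]_m) : -1 < b -> t ^+ 2 < 1 ->
  fbeta m.+1 b (hv t (Num.sqrt (1 - t ^+ 2) *: y)) =
  cbeta m.+1 b / cbeta m b * (1 - t ^+ 2) `^ b * fbeta m b y.
Proof.
move=> b1 t1; have h : 0 < 1 - t ^+ 2 by rewrite subr_gt0.
have cm := cbeta_gt0 m b1.
rewrite !fbetaE edot_hv.
have -> : edot (Num.sqrt (1 - t ^+ 2) *: y) (Num.sqrt (1 - t ^+ 2) *: y) = (1 - t ^+ 2) * edot y y.
  rewrite /edot mulr_sumr; apply: eq_bigr => j _; rewrite !mxE mulrACA -expr2 sqr_sqrtr ?ltW//.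
have -> : (t * t + (1 - t ^+ 2) * edot y y <= 1) = (edot y y <= 1).
  rewrite -expr2 addrC -lerBrDr -[X in _ <= X]mulr1 ler_pM2l//.
case: ifP => y1; last by rewrite mulr0.
have -> : 1 - (t * t + (1 - t ^+ 2) * edot y y) = (1 - t ^+ 2) * (1 - edot y y) by ring.
rewrite powRM ?subr_ge0 ?(ltW t1)//; field.
by rewrite gt_eqF.
Qed.

Lemma fbeta_out m (b t : R) (w : 'rV[R]_m) : 1 < t ^+ 2 -> fbeta m.+1 b (hv t w) = 0.
Proof.
move=> t1; rewrite fbetaE edot_hv ifF//; apply/negbTE; rewrite -ltNge.
by apply: (lt_le_trans t1); rewrite -expr2 lerDl edot_ge0.
Qed.

Local Open Scope ereal_scope.

Lemma mrow_fbeta m b : mrow (fun x : 'rV[R]_m => (fbeta m b x)%:E).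
Proof.
apply: measurable_EF; apply: measurable_fbeta => j.
rewrite (_ : (fun u => _) = fun u : st R 'I_m => u j); first exact: measurable_coord.
by apply/funext => u; rewrite mxE.
Qed.

Lemma fbetaE_ge0 m (b : R) x : (-1 < b)%R -> 0 <= (fbeta m b x)%:E.
Proof. by move=> b1; rewrite lee_fin fbeta_ge0. Qed.

(** The exponent gains [m / 2] from the Jacobian of the scaling. The total mass stays unevaluated
    because its value 1 is deduced from this very formula, by induction on [m]. *)
Lemma Lint_slice_gen m (b t : R) : (-1 < b)%R -> (t ^+ 2 < 1)%R ->
  Lint (fun w : 'rV[R]_m => (fbeta m.+1 b (hv t w))%:E) =
  (cbeta m.+1 b / cbeta m b * (1 - t ^+ 2) `^ (b + m%:R / 2))%R%:E *
   Lint (fun w : 'rV[R]_m => (fbeta m b w)%:E).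
Proof.
move=> b1 t1; have h : (0 < 1 - t ^+ 2)%R by rewrite subr_gt0.
have s0 : (0 < Num.sqrt (1 - t ^+ 2))%R by rewrite sqrtr_gt0.
rewrite (@Lint_scale _ _ _ (Num.sqrt (1 - t ^+ 2))); last 3 first.
- by rewrite gt_eqF.
- exact: (@mrow_hv _ _ (fun x => (fbeta m.+1 b x)%:E) t (@mrow_fbeta _ _)).
- by move=> x; exact: fbetaE_ge0.
rewrite (_ : (fun x => _) = (fun x => (cbeta m.+1 b / cbeta m b * (1 - t ^+ 2) `^ b)%R%:E * (fbeta m b x)%:E)); last first.
  by apply/funext => x; rewrite fbeta_slice// EFinM.
rewrite LintZ//; last 3 first.
- exact: mrow_fbeta.
- by move=> x; exact: fbetaE_ge0.
- by rewrite lee_fin mulr_ge0 ?powR_ge0// divr_ge0// ltW// cbeta_gt0.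
rewrite muleA -EFinM; congr (_%:E * _).
rewrite ger0_norm ?(ltW s0)// -powR12_sqrt ?(ltW h)// -[((_ `^ _) ^+ m)%R]powR_mulrn ?powR_ge0// -powRrM.
rewrite mulrC -(mulrA (cbeta m.+1 b / cbeta m b)%R); congr (_ * _)%R.
by rewrite -powRD ?(gt_eqF h) ?implybT// (mulrC 2^-1%R).
Qed.

(** Integrating the slice masses over the first coordinate gives [cbeta 1 g * bint g] with
    [g = b + m / 2], which is 1. In dimension 0 the constant is a quotient of equal Gamma values. *)
Lemma Lint_fbeta m (b : R) : (-1 < b)%R -> Lint (fun w : 'rV[R]_m => (fbeta m b w)%:E) = 1.
Proof.
move=> b1; elim: m => [|m IH].
  rewrite /Lint /mint (_ : enum 'I_0 = [::])/=; last by apply: size0nil; rewrite size_enum_ord.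
  rewrite fbetaE (_ : edot _ _ = 0%R); last by rewrite /edot big_ord0.
  rewrite ler01 subr0 powR1 mulr1 /cbeta !mul0r powRr0 add0r mul1r divff//.
  by rewrite gt_eqF// Gamma_gt0//; lra.
have m0 : (0 <= m%:R / 2 :> R)%R by rewrite divr_ge0.
have g1 : (-1 < b + m%:R / 2)%R by lra.
have c0 := cbeta_gt0 1 g1.
rewrite Lint_consl//; last 2 first.
- exact: mrow_fbeta.
- by move=> x; exact: fbetaE_ge0.
transitivity (\int[mu]_t ((cbeta 1 (b + m%:R / 2))%:E * ((t ^+ 2 < 1)%R%:R * (1 - t ^+ 2) `^ (b + m%:R / 2))%R%:E)).
  apply: (@integral_off_seq _ [:: 1%R; (-1)%R]).
  - by move=> t; apply: Lint_ge0 => x; exact: fbetaE_ge0.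
  - by move=> t; rewrite mule_ge0 ?lee_fin ?(ltW c0)// mulr_ge0 ?powR_ge0.
  move=> t; rewrite !inE negb_or => /andP[tn1 tn2].
  have {tn1 tn2}t1 : (t ^+ 2 != 1)%R by rewrite sqrf_eq1 negb_or tn1.
  case: (ltgtP (t ^+ 2)%R 1%R) t1 => // t1 _.
    by rewrite Lint_slice_gen// IH mule1 cbeta_ratio// mul1r EFinM.
  rewrite mul0r mule0 /Lint (_ : (fun u => _) = cst 0).
    by rewrite /mint; elim: (enum _) (fun=> _) => [//|a s IH'] v /=; apply: integral0_eq => x _; exact: IH'.
  by apply/funext => u; rewrite fbeta_out.
rewrite ge0_integralZl_EFin//; last 3 first.
- by move=> t _; rewrite lee_fin mulr_ge0 ?powR_ge0.
- by meas.
- exact: ltW.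
rewrite -/(bint _) bint_cbeta// -EFinM divff// gt_eqF//.
Qed.

Lemma Lint_slice m (b t : R) : (-1 < b)%R -> (t ^+ 2 < 1)%R ->
  Lint (fun w : 'rV[R]_m => (fbeta m.+1 b (hv t w))%:E) =
  (cbeta 1 (b + m%:R / 2) * (1 - t ^+ 2) `^ (b + m%:R / 2))%R%:E.
Proof. by move=> b1 t1; rewrite Lint_slice_gen// Lint_fbeta// mule1 cbeta_ratio. Qed.

(** Comparison with [bint g] gives finiteness, so [fine] is harmless. The two indicators may differ
    only at the points [1], [-1] and [h]. *)
Lemma Fgamma_int (g h : R) : (-1 < g)%R -> (h <= 1)%R ->
  (Fgamma g h)%:E = \int[mu]_t (((t ^+ 2 < 1) && (t < h))%R%:R * (cbeta 1 g * (1 - t ^+ 2) `^ g))%R%:E.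
Proof.
move=> g1 h1; have c0 := cbeta_gt0 1 g1.
have p0 t : (0 <= ((t ^+ 2 < 1) && (t < h))%R%:R * (1 - t ^+ 2) `^ g)%R by rewrite mulr_ge0 ?powR_ge0.
set I := \int[mu]_t (((t ^+ 2 < 1) && (t < h))%R%:R * (1 - t ^+ 2) `^ g)%R%:E.
have -> : \int[mu]_t (((t ^+ 2 < 1) && (t < h))%R%:R * (cbeta 1 g * (1 - t ^+ 2) `^ g))%R%:E = (cbeta 1 g)%:E * I.
  rewrite /I -ge0_integralZl_EFin ?(ltW c0)//; iside.
  by apply: eq_integral => t _; rewrite -EFinM mulrCA.
have Ib : I <= bint g.
  apply: ge0_le_integral => //.
  - by move=> t _; rewrite lee_fin.
  - by meas.
  - by meas.
  - by move=> t _; rewrite lee_fin ler_wpM2r ?powR_ge0// ler_nat; case: (t ^+ 2 < 1)%R; case: (t < h)%R.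
have Ifin : I \is a fin_num.
  rewrite ge0_fin_numE; last by apply: integral_ge0 => t _; rewrite lee_fin.
  by apply: (le_lt_trans Ib); rewrite bint_cbeta// ltry.
rewrite /Fgamma EFinM; congr (_ * _).
rewrite -[RHS](fineK Ifin); congr (fine _)%:E.
rewrite integral_mkcond; apply: (@integral_off_seq _ [:: 1%R; (-1)%R; h]).
- by move=> t; rewrite patchE; case: ifP => // _; rewrite lee_fin powR_ge0.
- by move=> t; rewrite lee_fin.
move=> t; rewrite !inE !negb_or => /and3P[tn1 tn2 th].
rewrite patchE mem_setE in_itv/=.
have -> : (t ^+ 2 < 1)%R = (-1 < t < 1)%R.
  by apply/idP/andP => [H|[H1 H2]]; [split|]; nra.
rewrite (lt_neqAle t h) th/= (lt_neqAle (-1)%R) eq_sym tn2/=.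
have [th'|th'] := lerP t h; rewrite ?andbT ?andbF ?mul0r//.
have -> : (t < 1)%R by rewrite lt_neqAle tn1 (le_trans th').
by case: ifP; rewrite ?mul1r ?mul0r.
Qed.

Lemma Fgamma_ge0 (g h : R) : (-1 < g)%R -> (h <= 1)%R -> (0 <= Fgamma g h)%R.
Proof.
move=> g1 h1; rewrite -lee_fin Fgamma_int//; apply: integral_ge0 => t _.
by rewrite lee_fin mulr_ge0// mulr_ge0 ?powR_ge0// ltW// cbeta_gt0.
Qed.

(** By [Lint_slice] the first coordinate of a vector with density [fbeta m.+1 b] has the
    one-dimensional beta density of parameter [b + m / 2]; hence the shift by [(d - 1) / 2] in the
    statement. *)
Lemma Lint_halfspace m (b h : R) : (-1 < b)%R -> (h <= 1)%R ->
  Lint (fun x : 'rV[R]_m.+1 => ((x 0%R ord0 < h)%R%:R * fbeta m.+1 b x)%:E) =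
  (Fgamma (b + m%:R / 2) h)%:E.
Proof.
move=> b1 h1.
have m0 : (0 <= m%:R / 2 :> R)%R by rewrite divr_ge0.
have g1 : (-1 < b + m%:R / 2)%R by lra.
have c0 := cbeta_gt0 1 g1.
rewrite Lint_consl//; last 2 first.
- apply: measurable_EF; apply: measurable_funM.
    apply: measurable_indb; apply: measurable_lt => //.
    rewrite (_ : (fun u => _) = fun u : st R 'I_m.+1 => u ord0); first exact: measurable_coord.
    by apply/funext => u; rewrite mxE.
  by apply/measurable_EFinP; exact: mrow_fbeta.
- by move=> x; rewrite lee_fin mulr_ge0// fbeta_ge0.
rewrite Fgamma_int//; apply: (@integral_off_seq _ [:: 1%R; (-1)%R]).
- by move=> t; apply: Lint_ge0 => x; rewrite lee_fin mulr_ge0 ?fbeta_ge0.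
- by move=> t; rewrite lee_fin mulr_ge0// mulr_ge0 ?powR_ge0// ltW.
move=> t; rewrite !inE negb_or => /andP[tn1 tn2].
have {tn1 tn2}t1 : (t ^+ 2 != 1)%R by rewrite sqrf_eq1 negb_or tn1.
have -> : (fun w : 'rV[R]_m => ((hv t w 0%R ord0 < h)%R%:R * fbeta m.+1 b (hv t w))%:E) =
  (fun w => (t < h)%R%:R%:E * (fbeta m.+1 b (hv t w))%:E).
  by apply/funext => w; rewrite hv0 EFinM.
rewrite LintZ//; last 2 first.
- exact: (@mrow_hv _ _ (fun x => (fbeta m.+1 b x)%:E) t (@mrow_fbeta _ _)).
- by move=> x; exact: fbetaE_ge0.
case: (ltgtP (t ^+ 2)%R 1%R) t1 => // t1 _.
  by rewrite Lint_slice// -EFinM.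
rewrite mul0r /Lint (_ : (fun u => _) = cst 0); last by apply/funext => u; rewrite fbeta_out.
rewrite [X in _ * X](_ : _ = 0) ?mule0//.
by rewrite /mint; elim: (enum _) (fun=> _) => [//|a s IH'] v /=; apply: integral0_eq => x _; exact: IH'.
Qed.

Lemma fbetaN m b (x : 'rV[R]_m) : fbeta m b (- x)%R = fbeta m b x.
Proof.
rewrite !fbetaE; suff -> : edot (- x)%R (- x)%R = edot x x by [].
by rewrite /edot; apply: eq_bigr => j _; rewrite !mxE mulrNN.
Qed.

Lemma Lint_halfspaceN m (b h : R) : (-1 < b)%R -> (-1 <= h)%R ->
  Lint (fun x : 'rV[R]_m.+1 => ((h < x 0%R ord0)%R%:R * fbeta m.+1 b x)%:E) =
  (Fgamma (b + m%:R / 2) (- h))%:E.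
Proof.
move=> b1 h1; rewrite -Lint_halfspace//; last by rewrite lerNl.
rewrite (@Lint_scale _ _ _ (-1)%R)//; last 2 first.
- apply: measurable_EF; apply: measurable_funM.
    apply: measurable_indb; apply: measurable_lt => //.
    rewrite (_ : (fun u => _) = fun u : st R 'I_m.+1 => u ord0); first exact: measurable_coord.
    by apply/funext => u; rewrite mxE.
  by apply/measurable_EFinP; exact: mrow_fbeta.
- by move=> x; rewrite lee_fin mulr_ge0// fbeta_ge0.
rewrite normrN1 expr1n mul1e; congr Lint; apply/funext => x.
by rewrite scaleN1r fbetaN mxE ltrNr.
Qed.


End Slices.

(** * Volumes of simplices and balls *)

Section Volumes.
Variable R : realType.
Local Notation mu := (@lebesgue_measure R).

(** Homogeneous coordinates: for [m + 1] points, [|\det|] is [m!] times the volume of their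
    simplex. *)
Definition hom m k (y : 'I_k -> 'rV[R]_m) : 'M[R]_(k, m.+1) := \matrix_(i < k) hv 1 (y i).

Definition edges m (y : 'I_m.+1 -> 'rV[R]_m) : 'M[R]_m :=
  \matrix_(i < m) (y (lift ord0 i) - y ord0).

Lemma hom_block m (y : 'I_m.+1 -> 'rV[R]_m) :
  hom y = (block_mx 1%:M 0 (const_mx 1) 1%:M : 'M[R]_(1 + m)) *m (block_mx 1%:M (y ord0) 0 (edges y) : 'M[R]_(1 + m)).
Proof.
rewrite mulmx_block !mul1mx !mul0mx !mulmx1 !addr0.
apply/row_matrixP => i; rewrite rowK.
case: (unliftP ord0 i) => [j ->|->].
  rewrite (_ : lift ord0 j = rshift 1 j); last exact: val_inj.
  rewrite /block_mx (@rowKd _ 1) (@row_row_mx _ m 1 m) /hv.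
  have -> : row j (const_mx 1 : 'M[R]_(m, 1)) = 1%:M.
    by apply/matrixP => a b; rewrite !ord1 !mxE.
  have -> // : row j (const_mx 1 *m y ord0 + edges y) = y (rshift 1 j).
  apply/rowP => l; rewrite !mxE big_ord1 !mxE mul1r.
  rewrite (_ : lift ord0 j = rshift 1 j); last exact: val_inj.
  by rewrite addrCA subrr addr0.
rewrite (_ : ord0 = lshift m (ord0 : 'I_1)); last exact: val_inj.
rewrite /block_mx (@rowKu _ 1) /hv; apply/rowP => l; rewrite !mxE.
by rewrite (_ : lshift m (ord0 : 'I_1) = ord0)//; exact: val_inj.
Qed.

Lemma det_hom m (y : 'I_m.+1 -> 'rV[R]_m) : \det (hom y) = \det (edges y).
Proof.
rewrite hom_block det_mulmx (@det_lblock _ 1 m) (@det_ublock _ 1 m) !det1 !mul1r//.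
Qed.

Lemma hom_aff m k (y : 'I_k -> 'rV[R]_m) (A : 'M[R]_m) c :
  hom (fun i => y i *m A + c) = hom y *m (block_mx 1%:M c 0 A : 'M[R]_(1 + m)).
Proof.
apply/row_matrixP => i; rewrite row_mul !rowK /hv (@mul_row_block _ 1 1 m 1 m).
by rewrite mulmx1 mulmx0 addr0 mul_scalar_mx scale1r addrC.
Qed.

Lemma det_hom_aff m (y : 'I_m.+1 -> 'rV[R]_m) (A : 'M[R]_m) c :
  \det (hom (fun i => y i *m A + c)) = \det (hom y) * \det A.
Proof. by rewrite hom_aff det_mulmx (@det_ublock _ 1 m) det1 mul1r. Qed.

Definition simplex m (w : 'rV[R]_m) : bool := [forall j, 0 <= w 0 j] && (\sum_j w 0 j <= 1).

(** The barycentric weights other than the first are the coordinates along the edges at the first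
    vertex. *)
Lemma conv_simplex m (y : 'I_m.+1 -> 'rV[R]_m) (w : 'rV[R]_m) : edges y \in unitmx ->
  conv_pts y (w *m edges y + y ord0) <-> simplex w.
Proof.
move=> uA; split => [[l [l0 [l1 E]]]|/andP[/forallP w0 w1]].
  have Ew : w = \row_j l (lift ord0 j).
    apply: (can_inj (mulmxK uA)); apply: (addIr (y ord0)); rewrite E.
    rewrite mulmx_sum_row big_ord_recl.
    under [in RHS]eq_bigr do rewrite rowK mxE scalerBr.
    rewrite sumrB -scaler_suml.
    have -> : \sum_(i < m) l (lift ord0 i) = 1 - l ord0 by rewrite -l1 big_ord_recl addrC addKr.
    by rewrite scalerBl scale1r opprB addrA subrK addrC.
  apply/andP; split; first by apply/forallP => j; rewrite Ew mxE.
  rewrite -l1 big_ord_recl -[leLHS]add0r lerD//.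
  by apply: ler_sum => j _; rewrite Ew mxE.
exists (fun i => if unlift ord0 i is Some j then w 0 j else 1 - \sum_j w 0 j).
split; first by move=> i; case: unliftP => [j _|_] //; rewrite subr_ge0.
split.
  rewrite big_ord_recl /= unlift_none; under [X in _ + X]eq_bigr do rewrite liftK.
  by rewrite subrK.
rewrite big_ord_recl /= unlift_none; under [X in _ = _ + X]eq_bigr do rewrite liftK.
rewrite mulmx_sum_row; under [X in X + _ = _]eq_bigr do rewrite rowK scalerBr.
by rewrite sumrB -scaler_suml scalerBl scale1r addrC addrA addrAC.
Qed.

Local Open Scope ereal_scope.

Lemma int_onem n : \int[mu]_t ((0 <= t <= 1)%R%:R * (1 - t) ^+ n)%R%:E = (n.+1%:R^-1)%R%:E.
Proof.
rewrite -(@Rintegral_onemXn R n) /Rintegral fineK; last first.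
  rewrite (_ : (fun x => _) = EFin \o XMonemX 0 n).
    by apply: integrable_fin_num => //; exact: integrable_XMonemX.
  by apply/funext => x /=; rewrite XMonemX0n.
rewrite [RHS]integral_mkcond; apply: eq_integral => t _.
rewrite patchE mem_setE in_itv/=; case: ifP; rewrite ?mul1r ?mul0r//.
Qed.

Lemma mrow_simplex m : mrow (fun w : 'rV[R]_m => (simplex w)%:R%:E).
Proof.
apply: measurable_EF; apply: measurable_indb; rewrite /simplex.
rewrite (_ : (fun u => _) = (fun u : st R 'I_m => (\prod_j ((0 <= u j)%R%:R : R) == 1)%R && (\sum_j u j <= 1)%R)).
  by meas; exact: measurable_coord.
apply/funext => u; congr (_ && _); last first.
  by congr (_ <= _)%R; apply: eq_bigr => j _; rewrite mxE.
apply/forallP/eqP => [H|].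
  by rewrite big1// => j _; have := H j; rewrite mxE => ->.
move=> H j; rewrite mxE; apply: contraT => uj; move: H.
by rewrite (bigD1 j)//= (negbTE uj) mul0r => /esym/eqP; rewrite oner_eq0.
Qed.

Lemma simplex_hv m t (w : 'rV[R]_m) : (t < 1)%R ->
  simplex (hv t ((1 - t) *: w)%R) = (0 <= t)%R && simplex w.
Proof.
move=> t1; have h : (0 < 1 - t)%R by rewrite subr_gt0.
rewrite /simplex big_ord_recl hv0.
have -> : (\sum_(i < m) hv t ((1 - t) *: w) 0 (lift ord0 i) = (1 - t) * \sum_j w 0 j)%R.
  by rewrite mulr_sumr; apply: eq_bigr => i _; rewrite hvS mxE.
have -> S : (t + (1 - t) * S <= 1)%R = (S <= 1)%R.
  by rewrite addrC -lerBrDr -[leRHS]mulr1 ler_pM2l.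
rewrite andbA; congr (_ && _).
apply/forallP/andP => [H|[t0 /forallP H] j].
  split; first by have := H ord0; rewrite hv0.
  by apply/forallP => j; have := H (lift ord0 j); rewrite hvS mxE pmulr_rge0.
by case: (unliftP ord0 j) => [i ->|->]; rewrite ?hv0// hvS mxE pmulr_rge0.
Qed.

Lemma simplex_out m t (w : 'rV[R]_m) : (1 < t)%R -> simplex (hv t w) = false.
Proof.
move=> t1; apply/negP => /andP[/forallP H]; rewrite big_ord_recl hv0 => H1.
suff : (1 < 1 :> R)%R by rewrite ltxx.
apply: (lt_le_trans t1); apply: le_trans H1; rewrite lerDl.
by apply: sumr_ge0 => j _; exact: H.
Qed.

Lemma II0 (V : eqType) (s : seq V) (v : V -> R) : II s (fun _ => 0) v = 0.
Proof. by elim: s v => [//|a s IH] v /=; apply: integral0_eq => t _; exact: IH. Qed.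

Lemma Lint0 m : Lint (fun _ : 'rV[R]_m => 0) = 0.
Proof. exact: II0. Qed.

(** The slice at height [t] is the simplex of one dimension less scaled by [1 - t], and [(1 - t)^m]
    integrates to [1 / (m + 1)] over [0, 1]. *)
Lemma Lint_simplex m : Lint (fun w : 'rV[R]_m => (simplex w)%:R%:E) = ((m`!)%:R^-1)%R%:E.
Proof.
elim: m => [|m IH].
  rewrite /Lint /mint (_ : enum 'I_0 = [::])/=; last by apply: size0nil; rewrite size_enum_ord.
  rewrite /simplex big_ord0 ler01 andbT (_ : [forall j, _] = true) ?fact0 ?invr1//.
  by apply/forallP => -[].
rewrite Lint_consl//; last exact: mrow_simplex.
transitivity (\int[mu]_t (((m`!)%:R^-1)%R%:E * ((0 <= t <= 1)%R%:R * (1 - t) ^+ m)%R%:E)).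
  apply: (@integral_off_seq _ [:: 1%R]).
  - by move=> t; exact: Lint_ge0.
  - move=> t; rewrite mule_ge0// lee_fin; case: (lerP 0%R t) => // _; last by rewrite mul0r.
    by case: (lerP t 1%R) => t1; rewrite ?mul0r// mulr_ge0// exprn_ge0// subr_ge0.
  move=> t; rewrite inE => tn1.
  case: (ltgtP t 1%R) tn1 => // t1 _; last first.
    rewrite andbF mul0r mule0 -[RHS](Lint0 m); congr Lint; apply/funext => w.
    by rewrite simplex_out.
  have h : (0 < 1 - t)%R by rewrite subr_gt0.
  rewrite (@Lint_scale _ _ _ (1 - t)%R)//; last 2 first.
  - by rewrite gt_eqF.
  - exact: (@mrow_hv _ _ (fun x => (simplex x)%:R%:E) t (@mrow_simplex _)).
  rewrite (_ : (fun x => _) = (fun x => (0 <= t)%R%:R%:E * (simplex x)%:R%:E)); last first.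
    by apply/funext => x; rewrite simplex_hv// -EFinM -natrM mulnb.
  rewrite LintZ//; last exact: mrow_simplex.
  rewrite IH -!EFinM ger0_norm ?(ltW h)// andbT; congr EFin; ring.
rewrite ge0_integralZl_EFin//; iside.
  by rewrite int_onem -EFinM factS natrM invfM mulrC.
move=> t _; rewrite lee_fin; case: (lerP 0%R t) => // _; last by rewrite mul0r.
by case: (lerP t 1%R) => t1; rewrite ?mul0r// mulr_ge0// exprn_ge0// subr_ge0.
Qed.

Lemma leb_LintE m (A : set 'rV[R]_m) (b : 'rV[R]_m -> bool) :
  (forall x, A x <-> b x) -> mrow (fun x => (b x)%:R%:E) ->
  leb_vol A = Lint (fun x => (b x)%:R%:E).
Proof.
move=> Ab mb; rewrite /leb_vol.
rewrite (_ : (fun x => _) = (fun x => (b x)%:R%:E)).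
  by rewrite leb_intE.
apply/funext => x; rewrite indicE; congr (_%:R%:E).
by congr nat_of_bool; apply/idP/idP => [/set_mem/Ab//|/Ab/mem_set].
Qed.

(** The hull is the affine image of the standard simplex under [edges y], whose determinant is that
    of [hom y]. *)
Lemma leb_vol_conv m (y : 'I_m.+1 -> 'rV[R]_m) : hom y \in unitmx ->
  leb_vol (conv_pts y) = (`|\det (hom y)| / (m`!)%:R)%R%:E.
Proof.
rewrite unitmxE det_hom -unitmxE => uA.
pose b z := simplex ((z - y ord0) *m invmx (edges y))%R.
have mb : mrow (fun z => (b z)%:R%:E).
  apply: (@mrow_comp R m m (fun w => (simplex w)%:R%:E) (fun z => ((z - y ord0) *m invmx (edges y))%R)); first exact: mrow_simplex.
  move=> j; rewrite (_ : (fun u => _) = (fun u : st R 'I_m => (rv u *m invmx (edges y) + - (y ord0 *m invmx (edges y)))%R 0%R j)).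
    exact: measurable_rvaff.
  by apply/funext => u; rewrite mulmxBl.
rewrite (leb_LintE (b := b))//; last first.
  move=> z; rewrite /b -(conv_simplex _ uA) mulmxKV// subrK//.
rewrite (@Lint_aff _ _ _ (edges y) (y ord0))//.
rewrite (_ : (fun x => _) = (fun w => (simplex w)%:R%:E)); last first.
  by apply/funext => w; rewrite /b addrK mulmxK.
by rewrite Lint_simplex -EFinM.
Qed.

End Volumes.

Section Kappa.
Variable R : realType.
Local Notation mu := (@lebesgue_measure R).

(* The hyperplane x_0 = s + <p, x'> has normal (1, -p), of length [slant p]. *)
Definition slant m (p : 'rV[R]_m) : R := Num.sqrt (1 + edot p p).

Lemma slant_gt0 m (p : 'rV[R]_m) : 0 < slant p.
Proof. by rewrite sqrtr_gt0 ltr_pwDl// edot_ge0. Qed.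

Lemma slant_sqr m (p : 'rV[R]_m) : slant p ^+ 2 = 1 + edot p p.
Proof. by rewrite sqr_sqrtr// addr_ge0// edot_ge0. Qed.

Lemma measurable_rv m j : measurable_fun setT (fun u : st R 'I_m => rv u 0 j).
Proof.
rewrite (_ : (fun u => _) = fun u : st R 'I_m => u j); first exact: measurable_coord.
by apply/funext => u; rewrite mxE.
Qed.

Lemma measurable_edot_rv m : measurable_fun setT (fun u : st R 'I_m => edot (rv u) (rv u)).
Proof. by apply: measurable_edot => j; exact: measurable_rv. Qed.

Lemma measurable_hv m d (T : measurableType d) (t : T -> R) (w : T -> 'rV[R]_m) j :
  measurable_fun setT t -> (forall j, measurable_fun setT (fun x => w x 0 j)) ->
  measurable_fun setT (fun x => hv (t x) (w x) 0 j).
Proof.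
move=> mt mw; case: (unliftP ord0 j) => [i ->|->].
  by rewrite (_ : (fun x => _) = fun x => w x 0 i)//; apply/funext => x; rewrite hvS.
by rewrite (_ : (fun x => _) = t)//; apply/funext => x; rewrite hv0.
Qed.

Local Open Scope ereal_scope.

Lemma mrow_ball m : mrow (fun x : 'rV[R]_m => (edot x x <= 1)%R%:R%:E).
Proof. by rewrite /mrow /mea; have H := @measurable_edot_rv m; meas. Qed.

(** The beta density with parameter 0 is uniform on the ball. The value serves to show that the ball
    volume is finite, so that [fine] in [kappa] loses nothing. *)
Lemma Lint_ball m : Lint (fun x : 'rV[R]_m => (edot x x <= 1)%R%:R%:E) = ((cbeta m (0 : R))^-1)%:E.
Proof.
have N1 : (-1 < 0 :> R)%R by lra.
have c0 := cbeta_gt0 m N1.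
have := @Lint_fbeta R m 0 N1.
rewrite (_ : (fun w => _) = (fun x => (cbeta m (0 : R))%:E * (edot x x <= 1)%R%:R%:E)); last first.
  apply/funext => x; rewrite fbetaE -EFinM powRr0 mulr1; case: ifP; rewrite ?mulr1 ?mulr0//.
rewrite LintZ//; last 2 first.
- exact: mrow_ball.
- by rewrite lee_fin ltW.
move=> h; have : ((cbeta m (0 : R))^-1)%:E * ((cbeta m (0 : R))%:E * Lint (fun x : 'rV[R]_m => (edot x x <= 1)%R%:R%:E)) = ((cbeta m (0 : R))^-1)%:E * 1 by rewrite h.
by rewrite muleA -EFinM mulVf ?gt_eqF// mul1e mule1.
Qed.

Lemma kappaE m : (kappa m : R)%:E = Lint (fun x : 'rV[R]_m => (edot x x <= 1)%R%:R%:E).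
Proof.
rewrite /kappa (leb_LintE (b := fun x => edot x x <= 1)%R); last 2 first.
- by move=> x /=; rewrite enorm_le1.
- exact: mrow_ball.
by rewrite Lint_ball.
Qed.

Lemma int_absX n : \int[mu]_t ((t ^+ 2 <= 1)%R%:R * `|t| ^+ n)%R%:E = (2 / n.+1%:R)%R%:E.
Proof.
pose f (t : R) : R := ((0 <= t <= 1)%R%:R * t ^+ n)%R.
have f0 t : (0 <= f t)%R.
  by rewrite /f; case: (lerP 0%R t) => t0 /=; rewrite ?mul0r// mulr_ge0// exprn_ge0.
have mf : measurable_fun setT (fun t => (f t)%:E) by rewrite /f; meas.
have If : \int[mu]_t (f t)%:E = (n.+1%:R^-1)%R%:E.
  rewrite (@integral_affine R _ (-1)%R 1%R)//.
  rewrite normrN1 mul1e -int_onem; apply: eq_integral => t _; rewrite /f.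
  have -> : (-1 * t + 1 = 1 - t)%R by ring.
  by congr (_%:R * _)%:E; congr nat_of_bool; apply/andP/andP => -[? ?]; split; lra.
have If' : \int[mu]_t (f (- t))%R%:E = (n.+1%:R^-1)%R%:E.
  rewrite -If [RHS](@integral_affine R _ (-1)%R 0%R)//.
  by rewrite normrN1 mul1e; apply: eq_integral => t _; rewrite addr0 mulN1r.
transitivity (\int[mu]_t ((f t)%:E + (f (- t))%R%:E)).
  apply: (@integral_off_seq _ [:: 0%R]).
  - by move=> t; rewrite lee_fin mulr_ge0// exprn_ge0.
  - by move=> t; rewrite adde_ge0// lee_fin.
  move=> t; rewrite inE => tn0; rewrite -EFinD; congr EFin; rewrite /f.
  have E : (t ^+ 2 <= 1)%R = (-1 <= t <= 1)%R.
    by apply/idP/andP => [H|[H1 H2]]; [split|]; nra.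
  rewrite E; case: (ltgtP t 0%R) tn0 => // t0 _.
    rewrite ltr0_norm//= mul0r add0r oppr_ge0 (ltW t0)/=.
    by congr (_%:R * _)%R; congr nat_of_bool; apply/andP/idP => [[? ?]|?]; [|split]; lra.
  rewrite gtr0_norm// oppr_ge0 (leNgt t 0%R) t0/= mul0r addr0.
  by congr (_%:R * _)%R; congr nat_of_bool; apply/andP/idP => [[? ?]|?]; [|split]; lra.
rewrite ge0_integralD//; last 3 first.
- by move=> t _; rewrite lee_fin.
- by move=> t _; rewrite lee_fin.
- by rewrite /f; meas.
by rewrite If If' -EFinD -mulr2n mulr_natl.
Qed.

Lemma mrow_slantX m n : mrow (fun p : 'rV[R]_m => (slant p ^- n)%R%:E).
Proof. by rewrite /mrow /mea /slant; have H := @measurable_edot_rv m; meas. Qed.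

(* The substitution x = (t, t p) maps the half-line over [p] to a ray. *)
Lemma kappa_slant m :
  (m.+1%:R * kappa m.+1)%R%:E = 2%:E * Lint (fun p : 'rV[R]_m => (slant p ^- m.+1)%R%:E).
Proof.
(* Indicator of the ball at [(t, t p)], times the Jacobian [|t|^m]; the squared norm of that point
   is [t^2 (1 + |p|^2)]. *)
pose G (x : 'rV[R]_m.+1) : \bar R :=
  (`|x 0 ord0| ^+ m * (x 0 ord0 ^+ 2 * (1 + edot (\row_j x 0 (lift ord0 j)) (\row_j x 0 (lift ord0 j))) <= 1)%R%:R)%R%:E.
have GE t p : G (hv t p) = (`|t| ^+ m)%R%:E * ((t ^+ 2 * slant p ^+ 2 <= 1)%R%:R)%R%:E.
  rewrite /G hv0 -EFinM slant_sqr.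
  by have -> : (\row_j hv t p 0 (lift ord0 j))%R = p by apply/rowP => j; rewrite mxE hvS.
have mc j : measurable_fun setT (fun u : st R 'I_m.+1 => rv u 0%R j).
  exact: measurable_rv.
have mG : mrow G.
  rewrite /mrow /mea /G.
  have mE : measurable_fun setT (fun u : st R 'I_m.+1 => edot (\row_j rv u 0 (lift ord0 j))%R (\row_j rv u 0 (lift ord0 j))%R).
    apply: measurable_edot => j; rewrite (_ : (fun u => _) = fun u : st R 'I_m.+1 => rv u 0%R (lift ord0 j)) //;
    by apply/funext => u; rewrite mxE.
  by meas; exact: mc.
have G0 x : 0 <= G x by rewrite lee_fin mulr_ge0// exprn_ge0.
have B0 k (x : 'rV[R]_k) : 0 <= (edot x x <= 1)%R%:R%:E :> \bar R by [].
rewrite EFinM kappaE.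
have -> : Lint (fun x : 'rV[R]_m.+1 => (edot x x <= 1)%R%:R%:E) = Lint G.
  rewrite !Lint_consl//; last exact: mrow_ball.
  apply: (@integral_off_seq _ [:: 0%R]) => [t|t|t]; try exact: Lint_ge0.
  rewrite inE => t0.
  rewrite (@Lint_scale _ _ _ t)//; last first.
    exact: (@mrow_hv _ _ (fun x => (edot x x <= 1)%R%:R%:E) t (@mrow_ball _)).
  rewrite -LintZ//; last first.
    apply: (@mrow_comp R m.+1 m (fun x => (edot x x <= 1)%R%:R%:E) (fun p => hv t (t *: p)%R)); first exact: mrow_ball.
    move=> j; apply: measurable_hv => // i.
    rewrite (_ : (fun u => _) = fun u : st R 'I_m => (t * rv u 0 i)%R); last by apply/funext => u; rewrite !mxE.
    by apply: measurable_funM => //; exact: measurable_rv.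
  congr Lint; apply/funext => p; rewrite GE; congr (_ * _%:R%:E); congr nat_of_bool.
  congr (_ <= _)%R; rewrite edot_hv slant_sqr mulrDr mulr1 expr2; congr (_ + _)%R.
  by rewrite /edot mulr_sumr; apply: eq_bigr => j _; rewrite !mxE; ring.
rewrite Lint_consr//.
rewrite (_ : (fun p => _) = (fun p => (2 / m.+1%:R)%R%:E * (slant p ^- m.+1)%R%:E)); last first.
  apply/funext => p; have r0 := slant_gt0 p.
  (* Replacing [t] by [t / slant p] normalises the constraint to [t^2 <= 1] and extracts [m + 1]
     powers of [slant p]: [m] from [|t|^m], one from [dt]. *)
  rewrite (@integral_affine R _ ((slant p)^-1)%R 0%R)//; last 2 first.
  - by rewrite gt_eqF// invr_gt0.
  - by under eq_fun do rewrite GE; meas.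
  rewrite -(int_absX m) exprS invfM EFinM [RHS]muleC -[RHS]muleA.
  rewrite ger0_norm ?invr_ge0 ?(ltW r0)//; congr (_ * _); rewrite -ge0_integralZl_EFin//; iside.
  - apply: eq_integral => t _; rewrite GE addr0 -!EFinM; congr EFin.
    rewrite exprMn mulrAC -exprMn mulVf ?gt_eqF// expr1n mul1r.
    by rewrite normrM exprMn ger0_norm ?invr_ge0 ?(ltW r0)// exprVn -mulrA (mulrC (`|t| ^+ m)%R).
  - by rewrite invr_ge0 exprn_ge0// ltW.
rewrite LintZ//; last 2 first.
- exact: mrow_slantX.
- by move=> x; rewrite lee_fin invr_ge0 exprn_ge0// ltW// slant_gt0.
by rewrite muleA -EFinM mulrCA divff ?mulr1// pnatr_eq0.
Qed.

End Kappa.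

(** * Hyperplanes as graphs *)

Lemma row_mul_tr (R : realType) k (u v : 'rV[R]_k) : u *m v^T = (edot u v)%:M.
Proof. by apply/matrixP => i j; rewrite !ord1 edotE [RHS]mxE eqxx mulr1n. Qed.

Section Rot.
Variables (R : realType) (m : nat).
Implicit Types (p w : 'rV[R]_m) (x y : 'rV[R]_m.+1).

(** This is [(1 + p^T p)^(-1/2)]: the identity orthogonally to [p] and the factor [1 / slant p]
    along [p]. The constant [1 / (r (r + 1))] equals [(1 - 1/r) / |p|^2] but makes sense for [p = 0]
    too. *)
Definition rotA p : 'M[R]_m := 1%:M - (slant p * (slant p + 1))^-1 *: (p^T *m p).

Lemma trmx_rotA p : (rotA p)^T = rotA p.
Proof. by rewrite /rotA linearB /= trmx1 linearZ /= trmx_mul trmxK. Qed.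

Lemma edot_slant p : edot p p = slant p ^+ 2 - 1.
Proof. by rewrite slant_sqr addrC addKr. Qed.

Lemma mul_rotA p : p *m rotA p = (slant p)^-1 *: p.
Proof.
have r0 := slant_gt0 p.
rewrite /rotA mulmxBr mulmx1 -scalemxAr mulmxA row_mul_tr.
rewrite mul_scalar_mx scalerA -{1}(scale1r p) -scalerBl; congr (_ *: _).
rewrite edot_slant; field; rewrite !gt_eqF//; lra.
Qed.

Lemma rotA_orth p : rotA p *m rotA p + (slant p ^- 2) *: (p^T *m p) = 1%:M.
Proof.
have r0 := slant_gt0 p.
rewrite {2}/rotA mulmxBr mulmx1 -scalemxAr.
have -> : rotA p *m (p^T *m p) = (slant p)^-1 *: (p^T *m p).
  by rewrite mulmxA -{1}trmx_rotA -trmx_mul mul_rotA linearZ /= scalemxAl.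
rewrite /rotA scalerA -addrA -addrA.
rewrite -[X in _ = X]addr0; congr (_ + _).
rewrite -!scaleNr -!scalerDl -[RHS](scale0r (p^T *m p)); congr (_ *: _).
have E (r : R) : 0 < r -> - (r * (r + 1))^-1 + (- (r * (r + 1))^-1 * r^-1 + r ^- 2) = 0.
  by move=> ?; field; rewrite !gt_eqF//; lra.
exact: E.
Qed.

Definition normal p : 'rV[R]_m.+1 := hv 1 (- p).

Definition tang p : 'M[R]_(m, m.+1) := row_mx ((slant p)^-1 *: p^T) (rotA p).

(* An orthogonal matrix mapping the first basis vector to the unit normal and its
   orthogonal complement to the directions of the hyperplane. *)
Definition rotQ p : 'M[R]_m.+1 := col_mx ((slant p)^-1 *: normal p) (tang p).

Lemma mul_rotQ p (h : R) w : hv h w *m rotQ p = (h / slant p) *: normal p + w *m tang p.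
Proof.
by rewrite /rotQ /hv (@mul_row_col _ 1 1 m) mul_scalar_mx scalerA.
Qed.

Lemma tang_orth p : tang p *m (tang p)^T = 1%:M.
Proof.
rewrite /tang (@tr_row_mx _ m 1 m) (@mul_row_col _ m 1 m m) trmx_rotA linearZ /= trmxK -scalemxAl -scalemxAr scalerA.
by rewrite addrC -invfM -expr2 rotA_orth.
Qed.

Lemma tang_normal p : tang p *m (normal p)^T = 0.
Proof.
rewrite /tang /normal /hv (@tr_row_mx _ 1 1 m) (@mul_row_col _ m 1 m 1) tr_scalar_mx mul_mx_scalar scale1r.
by rewrite linearN /= mulmxN -trmx_rotA -trmx_mul mul_rotA linearZ /= subrr.
Qed.

Lemma edot_normal p : edot (normal p) (normal p) = slant p ^+ 2.
Proof.
rewrite /normal edot_hv mulr1 slant_sqr; congr (_ + _).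
by apply: eq_bigr => i _; rewrite !mxE mulrNN.
Qed.

Lemma rotQ_orth p : rotQ p *m (rotQ p)^T = 1%:M.
Proof.
have r0 := slant_gt0 p.
rewrite /rotQ (@tr_col_mx _ 1 m m.+1) (@mul_col_row _ 1 m m.+1 1 m) tang_orth linearZ /= -!scalemxAl -!scalemxAr tang_normal.
rewrite row_mul_tr edot_normal scalerA scaler0.
have -> : normal p *m (tang p)^T = 0 by rewrite -[LHS]trmxK trmx_mul trmxK tang_normal trmx0.
rewrite scaler0 scale_scalar_mx -(_ : 1 = (slant p)^-1 / slant p * slant p ^+ 2); last first.
  by field; rewrite gt_eqF.
by rewrite -(@scalar_mx_block _ 1 m).
Qed.

Lemma rotQ_unit p : rotQ p \in unitmx.
Proof. by have /mulmx1_unit[] := rotQ_orth p. Qed.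

Lemma norm_det_rotQ p : `|\det (rotQ p)| = 1.
Proof.
have : \det (rotQ p) ^+ 2 = 1 by rewrite expr2 -{2}(det_tr (rotQ p)) -det_mulmx rotQ_orth det1.
by move=> /eqP; rewrite sqrf_eq1 => /orP[] /eqP ->; rewrite ?normrN1 ?normr1.
Qed.

Lemma edot_rotQ p x y : edot (x *m rotQ p) (y *m rotQ p) = edot x y.
Proof. by rewrite !edotE trmx_mul mulmxA -(mulmxA x) rotQ_orth mulmx1. Qed.

(** Multiplying the orthogonal [rotQ p] by a unipotent matrix makes it block triangular, with
    diagonal blocks [slant p] and [rotA p]. *)
Lemma norm_det_rotA p : `|\det (rotA p)| = (slant p)^-1.
Proof.
have r0 := slant_gt0 p.
have E : rotQ p *m (block_mx 1%:M 0 (- p^T) 1%:M : 'M[R]_(1 + m)) =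
  (block_mx (slant p)%:M (- (slant p)^-1 *: p) 0 (rotA p) : 'M[R]_(1 + m)).
  have -> : rotQ p = (block_mx ((slant p)^-1 *: 1%:M) ((slant p)^-1 *: - p)
      ((slant p)^-1 *: p^T) (rotA p) : 'M[R]_(1 + m)).
    by rewrite /rotQ /normal /tang /hv (@scale_row_mx _ 1 1 m).
  rewrite (@mulmx_block _ 1 m 1 m 1 m).
  rewrite !mulmx0 !mulmx1 !add0r -scalemxAl mulNmx mulmxN opprK row_mul_tr.
  rewrite !scale_scalar_mx -raddfD /= -mulrDr.
  rewrite (_ : (slant p)^-1 * (1 + edot p p) = slant p); last first.
    by rewrite -slant_sqr; field; rewrite gt_eqF.
  rewrite mulmxN -[X in X *m p^T]trmx_rotA -trmx_mul mul_rotA linearZ /= subrr.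
  by rewrite scalerN scaleNr.
have := congr1 (fun M => `|\det M|) E.
rewrite det_mulmx (@det_lblock _ 1 m) (@det_ublock _ 1 m) !det1 !mulr1 det_scalar1 norm_det_rotQ.
rewrite normrM (gtr0_norm r0) => h; rewrite -[LHS](mulKf (lt0r_neq0 r0)) -h mulr1//.
Qed.

End Rot.

Section Graph.
Variables (R : realType) (m : nat).
Implicit Types (x z g : 'rV[R]_m.+1).

Definition tail x : 'rV[R]_m := \row_j x 0 (lift ord0 j).

Lemma hv_tail x : hv (x 0 ord0) (tail x) = x.
Proof. by rewrite -hvP. Qed.

Lemma tail_hv t w : tail (hv t w : 'rV[R]_m.+1) = w.
Proof. by apply/rowP => j; rewrite mxE hvS. Qed.

Lemma tailD x z : tail (x + z) = tail x + tail z.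
Proof. by apply/rowP => j; rewrite !mxE. Qed.

Lemma tailZ c x : tail (c *: x) = c *: tail x.
Proof. by apply/rowP => j; rewrite !mxE. Qed.

Lemma tail_sum (I : Type) (r : seq I) (F : I -> 'rV[R]_m.+1) :
  tail (\sum_(i <- r) F i) = \sum_(i <- r) tail (F i).
Proof.
by apply: (big_morph tail tailD); apply/rowP => j; rewrite !mxE.
Qed.

Lemma edotDl k (u v w : 'rV[R]_k) : edot (u + v) w = edot u w + edot v w.
Proof. by rewrite -big_split /=; apply: eq_bigr => j _; rewrite mxE mulrDl. Qed.

Lemma edotC k (u v : 'rV[R]_k) : edot u v = edot v u.
Proof. by apply: eq_bigr => j _; rewrite mulrC. Qed.

Lemma edotDr k (u v w : 'rV[R]_k) : edot w (u + v) = edot w u + edot w v.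
Proof. by rewrite ![edot w _]edotC edotDl. Qed.

Lemma edotZl k (c : R) (u v : 'rV[R]_k) : edot (c *: u) v = c * edot u v.
Proof. by rewrite /edot mulr_sumr; apply: eq_bigr => j _; rewrite mxE mulrA. Qed.

Lemma edotZr k (c : R) (u v : 'rV[R]_k) : edot u (c *: v) = c * edot u v.
Proof. by rewrite edotC edotZl edotC. Qed.

Lemma edot_sumr k (I : Type) (r : seq I) (F : I -> 'rV[R]_k) u :
  edot u (\sum_(i <- r) F i) = \sum_(i <- r) edot u (F i).
Proof.
apply: (big_morph (edot u) (fun a b => edotDr a b u)).
by rewrite /edot big1// => j _; rewrite mxE mulr0.
Qed.

Lemma edotNl k (u v : 'rV[R]_k) : edot (- u) v = - edot u v.
Proof. by rewrite -scaleN1r edotZl mulN1r. Qed.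

Lemma cauchy_schwarz k (u v : 'rV[R]_k) : edot u v ^+ 2 <= edot u u * edot v v.
Proof.
have [v0|v0] := eqVneq (edot v v) 0.
  have -> : v = 0.
    apply/rowP => j; rewrite mxE; apply/eqP; rewrite -sqrf_eq0 expr2.
    move/eqP: v0; rewrite psumr_eq0 => [|i _]; last by rewrite -expr2 sqr_ge0.
    by move=> /allP/(_ j (mem_index_enum _)).
  have e0 (w : 'rV[R]_k) : edot w 0 = 0 by rewrite /edot big1// => j _; rewrite mxE mulr0.
  by rewrite !e0 expr0n mulr0.
have vp : 0 < edot v v by rewrite lt_neqAle eq_sym v0 edot_ge0.
have := edot_ge0 (edot v v *: u + (- edot u v) *: v).
rewrite !(edotDl, edotDr, edotZl, edotZr) [edot v u]edotC => h.
have : 0 <= edot v v * (edot u u * edot v v - edot u v ^+ 2) by move: h; nra.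
by rewrite pmulr_rge0// subr_ge0.
Qed.

(* [g = (s, p)] encodes the hyperplane x_0 = s + <p, x'>. *)
Definition side g x : R := x 0 ord0 - edot g (hv 1 (tail x)).

Lemma sideE g x : side g x = edot (normal (tail g)) x - g 0 ord0.
Proof.
rewrite /side -[in edot g _](hv_tail g) edot_hv mulr1 -[in edot _ x](hv_tail x) /normal.
by rewrite edot_hv mul1r edotNl opprD addrA addrAC.
Qed.

Lemma side_sum g k (w : 'I_k -> R) (z : 'I_k -> 'rV[R]_m.+1) : \sum_i w i = 1 ->
  side g (\sum_i w i *: z i) = \sum_i w i * side g (z i).
Proof.
move=> w1; rewrite sideE edot_sumr.
under [RHS]eq_bigr do rewrite sideE mulrBr.
rewrite sumrB -mulr_suml w1 mul1r; congr (_ - _).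
by apply: eq_bigr => i _; rewrite edotZr.
Qed.

Definition plane g : set 'rV[R]_m.+1 := [set x | side g x = 0].

Definition tail_hom k (y : 'I_k -> 'rV[R]_m.+1) := hom (fun i => tail (y i)).

(* The parameters (s, p) of the hyperplane through the points [y]. *)
Definition graph_param (y : 'I_m.+1 -> 'rV[R]_m.+1) : 'rV[R]_m.+1 :=
  (invmx (tail_hom y) *m (\col_i y i 0 ord0))^T.

Lemma gB_mul k (y : 'I_k -> 'rV[R]_m.+1) g i : (tail_hom y *m g^T) i 0 = edot g (hv 1 (tail (y i))).
Proof.
by rewrite edotC mxE; apply: eq_bigr => j _; rewrite !mxE.
Qed.

Lemma gparP (y : 'I_m.+1 -> 'rV[R]_m.+1) i : tail_hom y \in unitmx -> side (graph_param y) (y i) = 0.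
Proof.
move=> uB; rewrite /side -gB_mul trmxK mulKVmx// mxE subrr//.
Qed.

Section OneSimplex.
Variables (y : 'I_m.+1 -> 'rV[R]_m.+1) (g : 'rV[R]_m.+1).
Hypotheses (uB : tail_hom y \in unitmx) (Hg : forall i, side g (y i) = 0).
Let p := tail g.
Let s := g 0 ord0.

Definition bary (z : 'rV[R]_m.+1) : 'rV[R]_m.+1 := hv 1 (tail z) *m invmx (tail_hom y).

Lemma bary_hom z : \sum_i bary z 0 i *: hv 1 (tail (y i)) = hv 1 (tail z).
Proof.
rewrite -[RHS](mulmxKV uB) -/(bary z) mulmx_sum_row.
by apply: eq_bigr => i _; rewrite rowK.
Qed.

Lemma bary_sum z : \sum_i bary z 0 i = 1.
Proof.
have := congr1 (fun v : 'rV[R]_m.+1 => v 0 ord0) (bary_hom z).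
rewrite hv0 summxE => <-; apply: eq_bigr => i _; by rewrite [RHS]mxE hv0 mulr1.
Qed.

(** The weights are computed from tails alone; the heights then agree because a point of a graph is
    determined by its tail. *)
Lemma bary_plane z : plane g z -> z = \sum_i bary z 0 i *: y i.
Proof.
move=> Hz; rewrite -[LHS]hv_tail -[RHS]hv_tail.
have Ht : tail z = tail (\sum_i bary z 0 i *: y i).
  have := congr1 tail (bary_hom z); rewrite tail_hv => <-.
  by rewrite !tail_sum; apply: eq_bigr => i _; rewrite !tailZ tail_hv.
rewrite -Ht; congr hv.
have : side g (\sum_i bary z 0 i *: y i) = 0.
  by rewrite side_sum ?bary_sum// big1// => i _; rewrite Hg mulr0.
rewrite /side -Ht => /eqP; rewrite subr_eq0 => /eqP ->.
by apply/eqP; rewrite -subr_eq0; apply/eqP.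
Qed.

Lemma conv_plane z : conv_pts y z -> plane g z.
Proof.
move=> [w [_ [w1 ->]]]; rewrite /plane /= side_sum// big1// => i _.
by rewrite Hg mulr0.
Qed.

Lemma conv_vertex k (x : 'I_k -> 'rV[R]_m.+1) i : conv_pts x (x i).
Proof.
exists (fun j => (j == i)%:R); split; first by move=> j; case: eqP.
split.
  by rewrite (bigD1 i)//= eqxx big1 ?addr0// => j /negbTE ->.
by rewrite (bigD1 i)//= eqxx scale1r big1 ?addr0// => j /negbTE ->; rewrite scale0r.
Qed.

Lemma aff_hull_conv : aff_hull (conv_pts y) = plane g.
Proof.
apply/seteqP; split => z.
  move=> [k [v [w [Hv [w1 ->]]]]]; rewrite /plane /= side_sum// big1// => i _.
  by rewrite (conv_plane (Hv i)) mulr0.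
move=> Hz; exists m.+1, y, (fun i => bary z 0 i); split; first by move=> i; exact: conv_vertex.
by split; [exact: bary_sum|exact: bary_plane].
Qed.

Lemma dist0_plane : dist0 (plane g) = `|s| / slant p.
Proof.
have r0 := slant_gt0 p.
have pE x : plane g x <-> edot (normal p) x = s.
  by rewrite /plane /= sideE -/p -/s; split => [/eqP|->]; rewrite ?subrr// subr_eq0 => /eqP.
rewrite /dist0; apply/eqP; rewrite eq_le; apply/andP; split.
  apply: ge_inf.
    by exists 0 => _ [x _ <-]; exact: enorm_ge0.
  (* The foot of the perpendicular from the origin attains the distance; the opposite bound is
     Cauchy-Schwarz against the normal. *)
  exists ((s / slant p ^+ 2) *: normal p).
    apply/pE; rewrite edotZr edot_normal divfK// expf_neq0// gt_eqF//.
  rewrite /enorm edotZl edotZr edot_normal.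
  have -> : s / slant p ^+ 2 * (s / slant p ^+ 2 * slant p ^+ 2) = (s / slant p) ^+ 2.
    by field; rewrite gt_eqF.
  by rewrite sqrtr_sqr normrM normfV (gtr0_norm r0).
apply: lb_le_inf.
  exists (enorm (y ord0)), (y ord0) => //; exact: Hg.
move=> _ [x /pE Hx <-]; rewrite ler_pdivrMr//.
rewrite -(ler_pXn2r (_ : 0 < 2)%N) ?nnegrE ?mulr_ge0 ?enorm_ge0 ?(ltW r0)//.
rewrite real_normK ?num_real// exprMn enorm_sqr -edot_normal -Hx mulrC.
exact: cauchy_schwarz.
Qed.

Lemma tang_plane c : side g c = 0 ->
  plane g = [set c + z *m tang p | z in [set: 'rV[R]_m]].
Proof.
move=> Hc; have r0 := slant_gt0 p.
apply/seteqP; split => [v Hv|_ [z _ <-]]; last first.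
  rewrite /plane /= sideE -/p edotDr -(_ : side g c = 0)// sideE -/p.
  have -> : edot (normal p) (z *m tang p) = 0.
    by rewrite edotC edotE -mulmxA tang_normal mulmx0 mxE.
  by rewrite addr0.
exists ((v - c) *m (tang p)^T) => //.
have E : (rotQ p)^T *m rotQ p = 1%:M by apply: mulmx1C; exact: rotQ_orth.
have N0 : (v - c) *m (normal p)^T = 0.
  rewrite row_mul_tr edotC edotDr -scaleN1r edotZr mulN1r.
  move: Hv Hc; rewrite /plane /= !sideE -/p => /eqP; rewrite subr_eq0 => /eqP -> /eqP.
  by rewrite subr_eq0 => /eqP ->; rewrite subrr raddf0.
have : (v - c) *m ((rotQ p)^T *m rotQ p) = v - c by rewrite E mulmx1.
rewrite /rotQ (@tr_col_mx _ 1 m m.+1) (@mul_row_col _ m.+1 1 m m.+1) mulmxDr.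
rewrite !mulmxA [(_ *: normal p)^T]linearZ /= -!scalemxAr N0 scaler0 mul0mx scaler0 add0r => ->.
by rewrite addrC subrK.
Qed.

(** A direction inside the hyperplane has height [<p, tail>], so each edge is its tail times the
    matrix with blocks [p^T] and 1. *)
Lemma edges_tail : edges (fun i => tail (y i)) *m (row_mx p^T 1%:M : 'M[R]_(m, 1 + m)) =
  \matrix_(i < m) (y (lift ord0 i) - y ord0).
Proof.
apply/row_matrixP => i; rewrite row_mul !rowK (@mul_mx_row _ 1 m 1 m) mulmx1.
rewrite -[RHS]hv_tail tailD -[- y ord0]scaleN1r tailZ scaleN1r.
rewrite /hv; congr (@row_mx _ 1 1 m _ _).
rewrite row_mul_tr; congr (_%:M).
have := Hg (lift ord0 i); have := Hg ord0; rewrite !sideE -/p => /eqP; rewrite subr_eq0 => /eqP <-.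
move=> /eqP; rewrite subr_eq0 => /eqP.
rewrite -[in X in X -> _](hv_tail (y (lift ord0 i))) -[in X in X -> _](hv_tail (y ord0)).
rewrite /normal !edot_hv !mul1r !edotNl => h.
rewrite edotC edotDr -[- tail _]scaleN1r edotZr mulN1r !mxE.
lra.
by rewrite scaleN1r.
Qed.

(** Sylvester's determinant identity, from the two products [X *m U] and [U *m X] with the same
    unipotent [U]. *)
Lemma det_outer : \det (1%:M + p^T *m p) = slant p ^+ 2.
Proof.
pose X : 'M[R]_(1 + m) := block_mx 1%:M (- p) p^T 1%:M.
pose U : 'M[R]_(1 + m) := block_mx 1%:M p 0 1%:M.
have dU : \det U = 1 by rewrite (@det_ublock _ 1 m) !det1 mulr1.
have E1 : X *m U = (block_mx 1%:M 0 p^T (1%:M + p^T *m p) : 'M[R]_(1 + m)).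
  rewrite (@mulmx_block _ 1 m 1 m 1 m) !mul1mx !mulmx1 !mulmx0 !addr0 subrr.
  by rewrite addrC.
have E2 : U *m X = (block_mx (slant p ^+ 2)%:M 0 p^T 1%:M : 'M[R]_(1 + m)).
  rewrite (@mulmx_block _ 1 m 1 m 1 m) !mul1mx !mul0mx !mulmx1 !add0r addNr.
  by rewrite row_mul_tr -raddfD /= slant_sqr.
have := congr1 (fun M => \det M) E1; rewrite det_mulmx dU mulr1 (@det_lblock _ 1 m) det1 mul1r => <-.
have := congr1 (fun M => \det M) E2; rewrite det_mulmx dU mul1r (@det_lblock _ 1 m) det1 mulr1 det_scalar1.
by [].
Qed.

(** [hyp_param] is an arbitrary choice, so every isometric parametrisation is treated. Its edges and
    those of the tails describe the same vectors; comparing Gram determinants, with [M *m M^T = 1]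
    and [W *m W^T = 1 + p^T p], yields the factor [slant p]. *)
Lemma conv_param (c : 'rV[R]_m.+1) (M : 'M[R]_(m, m.+1)) : M *m M^T = 1%:M ->
  plane g = [set c + z *m M | z in [set: 'rV[R]_m]] ->
  leb_vol [set z : 'rV[R]_m | conv_pts y (c + z *m M)] =
  (slant p * `|\det (tail_hom y)| / (m`!)%:R)%:E.
Proof.
move=> MM PE; have r0 := slant_gt0 p.
have Hz i : exists z : 'rV[R]_m, c + z *m M = y i.
  have : plane g (y i) by exact: Hg.
  by rewrite PE => -[z _ <-]; exists z.
have [z zE] := boolp.choice Hz.
have Minj (v w : 'rV[R]_m) : c + v *m M = c + w *m M -> v = w.
  by move=> /addrI h; rewrite -[v]mulmx1 -MM mulmxA h -mulmxA MM mulmx1.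
have -> : [set v : 'rV[R]_m | conv_pts y (c + v *m M)] = conv_pts z.
  apply/seteqP; split => v /= [w [w0 [w1 E]]]; exists w; split => //; split => //.
    apply: Minj; rewrite E mulmx_suml; under eq_bigr do rewrite -zE scalerDr.
    rewrite big_split /= -scaler_suml w1 scale1r; congr (_ + _).
    by apply: eq_bigr => i _; rewrite scalemxAl.
  rewrite E mulmx_suml; under [RHS]eq_bigr do rewrite -zE scalerDr.
  rewrite big_split /= -scaler_suml w1 scale1r; congr (_ + _).
  by apply: eq_bigr => i _; rewrite scalemxAl.
pose W : 'M[R]_(m, m.+1) := (row_mx p^T 1%:M : 'M[R]_(m, 1 + m)).
have WW : W *m W^T = 1%:M + p^T *m p.
  by rewrite /W (@tr_row_mx _ m 1 m) trmxK trmx1 (@mul_row_col _ m 1 m m) mulmx1 addrC.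
have Ez : edges (fun i => tail (y i)) *m W = edges z *m M.
  rewrite edges_tail; apply/row_matrixP => i; rewrite row_mul !rowK -!zE mulmxBl.
  by rewrite opprD addrACA subrr add0r.
have dz : \det (hom z) ^+ 2 = (slant p * \det (tail_hom y)) ^+ 2.
  rewrite !det_hom.
  have := congr1 (fun X : 'M[R]_(m, m.+1) => \det (X *m X^T)) Ez.
  rewrite (_ : \det (edges z *m M *m (edges z *m M)^T) = \det (edges z) ^+ 2); last first.
    by rewrite trmx_mul -mulmxA (mulmxA M) MM mul1mx det_mulmx det_tr expr2.
  move=> <-; rewrite trmx_mul -mulmxA (mulmxA W) WW.
  by rewrite !det_mulmx det_tr det_outer; ring.
have ndz : `|\det (hom z)| = slant p * `|\det (tail_hom y)|.
  have : `|\det (hom z)| ^+ 2 = (slant p * `|\det (tail_hom y)|) ^+ 2.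
    by rewrite real_normK ?num_real// dz !exprMn real_normK ?num_real.
  by move=> /eqP; rewrite eqrXn2 ?mulr_ge0 ?(ltW r0)// => /eqP.
rewrite leb_vol_conv ?ndz//.
rewrite unitmxE unitfE -normr_eq0 ndz; apply: mulf_neq0; first by rewrite gt_eqF.
by rewrite normr_eq0; move: uB; rewrite unitmxE unitfE.
Qed.

Lemma facet_vol_conv : facet_vol (conv_pts y) = slant p * `|\det (tail_hom y)| / (m`!)%:R.
Proof.
rewrite /facet_vol.
have [MM PE] : (hyp_param (conv_pts y)).2 *m (hyp_param (conv_pts y)).2^T = 1%:M /\
   aff_hull (conv_pts y) = [set (hyp_param (conv_pts y)).1 + z *m (hyp_param (conv_pts y)).2 | z in [set: 'rV[R]_m]].
  (* The default of [xget] cannot occur, since [(y ord0, tang p)] is an isometric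
     parametrisation. *)
  rewrite /hyp_param; case: xgetP => [pM -> //|/(_ (y ord0, tang p))]; case; split => /=.
    exact: tang_orth.
  by rewrite aff_hull_conv; apply: tang_plane; exact: Hg.
by rewrite conv_param// -aff_hull_conv.
Qed.

End OneSimplex.
End Graph.

(** * Facets of polytopes in general position *)

Lemma rank_supported (F : fieldType) m n k (S : {set 'I_k}) (C : 'M[F]_(m, k)) (D : 'M[F]_(k, n)) :
  (forall i j, j \notin S -> C i j = 0) -> (\rank (C *m D) <= #|S|)%N.
Proof.
move=> C0.
rewrite (_ : C *m D = (\matrix_(i < m, l < #|S|) C i (enum_val l)) *m (\matrix_(l < #|S|, j < n) D (enum_val l) j)).
  by apply: leq_trans (mxrankM_maxl _ _) (rank_leq_col _).
apply/matrixP => i j; rewrite !mxE (bigID (mem S))/= [X in _ + X]big1 ?addr0; last first.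
  by move=> l lS; rewrite C0// mul0r.
by rewrite big_enum_val; apply: eq_bigr => l _; rewrite !mxE.
Qed.

Definition increasing d n (i : 'I_d -> 'I_n) : bool :=
  [forall k : 'I_d, forall l : 'I_d, (k < l)%N ==> (i k < i l)%N].

Lemma increasingP d n (i : 'I_d -> 'I_n) :
  reflect (forall k l : 'I_d, (k < l)%N -> (i k < i l)%N) (increasing i).
Proof.
apply: (iffP forallP) => [H k l kl|H k]; last by apply/forallP => l; apply/implyP; exact: H.
by have /forallP/(_ l)/implyP := H k; apply.
Qed.

Lemma increasing_inj d n (i : 'I_d -> 'I_n) : increasing i -> injective i.
Proof.
move=> /increasingP H k l kl; apply: ord_inj; case: (ltngtP k l) => // /H; rewrite kl ltnn//.
Qed.

Lemma sorted_enum n (S : {set 'I_n}) : sorted (fun a b : 'I_n => (a < b)%N) (enum S).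
Proof.
rewrite -[enum S]/(seq.filter _ (Finite.enum _)) -enumT; apply: sorted_filter.
  by move=> a b c; exact: ltn_trans.
by rewrite -(@sorted_map _ _ val ltn) val_enum_ord iota_ltn_sorted.
Qed.

Lemma increasing_subset d n (S : {set 'I_n}) : (d <= #|S|)%N ->
  exists2 i : {ffun 'I_d -> 'I_n}, increasing i & forall k, i k \in S.
Proof.
move=> dS; exists [ffun k => enum_val (widen_ord dS k)]; last first.
  by move=> k; rewrite ffunE enum_valP.
apply/increasingP => k l kl; rewrite !ffunE.
have x0 : 'I_n := enum_val (widen_ord dS k).
rewrite !(enum_val_nth x0) /=.
have tr : transitive (fun a b : 'I_n => (a < b)%N) by move=> a b c; exact: ltn_trans.
apply: (sorted_ltn_nth tr x0 (sorted_enum S)) => //; rewrite inE -cardE;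
  exact: leq_trans (ltn_ord _) dS.
Qed.

Lemma increasing_eq d n (i j : {ffun 'I_d -> 'I_n}) : increasing i -> increasing j ->
  (forall k, (exists l, i l = k) <-> (exists l, j l = k)) -> i = j.
Proof.
move=> hi hj ij.
have S (h : {ffun 'I_d -> 'I_n}) : increasing h -> sorted ltn [seq nat_of_ord (h k) | k <- enum 'I_d].
  move=> /increasingP hh.
  apply: (@homo_sorted _ _ (fun k => nat_of_ord (h k)) (fun a b : 'I_d => (a < b)%N)) => //.
  by rewrite -(@sorted_map _ _ val ltn) val_enum_ord iota_ltn_sorted.
have E : [seq nat_of_ord (i k) | k <- enum 'I_d] = [seq nat_of_ord (j k) | k <- enum 'I_d].
  apply: (irr_sorted_eq ltn_trans ltnn) => [||x]; [exact: S|exact: S|].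
  apply/mapP/mapP => -[k _ ->].
    have /ij[l lE] : exists l, i l = i k by exists k.
    by exists l; rewrite ?mem_enum// lE.
  have /ij[l lE] : exists l, j l = j k by exists k.
  by exists l; rewrite ?mem_enum// lE.
apply/ffunP => k; apply: ord_inj.
have H (h : {ffun 'I_d -> 'I_n}) : nth 0%N [seq nat_of_ord (h k) | k <- enum 'I_d] k = h k.
  by rewrite (nth_map k) ?size_enum_ord// nth_ord_enum.
by rewrite -[LHS]H E H.
Qed.

Section Facets.
Variables (R : realType) (m n : nat) (x : 'I_n -> 'rV[R]_m.+1).
Implicit Types (I J : {ffun 'I_m.+1 -> 'I_n}).

(** The first condition makes the hyperplane through the tuple a graph, the second keeps all other
    points off it. *)
Definition gen_pos := forall I, increasing I -> tail_hom (x \o I) \in unitmx /\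
  forall k, (forall j, I j != k) -> side (graph_param (x \o I)) (x k) != 0.

Definition one_sided I : bool :=
  [forall k, [forall j, I j != k] ==> (side (graph_param (x \o I)) (x k) < 0)] ||
  [forall k, [forall j, I j != k] ==> (0 < side (graph_param (x \o I)) (x k))].

(** A nonzero factor [e] stands for the side, so both sides are handled at once; for a given facet
    it is the first coordinate of the supporting functional. *)
Lemma one_sidedP I : reflect
  (exists2 e : R, e != 0 & forall k, (forall j, I j != k) -> e * side (graph_param (x \o I)) (x k) < 0)
  (one_sided I).
Proof.
apply: (iffP orP) => [[|] /forallP H|[e e0 H]].
- exists 1; first exact: oner_neq0.
  by move=> k Hk; rewrite mul1r; have := H k; rewrite (introT forallP Hk).
- exists (-1); first by rewrite oppr_eq0 oner_neq0.
  by move=> k Hk; rewrite mulN1r oppr_lt0; have := H k; rewrite (introT forallP Hk).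
have [ep|en] := ltrP 0 e.
  by left; apply/forallP => k; apply/implyP => /forallP/H; rewrite pmulr_rlt0.
right; apply/forallP => k; apply/implyP => /forallP/H.
by rewrite nmulr_rlt0// lt_neqAle e0.
Qed.

Lemma conv_sub I z : injective I -> conv_pts (x \o I) z -> conv_pts x z.
Proof.
move=> Ii [w [w0 [w1 ->]]].
exists (fun k => \sum_(j | I j == k) w j); split; first by move=> k; apply: sumr_ge0.
split.
  rewrite -w1 (exchange_big_dep xpredT)//=; apply: eq_bigr => j _.
  by rewrite (big_pred1 (I j))// => k; rewrite eq_sym.
under [RHS]eq_bigr do rewrite scaler_suml.
rewrite (exchange_big_dep xpredT)//=; apply: eq_bigr => j _.
by rewrite (big_pred1 (I j))// => k; rewrite eq_sym.
Qed.

(** A convex combination of nonpositive values [l (x k)] is 0 only if each term is, so all weight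
    sits on the indices in [I]. *)
Lemma face_conv I (l : 'rV[R]_m.+1 -> R) : injective I ->
  (forall (w : 'I_n -> R), \sum_k w k = 1 -> l (\sum_k w k *: x k) = \sum_k w k * l (x k)) ->
  (forall j, l (x (I j)) = 0) -> (forall k, (forall j, I j != k) -> l (x k) < 0) ->
  conv_pts x `&` [set z | l z = 0] = conv_pts (x \o I).
Proof.
move=> Ii l_aff l0 ln; apply/seteqP; split => [z [[w [w0 [w1 ->]]]] /=|z Hz]; last first.
  split; first exact: conv_sub Hz.
  have [w [w0 [w1 ->]]] := Hz.
  pose w' k := \sum_(j | I j == k) w j.
  have E : \sum_i w i *: (x \o I) i = \sum_k w' k *: x k.
    rewrite /w'; under [RHS]eq_bigr do rewrite scaler_suml.
    rewrite (exchange_big_dep xpredT)//=; apply: eq_bigr => j _.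
    by rewrite (big_pred1 (I j))// => k; rewrite eq_sym.
  have w'1 : \sum_k w' k = 1.
    rewrite -w1 /w' (exchange_big_dep xpredT)//=; apply: eq_bigr => j _.
    by rewrite (big_pred1 (I j))// => k; rewrite eq_sym.
  rewrite /= E l_aff// big1// => k _; rewrite /w' mulr_suml big1// => j /eqP <-.
  by rewrite l0 mulr0.
rewrite l_aff// => H.
have wout k : (forall j, I j != k) -> w k = 0.
  move=> Hk; have lk := ln k Hk.
  have : \sum_k w k * - l (x k) == 0.
    by under eq_bigr do rewrite mulrN; rewrite sumrN H oppr0.
  rewrite psumr_eq0 => [/allP/(_ k (mem_index_enum _))/=|k' _].
    by rewrite mulf_eq0 oppr_eq0 (lt_eqF lk) orbF => /eqP.
  rewrite mulr_ge0// oppr_ge0.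
  have [/forallP/ln/ltW//|] := boolP [forall j, I j != k'].
  by move/forallPn => [j]; rewrite negbK => /eqP <-; rewrite l0.
have red (V : nmodType) (F : 'I_n -> V) : (forall k, (forall j, I j != k) -> F k = 0) ->
    \sum_k F k = \sum_j F (I j).
  move=> F0; rewrite (bigID (fun k => [exists j, I j == k]))/= [X in _ + X]big1 ?addr0; last first.
    by move=> k /existsPn Hk; apply: F0.
  rewrite (eq_bigl (mem (I @: [set: 'I_m.+1]))); last first.
    move=> k; apply/existsP/imsetP => [[j /eqP <-]|[j _ ->]]; first by exists j; rewrite ?inE.
    by exists j.
  by rewrite big_imset/=; [apply: eq_bigl => j; rewrite in_setT|move=> a b _ _; exact: Ii].
exists (fun j => w (I j)); split => //; split.
  by rewrite -w1 [RHS]red.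
by apply: red => k /wout ->; rewrite scale0r.
Qed.

Lemma face_good I : gen_pos -> increasing I -> one_sided I ->
  is_facet (conv_pts x) (conv_pts (x \o I)).
Proof.
move=> gp iI /one_sidedP[e e0 He]; have [uB sn] := gp I iI.
have Ii := increasing_inj iI.
set g := graph_param (x \o I) in He sn *.
have s0 j : side g (x (I j)) = 0 by exact: (@gparP _ _ (x \o I)).
have lin (w : 'I_n -> R) : \sum_k w k = 1 ->
    e * side g (\sum_k w k *: x k) = \sum_k w k * (e * side g (x k)).
  by move=> w1; rewrite side_sum// mulr_sumr; apply: eq_bigr => k _; rewrite mulrCA.
have FE := face_conv (l := fun z => e * side g z) Ii lin (fun j => etrans (congr1 _ (s0 j)) (mulr0 e)) He.
have eE z : edot (e *: normal (tail g)) z - e * g 0 ord0 = e * side g z.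
  by rewrite edotZl sideE mulrBr.
split.
  exists (e *: normal (tail g)), (e * g 0 ord0); split.
    rewrite scaler_eq0 (negbTE e0)/=; apply/eqP => /(congr1 (fun v : 'rV[R]_m.+1 => v 0 ord0)).
    by rewrite /normal hv0 mxE => /eqP; rewrite oner_eq0.
  split.
    move=> z [w [w0 [w1 ->]]]; rewrite -subr_le0 eE lin//.
    rewrite -oppr_ge0 -sumrN; apply: sumr_ge0 => k _; rewrite -mulrN mulr_ge0// oppr_ge0.
    have [/forallP/He/ltW//|/forallPn[j]] := boolP [forall j, I j != k].
    by rewrite negbK => /eqP <-; rewrite s0 mulr0.
  rewrite -FE; congr (_ `&` _); apply/seteqP; split => z /= /eqP.
    by rewrite -eE subr_eq0 => /eqP.
  by rewrite -subr_eq0 eE => /eqP.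
exists (x \o I); split; first by move=> j; exact: conv_vertex.
rewrite /aff_indep.
have := @edges_tail _ _ (x \o I) g s0.
set W := row_mx _ _ => EW.
have -> : \matrix_(i < m, j < m.+1) ((x \o I) (lift ord0 i) - (x \o I) ord0) 0 j =
   edges (fun i => tail ((x \o I) i)) *m W.
  by rewrite EW; apply/matrixP => i j; rewrite !mxE.
have uE : edges (fun i => tail ((x \o I) i)) \in unitmx.
  by move: uB; rewrite unitmxE det_hom -unitmxE.
have rW : row_free W.
  apply/row_freeP; exists (col_mx 0 1%:M : 'M[R]_(1 + m, m)).
  by rewrite (@mul_row_col _ m 1 m m) mulmx0 mulmx1 add0r.
apply/eqP; rewrite mxrankMfree// -/(row_free _) row_free_unit //.
Qed.

(** Recovers the index set from the facet, so that distinct tuples give distinct facets. *)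
Lemma gen_pos_mem I k : gen_pos -> increasing I ->
  conv_pts (x \o I) (x k) <-> exists j, I j = k.
Proof.
move=> gp iI; have [uB sn] := gp I iI.
split=> [Hk|[j <-]]; last exact: (@conv_vertex _ _ _ (x \o I)).
apply: contrapT => nk.
have : side (graph_param (x \o I)) (x k) != 0 by apply: sn => j; apply/eqP => jk; apply: nk; exists j.
move/eqP; apply; apply: (@conv_plane _ _ _ _ _ _ Hk) => j; exact: gparP.
Qed.

Lemma conv_facet_inj I J : gen_pos -> increasing I -> increasing J ->
  conv_pts (x \o I) = conv_pts (x \o J) -> I = J.
Proof.
move=> gp iI iJ IJ; apply: increasing_eq => // k.
by rewrite -!gen_pos_mem// IJ.
Qed.

(** The supporting hyperplane contains at least [m + 1] of the points. It is then the hyperplane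
    through some increasing tuple of them, and general position leaves no further point on it. *)
Lemma facet_conv F : (m < n)%N -> gen_pos -> is_facet (conv_pts x) F ->
  exists I, [/\ increasing I, one_sided I & F = conv_pts (x \o I)].
Proof.
move=> mn gp [[u [t [u0 [Pt FE]]]] [z [Fz indz]]].
pose l v := edot u v - t.
have lin (w : 'I_n -> R) : \sum_k w k = 1 ->
    l (\sum_k w k *: x k) = \sum_k w k * l (x k).
  move=> w1; rewrite /l edot_sumr; under [RHS]eq_bigr do rewrite mulrBr.
  by rewrite sumrB -mulr_suml w1 mul1r; congr (_ - _); apply: eq_bigr => k _; rewrite edotZr.
have lx k : l (x k) <= 0 by rewrite subr_le0; apply: Pt; exact: conv_vertex.
pose K : {set 'I_n} := finset (fun k => l (x k) == 0).
have HW j : exists w : 'I_n -> R, [/\ \sum_k w k = 1, z j = \sum_k w k *: x k & forall k, k \notin K -> w k = 0].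
  move: (Fz j); rewrite FE => -[[w [w0 [w1 E]]]] /= H; exists w; split => // k.
  rewrite inE => kK.
  have : \sum_k w k * - l (x k) == 0.
    under eq_bigr do rewrite mulrN; rewrite sumrN -lin// -E oppr_eq0.
    by rewrite /l H subrr.
  rewrite psumr_eq0 => [/allP/(_ k (mem_index_enum _))/=|k' _].
    by rewrite mulf_eq0 oppr_eq0 (negbTE kK) orbF => /eqP.
  by rewrite mulr_ge0// oppr_ge0.
have [w Hw] := boolp.choice HW.
have [k0 k0K] : exists k0, k0 \in K.
  apply: contrapT => nK; have [w1 _ w0] := Hw ord0.
  move: w1; rewrite big1 => [/eqP|k _]; first by rewrite eq_sym oner_eq0.
  by apply: w0; apply/negP => kK; apply: nK; exists k.
(* The [m] independent differences of the [z] are combinations of [x k - x k0] for [k] in [K] other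
   than [k0], because the weights of each difference sum to 0. *)
have cK : (m.+1 <= #|K|)%N.
  have : (\rank (\matrix_(i < m, j < m.+1) (z (lift ord0 i) - z ord0)%R 0%R j) <= #|K :\ k0|)%N.
    have -> : \matrix_(i < m, j < m.+1) (z (lift ord0 i) - z ord0) 0 j =
      (\matrix_(i < m, k < n) (if k \in K :\ k0 then w (lift ord0 i) k - w ord0 k else 0)) *m
      (\matrix_(k < n) (x k - x k0)).
      apply/row_matrixP => i; rewrite row_mul mulmx_sum_row.
      have -> : row i (\matrix_(i < m, j < m.+1) (z (lift ord0 i) - z ord0) 0 j) = z (lift ord0 i) - z ord0.
        by apply/rowP => j; rewrite !mxE.
      have [wi1 -> wi0] := Hw (lift ord0 i); have [wo1 -> wo0] := Hw ord0.
      rewrite -sumrB.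
      transitivity (\sum_k (w (lift ord0 i) k - w ord0 k) *: (x k - x k0)).
        under [RHS]eq_bigr do rewrite scalerBr.
        rewrite [RHS]sumrB -[X in _ = _ - X]scaler_suml [X in X *: _]sumrB wi1 wo1 subrr scale0r subr0.
        by apply: eq_bigr => k _; rewrite scalerBl.
      apply: eq_bigr => k _; rewrite rowK !mxE !inE.
      have [->|kk0] := eqVneq k k0; first by rewrite subrr !scaler0.
      rewrite andTb; case: ifPn => // kK.
      by rewrite wi0 ?wo0 ?subrr ?scale0r// inE.
    by apply: rank_supported => i k kK; rewrite mxE (negbTE kK).
  by rewrite indz (cardsD1 k0 K) k0K.
have [I iI IK] := increasing_subset cK.
have [uB sn] := gp I iI.
set g := graph_param (x \o I) in sn *.
have s0 j : side g (x (I j)) = 0 by exact: (@gparP _ _ (x \o I)).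
have lI j : l (x (I j)) = 0 by have := IK j; rewrite inE => /eqP.
(* In [l - u_0 side g] the height cancels, so it is an affine function [q] of the tail; it vanishes
   at [m + 1] affinely independent tails and hence identically. *)
have lE v : l v = u 0 ord0 * side g v.
  pose q : 'rV[R]_m.+1 := hv (u 0 ord0 * g 0 ord0 - t) (tail u + u 0 ord0 *: tail g).
  have qE y : edot q (hv 1 (tail y)) = l y - u 0 ord0 * side g y.
    rewrite /q edot_hv edotDl edotZl /l /side -[in edot u y](hv_tail u) -[in edot _ y](hv_tail y).
    rewrite -[in edot g _](hv_tail g) !edot_hv.
    by ring.
  have q0 : q = 0.
    have : tail_hom (x \o I) *m q^T = 0.
      by apply/colP => j; rewrite gB_mul qE lI s0 mulr0 subrr mxE.
    move/(congr1 (mulmx (invmx (tail_hom (x \o I))))); rewrite mulKmx// mulmx0 => /(congr1 trmx).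
    by rewrite trmxK trmx0.
  have := qE v; rewrite q0 (_ : edot 0 _ = 0); first by move/eqP; rewrite eq_sym subr_eq0 => /eqP.
  by rewrite /edot big1// => j _; rewrite mxE mul0r.
(* Otherwise [l] vanishes everywhere, so [edot u] is constant and [u] is 0. *)
have u00 : u 0 ord0 != 0.
  apply/eqP => u00; move/eqP: u0; apply.
  have E v w' : edot u v = edot u w'.
    by have := lE v; have := lE w'; rewrite u00 !mul0r /l => /eqP; rewrite subr_eq0 => /eqP -> /eqP; rewrite subr_eq0 => /eqP.
  have : edot u u = 0 by rewrite (E u 0) /edot big1// => j _; rewrite mxE mulr0.
  move/eqP; rewrite psumr_eq0 => [/allP H|j _]; last by rewrite -expr2 sqr_ge0.
  apply/rowP => j; rewrite mxE; apply/eqP.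
  by have := H j (mem_index_enum _); rewrite mulf_eq0 orbb.
have neg k : (forall j, I j != k) -> u 0 ord0 * side g (x k) < 0.
  move=> Hk; rewrite -lE lt_neqAle lx andbT lE mulf_neq0//; exact: sn.
exists I; split => //; first by apply/one_sidedP; exists (u 0 ord0).
rewrite -(face_conv (l := l) (increasing_inj iI) lin lI); last by move=> k Hk; rewrite lE; exact: neg.
rewrite FE; congr (_ `&` _); apply/seteqP; split => v /=; rewrite /l => /eqP.
  by rewrite -subr_eq0 => /eqP.
by rewrite subr_eq0 => /eqP.
Qed.

(** [I |-> conv (x_I)] is a bijection from the one-sided increasing tuples onto the facets, along
    which the sum over sets is reindexed. *)
Lemma Tab_gen_pos a b : (m < n)%N -> gen_pos ->
  Tab a b (conv_pts x) = \sum_(I : {ffun 'I_m.+1 -> 'I_n} | increasing I)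
    (one_sided I)%:R * ((`|graph_param (x \o I) 0 ord0| / slant (tail (graph_param (x \o I)))) `^ a *
      (slant (tail (graph_param (x \o I))) * `|\det (tail_hom (x \o I))| / (m`!)%:R) `^ b).
Proof.
move=> mn gp; rewrite /Tab.
rewrite (@reindex_fsbig _ _ _ _ _ (fun I : {ffun 'I_m.+1 -> 'I_n} => conv_pts (x \o I))
   [set` (fun I : {ffun 'I_m.+1 -> 'I_n} => increasing I && one_sided I)]); last first.
  split.
  - by move=> I /= /andP[iI oI]; exact: face_good.
  - move=> I J; rewrite !inE => /andP[iI _] /andP[iJ _]; exact: conv_facet_inj.
  - move=> F /= /(facet_conv mn gp)[I [iI oI ->]]; exists I => //=; exact/andP.
rewrite -(@bigfs _ _ _ _ (index_enum _))//; last 2 first.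
- exact: index_enum_uniq.
- by move=> I _; rewrite mem_index_enum.
rewrite [RHS](bigID one_sided)/= [X in _ + X]big1 ?addr0; last first.
  by move=> I /andP[_ /negbTE ->]; rewrite mul0r.
apply: eq_bigr => I /andP[iI oI]; rewrite oI mul1r; have [uB _] := gp I iI.
have s0 j : side (graph_param (x \o I)) ((x \o I) j) = 0 by exact: gparP.
by rewrite (aff_hull_conv uB s0) (dist0_plane s0) (facet_vol_conv uB s0).
Qed.

End Facets.

(** * Null configurations and the expectation as a sum over tuples *)

Section MeasGeom.
Context (R : realType) d (T : measurableType d).

Lemma measurable_det k (A : T -> 'M[R]_k) :
  (forall i j, measurable_fun setT (fun t => A t i j)) ->
  measurable_fun setT (fun t => \det (A t)).
Proof. by move=> mA; rewrite /determinant; meas. Qed.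

Lemma measurable_invmx k (A : T -> 'M[R]_k) i j :
  (forall i j, measurable_fun setT (fun t => A t i j)) ->
  measurable_fun setT (fun t => invmx (A t) i j).
Proof.
move=> mA; have mD := measurable_det mA.
(* Cramer's rule; on singular matrices [invmx] returns the matrix itself. *)
rewrite (_ : (fun t => _) = fun t => if \det (A t) != 0 then (\det (A t))^-1 * cofactor (A t) j i else A t i j).
  apply: measurable_ifR; [by meas| |exact: mA].
  apply: measurable_funM; first by meas.
  rewrite /cofactor; apply: measurable_funM => //; apply: measurable_det => i' j'.
  by under eq_fun do rewrite !mxE; exact: mA.
apply/funext => t; rewrite /invmx unitmxE unitfE.
by case: ifP => _; rewrite // !mxE.
Qed.

Lemma measurable_tail m (x : T -> 'rV[R]_m.+1) j :
  (forall j, measurable_fun setT (fun t => x t 0 j)) ->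
  measurable_fun setT (fun t => tail (x t) 0 j).
Proof. by move=> mx; under eq_fun do rewrite mxE; exact: mx. Qed.

Lemma measurable_slant m (x : T -> 'rV[R]_m) :
  (forall j, measurable_fun setT (fun t => x t 0 j)) ->
  measurable_fun setT (fun t => slant (x t)).
Proof. by move=> mx; have := measurable_edot mx mx; rewrite /slant => ?; meas. Qed.

Lemma measurable_side m (g x : T -> 'rV[R]_m.+1) :
  (forall j, measurable_fun setT (fun t => g t 0 j)) ->
  (forall j, measurable_fun setT (fun t => x t 0 j)) ->
  measurable_fun setT (fun t => side (g t) (x t)).
Proof.
move=> mg mx; apply: measurable_funB; first exact: mx.
apply: measurable_edot => // j; apply: measurable_hv => // j'; exact: measurable_tail.
Qed.

Lemma measurable_hom m k (y : T -> 'I_k -> 'rV[R]_m) i j :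
  (forall i j, measurable_fun setT (fun t => y t i 0 j)) ->
  measurable_fun setT (fun t => hom (y t) i j).
Proof.
move=> my; rewrite (_ : (fun t => _) = fun t => hv 1 (y t i) 0 j).
  by apply: measurable_hv.
by apply/funext => t; rewrite mxE.
Qed.

Lemma measurable_gB m k (y : T -> 'I_k -> 'rV[R]_m.+1) i j :
  (forall i j, measurable_fun setT (fun t => y t i 0 j)) ->
  measurable_fun setT (fun t => tail_hom (y t) i j).
Proof. by move=> my; apply: measurable_hom => i' j'; exact: measurable_tail. Qed.

Lemma measurable_gpar m (y : T -> 'I_m.+1 -> 'rV[R]_m.+1) j :
  (forall i j, measurable_fun setT (fun t => y t i 0 j)) ->
  measurable_fun setT (fun t => graph_param (y t) 0 j).
Proof.
move=> my; under eq_fun do rewrite !mxE.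
apply: measurable_sumb => i; apply: measurable_funM.
  by apply: measurable_invmx => i' j'; exact: measurable_gB.
by under eq_fun do rewrite mxE; exact: my.
Qed.

End MeasGeom.

Section Null.
Variables (R : realType) (V : eqType).
Local Open Scope ereal_scope.

(* [f] is affine in each variable separately, like a determinant in its entries;
   by induction it vanishes either on a null set or identically. *)
Lemma II_null_affine (f : (V -> R) -> R) (s : seq V) (v u0 : V -> R) :
  (forall u a, exists c, forall t, f (upd u a t) = (c.1 + c.2 * t)%R) ->
  (forall b, b \notin s -> u0 b = v b) -> f u0 != 0%R ->
  II s (fun u => (f u == 0%R)%:R%:E) v = 0.
Proof.
move=> faff; elim: s v u0 => [|a s IH] v u0 uv fu0 /=.
  have <- : u0 = v by apply/funext => b; apply: uv.
  by rewrite (negbTE fu0).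
have [[c1 c2] fc] := faff u0 a; rewrite /= in fc.
transitivity (\int[@lebesgue_measure R]_t (fun=> 0 : \bar R) t); last by rewrite integral0.
(* The only possible root in this variable. If [c2] is 0 there is none, and removing one point does
   no harm. *)
apply: (@integral_off_seq _ [:: (- c1 / c2)%R]) => // t.
  by apply: II_ge0.
rewrite inE => tc; apply: (IH _ (upd u0 a t)).
  by move=> b bs; rewrite /upd; case: eqP => // /eqP ba; apply: uv; rewrite inE negb_or ba.
have E : upd u0 a (u0 a) = u0 by apply/funext => b; rewrite /upd; case: eqP => // ->.
rewrite fc; apply: contra_neq tc => h.
have c20 : c2 != 0%R.
  apply/eqP => c20; move: fu0; rewrite -E fc; move: h.
  by rewrite c20 !mul0r !addr0 => ->; rewrite eqxx.
have h2 : (- c1 = c2 * t)%R by lra.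
by rewrite h2 mulrC mulKf.
Qed.

(** With [a] innermost the zero set is the single point [phi u]. *)
Lemma II_null_graph (f phi : (V -> R) -> R) (s : seq V) (a : V) v : a \in s ->
  mea (fun u => (f u == 0%R)%:R%:E) ->
  (forall u, f u = (u a - phi u)%R) -> (forall u t, phi (upd u a t) = phi u) ->
  II s (fun u => (f u == 0%R)%:R%:E) v = 0.
Proof.
move=> as_ mf fE pE.
rewrite (II_perm (s2 := rem a s ++ [:: a]))//; last first.
  by apply: (perm_trans (perm_to_rem as_)); rewrite cats1 perm_sym perm_rcons.
rewrite II_cat -[RHS](II0 (rem a s) v); apply: eq_II => u _ /=.
transitivity (\int[@lebesgue_measure R]_t (fun=> 0 : \bar R) t); last by rewrite integral0.
apply: (@integral_off_seq _ [:: phi u]) => // t; rewrite inE => tp.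
by rewrite fE pE updE eqxx subr_eq0 (negbTE tp).
Qed.

End Null.

Section DetAffine.
Variable R : realType.

Lemma det_row_affine k (A : R -> 'M[R]_k) (i0 : 'I_k) (c : 'I_k -> R * R) :
  (forall t i j, i != i0 -> A t i j = A 0 i j) ->
  (forall t j, A t i0 j = (c j).1 + (c j).2 * t) ->
  exists e : R * R, forall t, \det (A t) = e.1 + e.2 * t.
Proof.
move=> A1 A2.
exists (\sum_j (c j).1 * cofactor (A 0) i0 j, \sum_j (c j).2 * cofactor (A 0) i0 j) => t /=.
rewrite (expand_det_row _ i0) mulr_suml -big_split /=; apply: eq_bigr => j _.
have -> : cofactor (A t) i0 j = cofactor (A 0) i0 j.
  rewrite /cofactor; congr (_ * \det _); apply/matrixP => a b; rewrite !mxE A1//.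
  by rewrite eq_sym neq_lift.
by rewrite A2 mulrDl mulrAC.
Qed.

End DetAffine.

Section LHS.
Variables (R : realType) (m n : nat) (beta : 'I_n -> R) (a b : R).
Hypothesis beta1 : forall i, -1 < beta i.
Hypothesis mn : (m.+1 < n)%N.
Local Notation state := ('I_n * 'I_m.+1 -> R).
Implicit Types (I : {ffun 'I_m.+1 -> 'I_n}).

Definition off I k := [forall j, I j != k].

Lemma measurable_pt k l (i : 'I_k) (j : 'I_l) :
  measurable_fun setT (fun u : st R ('I_k * 'I_l) => pt u i 0 j).
Proof.
rewrite (_ : (fun u => _) = fun u : st R ('I_k * 'I_l) => u (i, j)); first exact: measurable_coord.
by apply/funext => u; rewrite mxE.
Qed.

Lemma gB_entry I (u : state) i j : tail_hom (pt u \o I) i j = if j == ord0 then 1 else u (I i, j).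
Proof.
rewrite mxE; case: (unliftP ord0 j) => [l ->|->]; last by rewrite hv0 eqxx.
by rewrite hvS !mxE eq_sym (negbTE (neq_lift _ _)).
Qed.

Lemma mint_detB_null I : injective I ->
  mint (fun u : state => (\det (tail_hom (pt u \o I)) == 0)%:R%:E) = 0%E.
Proof.
move=> Ii; apply: (@II_null_affine _ _ _ _ _ (fun kc => (I kc.2 == kc.1)%:R)).
- move=> u [k c]; have [/forallP kI|/forallPn[i0]] := boolP (off I k).
    exists (\det (tail_hom (pt u \o I)), 0) => t; rewrite /= mul0r addr0; congr (\det _).
    apply/matrixP => i j; rewrite !gB_entry updE xpair_eqE (negbTE (kI i))//.
  rewrite negbK => /eqP ik.
  apply: (@det_row_affine _ _ (fun t => tail_hom (pt (upd u (k, c) t) \o I)) i0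
    (fun j => if j == ord0 then (1, 0) else if j == c then (0, 1) else (u (k, j), 0))).
    move=> t i j ii0; rewrite !gB_entry !updE !xpair_eqE -ik.
    by rewrite (inj_eq Ii) (negbTE ii0).
  move=> t j; rewrite gB_entry updE xpair_eqE ik eqxx /=.
  by case: (j == ord0); [|case: (j == c)]; rewrite /=; ring.
- by move=> b'; rewrite mem_enum.
- rewrite det_hom (_ : edges _ = 1%:M) ?det1 ?oner_neq0//.
  apply/matrixP => i j; rewrite !mxE /= !(inj_eq Ii) (inj_eq lift_inj) eq_sym.
  by rewrite [lift ord0 j == ord0]eq_sym (negbTE (neq_lift _ _)) subr0.
Qed.

Lemma measurable_gparI I j : measurable_fun setT (fun u : st R ('I_n * 'I_m.+1) => graph_param (pt u \o I) 0 j).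
Proof. by apply: measurable_gpar => i' j'; exact: measurable_pt. Qed.

Lemma mint_side_null I k : off I k ->
  mint (fun u : state => (side (graph_param (pt u \o I)) (pt u k) == 0)%:R%:E) = 0%E.
Proof.
move=> /forallP kI.
apply: (@II_null_graph _ _ _ (fun u => edot (graph_param (pt u \o I)) (hv 1 (tail (pt u k)))) _ (k, ord0)).
- by rewrite mem_enum.
- rewrite /mea; have H : measurable_fun setT (fun u : st R ('I_n * 'I_m.+1) => side (graph_param (pt u \o I)) (pt u k)).
    by apply: measurable_side => j; [exact: measurable_gparI|exact: measurable_pt].
  by meas.
- by move=> u; rewrite /side mxE.
move=> u t; have E : pt (upd u (k, ord0) t) \o I = pt u \o I.
  apply/funext => i; apply/rowP => j; rewrite !mxE updE xpair_eqE (negbTE (kI i))//.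
rewrite E; congr (edot _ (hv 1 _)); apply/rowP => j; rewrite !mxE updE xpair_eqE.
by rewrite [lift _ _ == _]eq_sym (negbTE (neq_lift _ _)) andbF.
Qed.

(** The products are the indicators of all other points lying below, respectively above. As
    [n > m + 1] there is such a point, so the events exclude each other and the sum is the indicator
    of [one_sided]; unlike that one, each product factorises over the points. *)
Definition sides I (g : 'rV[R]_m.+1) (u : state) : R :=
  \prod_(k | off I k) (side g (pt u k) < 0)%R%:R + \prod_(k | off I k) (0 < side g (pt u k))%R%:R.

Definition facet_wgt (D s r : R) : R := (`|s| / r) `^ a * (r * `|D| / (m`!)%:R) `^ b.

(** The determinant indicator discards the null set where [graph_param] has no geometric meaning. *)
Definition facet_term I (u : state) : R :=
  (\det (tail_hom (pt u \o I)) != 0)%:R *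
  facet_wgt (\det (tail_hom (pt u \o I))) (graph_param (pt u \o I) 0 ord0) (slant (tail (graph_param (pt u \o I)))) *
  sides I (graph_param (pt u \o I)) u * \prod_k fbeta m.+1 (beta k) (pt u k).

Lemma sides_ge0 I g u : 0 <= sides I g u.
Proof. by rewrite addr_ge0// prodr_ge0. Qed.

Lemma prod_fbeta_ge0 (x : 'I_n -> 'rV[R]_m.+1) : 0 <= \prod_k fbeta m.+1 (beta k) (x k).
Proof. by apply: prodr_ge0 => k _; exact: fbeta_ge0. Qed.

Lemma facet_term_ge0 I u : 0 <= facet_term I u.
Proof. by rewrite !mulr_ge0 ?powR_ge0 ?sides_ge0 ?prod_fbeta_ge0. Qed.

Lemma measurable_sides I (g : st R ('I_n * 'I_m.+1) -> 'rV[R]_m.+1) :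
  (forall j, measurable_fun setT (fun u => g u 0 j)) ->
  measurable_fun setT (fun u : st R ('I_n * 'I_m.+1) => sides I (g u) u).
Proof.
move=> mg; have H k : measurable_fun setT (fun u : st R ('I_n * 'I_m.+1) => side (g u) (pt u k)).
  by apply: measurable_side => // j; exact: measurable_pt.
rewrite /sides; apply: measurable_funD; apply: measurable_prodb => k; have Hk := H k; meas.
Qed.

Lemma measurable_detB I : measurable_fun setT (fun u : st R ('I_n * 'I_m.+1) => \det (tail_hom (pt u \o I))).
Proof. by apply: measurable_det => i j; apply: measurable_gB => i' j'; exact: measurable_pt. Qed.

Lemma mea_facet_term I : mea (fun u => (facet_term I u)%:E).
Proof.
apply: measurable_EF.
have h1 := measurable_detB I.
have h2 : measurable_fun setT (fun u : st R ('I_n * 'I_m.+1) => slant (tail (graph_param (pt u \o I)))).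
  by apply: measurable_slant => j; apply: measurable_tail => j'; exact: measurable_gparI.
have h3 := measurable_gparI I ord0.
have h4 : measurable_fun setT (fun u : st R ('I_n * 'I_m.+1) => sides I (graph_param (pt u \o I)) u).
  by apply: measurable_sides => j; exact: measurable_gparI.
have h5 k : measurable_fun setT (fun u : st R ('I_n * 'I_m.+1) => fbeta m.+1 (beta k) (pt u k)).
  by apply: measurable_fbeta => j; exact: measurable_pt.
apply: measurable_funM; last by apply: measurable_prodb => k; exact: h5.
by rewrite /facet_wgt; meas.
Qed.

Lemma ex_off I : exists k, off I k.
Proof.
apply: contrapT => nk.
have : (n <= #|codom I|)%N.
  rewrite -{1}(card_ord n); apply: subset_leq_card; apply/fintype.subsetP => k _.
  apply/negPn/negP => kI; apply: nk; exists k; apply/forallP => j.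
  by apply: contraNneq kI => <-; exact: codom_f.
by move=> h; have := leq_trans h (leq_image_card _ _); rewrite card_ord leqNgt mn.
Qed.

Lemma one_sidedE I (u : state) : (one_sided (pt u) I)%:R = sides I (graph_param (pt u \o I)) u.
Proof.
have P (q : 'I_n -> bool) : \prod_(k | off I k) (q k)%:R = ([forall k, off I k ==> q k])%:R :> R.
  have [/forallP H|/forallPn[k]] := boolP [forall k, off I k ==> q k].
    by rewrite big1// => k Ik; have /implyP/(_ Ik) -> := H k.
  by rewrite negb_imply => /andP[Ik /negbTE qk]; rewrite (bigD1 k)//= qk mul0r.
rewrite /sides !P /one_sided -/(off I _).
set A := [forall k, _]; set B := [forall k, _].
have : ~~ (A && B).
  apply/negP => /andP[/forallP hA /forallP hB]; have [k Ik] := ex_off I.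
  have /implyP/(_ Ik) h1 := hA k; have /implyP/(_ Ik) h2 := hB k.
  by have := lt_trans h1 h2; rewrite ltxx.
by case: A; case: B => //= _; rewrite ?addr0 ?add0r.
Qed.

Local Open Scope ereal_scope.

(** [Z] adds up the indicators of all failures of general position; each is null, and [Z u = 0]
    yields [gen_pos], where [Tab] has the explicit value of [Tab_gen_pos]. *)
Lemma Tab_expectation :
  pts_int (fun x : 'I_n -> 'rV[R]_m.+1 =>
     (Tab a b (conv_pts x) * \prod_(i < n) fbeta m.+1 (beta i) (x i))%R%:E) =
  \sum_(I : {ffun 'I_m.+1 -> 'I_n} | increasing I) mint (fun u : state => (facet_term I u)%:E).
Proof.
pose Z1 I (u : state) : \bar R := (\det (tail_hom (pt u \o I)) == 0)%R%:R%:E.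
pose Z2 I k (u : state) : \bar R := (side (graph_param (pt u \o I)) (pt u k) == 0)%R%:R%:E.
pose Z u := \sum_(I : {ffun 'I_m.+1 -> 'I_n} | increasing I) (Z1 I u + \sum_(k | off I k) Z2 I k u).
have mZ1 I : mea (Z1 I) by have H := measurable_detB I; rewrite /mea /Z1; meas.
have mZ2 I k : mea (Z2 I k).
  rewrite /mea /Z2; have H : measurable_fun setT (fun u : st R ('I_n * 'I_m.+1) => side (graph_param (pt u \o I)) (pt u k)).
    by apply: measurable_side => j; [exact: measurable_gparI|exact: measurable_pt].
  by meas.
have Z10 I u : 0 <= Z1 I u by rewrite /Z1 lee_fin.
have Z20 I k u : 0 <= Z2 I k u by rewrite /Z2 lee_fin.
have Z1s I u : 0 <= Z1 I u + \sum_(k | off I k) Z2 I k u by rewrite adde_ge0// sume_ge0.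
have mZs I : mea (fun u => \sum_(k | off I k) Z2 I k u).
  rewrite /mea (_ : (fun u => _) = fun u : st R ('I_n * 'I_m.+1) => \sum_k (if off I k then Z2 I k u else 0)).
    by apply: emeasurable_sum => k; case: (off I k) => //; exact: mZ2.
  by apply/funext => u; rewrite big_mkcond.
have mZ1s I : mea (fun u => Z1 I u + \sum_(k | off I k) Z2 I k u).
  by apply: emeasurable_funD; [exact: mZ1|exact: mZs].
have mT u I : 0 <= (facet_term I u)%:E by rewrite lee_fin facet_term_ge0.
transitivity (pts_int (fun x : 'I_n -> 'rV[R]_m.+1 =>
   \sum_(I : {ffun 'I_m.+1 -> 'I_n} | increasing I) (facet_term I (fun kc => x kc.1 0%R kc.2))%:E)).
  apply: (@pts_int_ae _ _ _ _ _ Z).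
  - rewrite /mea /Z (_ : (fun u => _) = fun u : st R ('I_n * 'I_m.+1) => \sum_(I : {ffun 'I_m.+1 -> 'I_n}) (if increasing I then Z1 I u + \sum_(k | off I k) Z2 I k u else 0)).
      by apply: emeasurable_sum => I; case: (increasing I) => //; exact: mZ1s.
    by apply/funext => u; rewrite big_mkcond.
  - by move=> u; apply: sume_ge0 => I _; exact: Z1s.
  - move=> x; rewrite lee_fin mulr_ge0 ?prod_fbeta_ge0//.
    by apply: fsumr_ge0 => F _; rewrite mulr_ge0 ?powR_ge0.
  - by move=> x; apply: sume_ge0 => I _.
  - rewrite /mint /Z II_sum// big1// => I iI; rewrite II_add//; last by move=> u; apply: sume_ge0.
    rewrite -/(mint _) mint_detB_null ?add0e; last exact: increasing_inj.
    by rewrite II_sum// big1// => k Ik; exact: mint_side_null.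
  move=> u /eqP Zu.
  have gp : gen_pos (pt u).
    move=> I iI; move: Zu; rewrite /Z seq_psume_eq0 => [/allP/(_ I (mem_index_enum _))|I' _]; last exact: Z1s.
    rewrite iI /= padde_eq0//; last by apply: sume_ge0.
    move=> /andP[]; rewrite /Z1 eqe pnatr_eq0 eqb0 => dI.
    rewrite seq_psume_eq0 => [/allP H|//].
    split; first by rewrite unitmxE unitfE.
    move=> k Ik; have /implyP : off I k ==> (Z2 I k u == 0) := H k (mem_index_enum _).
    move=> /(_ (introT forallP Ik)).
    by rewrite /Z2 eqe pnatr_eq0 eqb0.
  rewrite Tab_gen_pos ?(ltnW mn)// sumEFin; congr EFin.
  rewrite mulr_suml; apply: eq_bigr => I iI.
  have [uB _] := gp I iI.
  have -> : (fun kc => pt u kc.1 0%R kc.2) = u by apply/funext => -[k c]; rewrite mxE.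
  rewrite /facet_term one_sidedE -unitfE -unitmxE uB mul1r /facet_wgt [X in (X * _)%R]mulrC //.
have uE u : (fun kc => pt u kc.1 0%R kc.2) = u by apply/funext => -[k c]; rewrite mxE.
rewrite pts_intE; last 2 first.
- rewrite /mea (_ : (fun u => _) = fun u : st R ('I_n * 'I_m.+1) => \sum_(I : {ffun 'I_m.+1 -> 'I_n}) (if increasing I then (facet_term I u)%:E else 0)).
    by apply: emeasurable_sum => I; case: (increasing I) => //; exact: mea_facet_term.
  by apply/funext => u; rewrite uE big_mkcond.
- by move=> x; apply: sume_ge0 => I _.
rewrite /mint -II_sum; [|by move=> I _; exact: mea_facet_term|by move=> *; exact: mT].
by apply: eq_II => u _; rewrite uE.
Qed.

End LHS.

(** * Integrals over families of points *)

Section Points.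
Variables (R : realType) (n l : nat).
Local Notation state := ('I_n * 'I_l -> R).
Local Open Scope ereal_scope.

Definition rows (K : seq 'I_n) : seq ('I_n * 'I_l) := [seq (k, c) | k <- K, c <- enum 'I_l].

Lemma rows_cons k K : rows (k :: K) = map (pair k) (enum 'I_l) ++ rows K.
Proof. by []. Qed.

Lemma mem_rows K k c : ((k, c) \in rows K) = (k \in K).
Proof.
apply/allpairsP/idP => [[[k' c'] /= [kK _ [-> _]]]//|kK].
by exists (k, c); rewrite mem_enum.
Qed.

Lemma mea_pt k (f : 'rV[R]_l -> \bar R) : mrow f -> mea (fun u : state => f (pt u k)).
Proof.
move=> mf; apply: (@mea_comp _ _ _ (fun w => f (rv w)) (fun (u : state) j => u (k, j))) => // j.
exact: measurable_coord.
Qed.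

Lemma II_row k (f : 'rV[R]_l -> \bar R) v : mrow f -> (forall x, 0 <= f x) ->
  II (map (pair k) (enum 'I_l)) (fun u : state => f (pt u k)) v = Lint f.
Proof.
move=> mf f0; apply: (@II_mint _ _ _ (pair k) (fun w => f (rv w))) => //.
by move=> c c' [].
Qed.

Lemma mea_prod_pt (K : seq 'I_n) (f : 'I_n -> 'rV[R]_l -> R) :
  (forall k, mrow (fun x => (f k x)%:E)) ->
  mea (fun u : state => (\prod_(k <- K) f k (pt u k))%R%:E).
Proof.
move=> mf; apply: measurable_EF; apply: measurable_prodb => k.
by apply/measurable_EFinP; exact: (@mea_pt k (fun x => (f k x)%:E)).
Qed.

Lemma II_rows (K : seq 'I_n) (f : 'I_n -> 'rV[R]_l -> R) (L : 'I_n -> R) v :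
  uniq K -> (forall k x, (0 <= f k x)%R) -> (forall k, mrow (fun x => (f k x)%:E)) ->
  (forall k, k \in K -> Lint (fun x => (f k x)%:E) = (L k)%:E) ->
  II (rows K) (fun u : state => (\prod_(k <- K) f k (pt u k))%R%:E) v = (\prod_(k <- K) L k)%R%:E.
Proof.
move=> + f0 mf; elim: K v => [|k K IH] v; first by move=> _ _; rewrite /= !big_nil.
move=> /andP[kK uK] LK; rewrite rows_cons.
transitivity (II ([seq (k, i) | i <- enum 'I_l] ++ rows K)
   (fun u : state => (f k (pt u k))%:E * (\prod_(k <- K) f k (pt u k))%R%:E) v).
  by apply: eq_II => u _; rewrite big_cons EFinM.
rewrite II_prod//.
- rewrite IH//; last by move=> j jK; apply: LK; rewrite inE jK orbT.
  rewrite (@II_row k (fun x => (f k x)%:E))//; last by move=> x; rewrite lee_fin.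
  by rewrite LK ?mem_head// big_cons EFinM.
- exact: (@mea_pt k (fun x => (f k x)%:E)).
- exact: mea_prod_pt.
- by move=> u; rewrite lee_fin.
- by move=> u; rewrite lee_fin; apply: prodr_ge0.
- move=> u u' uu'; congr (f k _)%:E; apply/rowP => j; rewrite !mxE; apply: uu'.
  by rewrite mem_rows.
- move=> u u' uu'; congr (_%:E); rewrite !big_seq; apply: eq_bigr => j jK.
  congr (f j _); apply/rowP => c; rewrite !mxE; apply: uu'.
  by apply/mapP => -[c' _ [jk _]]; rewrite -jk jK in kK.
Qed.

Definition affp (A : 'M[R]_l) (c : 'rV[R]_l) (K : seq 'I_n) (u : state) : state :=
  fun kj => if kj.1 \in K then (pt u kj.1 *m A + c)%R 0%R kj.2 else u kj.

Lemma measurable_affp A c K kj : measurable_fun setT (fun u : st R ('I_n * 'I_l) => affp A c K u kj).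
Proof.
rewrite /affp; case: (kj.1 \in K); last exact: measurable_coord.
rewrite (_ : (fun u => _) = fun u : st R ('I_n * 'I_l) => (\sum_i u (kj.1, i) * A i kj.2 + c 0 kj.2)%R).
  apply: measurable_funD => //; apply: measurable_sumb => i.
  by apply: measurable_funM => //; exact: measurable_coord.
by apply/funext => u; rewrite !mxE; congr (_ + _)%R; apply: eq_bigr => i _; rewrite !mxE.
Qed.

Lemma II_affp A c (K : seq 'I_n) F v : uniq K -> A \in unitmx -> mea F -> (forall u, 0 <= F u) ->
  II (rows K) F v = (`|\det A| ^+ size K)%R%:E * II (rows K) (fun u => F (affp A c K u)) v.
Proof.
move=> + uA; elim: K F v => [|k K IH] F v.
  by move=> _ mF F0; rewrite expr0 mul1e.
move=> /andP[kK uK] mF F0; rewrite rows_cons.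
have ki : injective (fun c : 'I_l => (k, c)) by move=> c1 c2 [].
have maff : mea (fun u => F (aff (fun j => (k, j)) A^T (fun j => c 0%R j) u)).
  by apply: mea_comp => // kj; exact: measurable_aff.
have pC s1 s2 : perm_eq (s1 ++ s2 : seq ('I_n * 'I_l)) (s2 ++ s1) by rewrite perm_catC.
rewrite (II_perm (pC _ _))// II_cat.
transitivity (II (rows K) (fun u => (`|\det A|)%:E * II (map (pair k) (enum 'I_l))
   (fun u => F (aff (fun j => (k, j)) A^T (fun j => c 0%R j) u)) u) v).
  apply: eq_II => u _.
  have -> : map (pair k) (enum 'I_l) = avars (fun j => (k, j)) by [].
  by rewrite (@II_aff R _ _ _ A^T (fun j => c 0%R j)) ?unitmx_tr// det_tr.
rewrite II_scale//; last 2 first.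
- by apply: mea_II.
- by move=> u; exact: II_ge0.
rewrite -(II_cat (rows K)) (II_perm (pC (rows K) _))// II_cat.
transitivity ((`|\det A|)%:E * II (map (pair k) (enum 'I_l)) (fun u => (`|\det A| ^+ size K)%R%:E *
   II (rows K) (fun u => F (aff (fun j => (k, j)) A^T (fun j => c 0%R j) (affp A c K u))) u) v).
  by congr (_ * _); apply: eq_II => u _; rewrite IH.
rewrite II_scale//; last 2 first.
- apply: mea_II => //.
  by apply: (@mea_comp _ _ _ (fun u => F (aff (fun j => (k, j)) A^T (fun j => c 0%R j) u)) (affp A c K)) => // kj; exact: measurable_affp.
- by move=> u; exact: II_ge0.
rewrite muleA -EFinM -exprS -II_cat; congr (_ * _); apply: eq_II => u _; congr F.
apply/funext => -[k' j]; rewrite /affp inE /=.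
have [->|kk'] := eqVneq k' k; last first.
  rewrite aff_out//= => i; rewrite xpair_eqE eq_sym (negbTE kk')//.
rewrite (@aff_in _ _ _ (fun j => (k, j)))// !mxE; congr (_ + _)%R; apply: eq_bigr => i _.
by rewrite !mxE /affp /= (negbTE kK) mulrC.
Qed.

Lemma mint_affp A c F : A \in unitmx -> mea F -> (forall u : state, 0 <= F u) ->
  mint F = (`|\det A| ^+ n)%R%:E * mint (fun u : state => F (fun kj => (pt u kj.1 *m A + c)%R 0%R kj.2)).
Proof.
move=> uA mF F0.
have p : perm_eq (enum {: 'I_n * 'I_l}) (rows (enum 'I_n)).
  apply: uniq_perm; first exact: enum_uniq.
    apply: allpairs_uniq; rewrite ?enum_uniq// => -[a b] [a' b'] _ _ //.
  by move=> [k j]; rewrite mem_rows !mem_enum.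
have E : (fun u : state => F (fun kj => (pt u kj.1 *m A + c)%R 0%R kj.2)) = (fun u => F (affp A c (enum 'I_n) u)).
  by apply/funext => u; congr F; apply/funext => kj; rewrite /affp mem_enum.
have m2 : mea (fun u => F (affp A c (enum 'I_n) u)).
  by apply: mea_comp => // kj; exact: measurable_affp.
rewrite /mint E !(II_perm p)// (@II_affp A c) ?enum_uniq// size_enum_ord//.
Qed.

End Points.

(** * The contribution of one tuple of vertices *)

(* The variables split into the heights [hvar] and the tails [tvar] of the points
   of the tuple, and the coordinates [rows others] of the remaining points. *)
Section Tuple.
Variables (R : realType) (m n : nat) (beta : 'I_n -> R) (a b : R).
Hypothesis beta1 : forall i, -1 < beta i.
Variable I : {ffun 'I_m.+1 -> 'I_n}.
Hypothesis Ii : injective I.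
Local Notation state := ('I_n * 'I_m.+1 -> R).
Local Notation facet_termI := (@facet_term R m n beta a b I).

Definition hvar (j : 'I_m.+1) : 'I_n * 'I_m.+1 := (I j, ord0).
Definition tvar (jl : 'I_m.+1 * 'I_m) : 'I_n * 'I_m.+1 := (I jl.1, lift ord0 jl.2).
Definition tvars := map tvar (enum {: 'I_m.+1 * 'I_m}).
Definition others := [seq k <- enum 'I_n | off I k].

Lemma hvar_inj : injective hvar.
Proof. by move=> j j' [] /Ii. Qed.

Lemma tvar_inj : injective tvar.
Proof.
move=> [j l] [j' l'] h; have /Ii /= -> := congr1 fst h.
by have /lift_inj /= -> := congr1 snd h.
Qed.

Lemma mem_others k : (k \in others) = off I k.
Proof. by rewrite mem_filter mem_enum andbT. Qed.

Lemma mem_hvars k c : ((k, c) \in avars hvar) = ~~ off I k && (c == ord0).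
Proof.
apply/mapP/andP => [[j _ [-> ->]]|[/forallPn[j]]].
  by split => //; apply/forallPn; exists j; rewrite negbK.
by rewrite negbK => /eqP <- /eqP ->; exists j; rewrite ?mem_enum.
Qed.

Lemma mem_tvars k c : ((k, c) \in tvars) = ~~ off I k && (c != ord0).
Proof.
apply/mapP/andP => [[[j l] _ [-> ->]]|[/forallPn[j]]].
  split; first by apply/forallPn; exists j; rewrite negbK.
  by rewrite eq_sym neq_lift.
rewrite negbK => /eqP <-; case: (unliftP ord0 c) => [l ->|->]; last by rewrite eqxx.
by move=> _; exists (j, l); rewrite ?mem_enum.
Qed.

Lemma perm_vars : perm_eq (enum {: 'I_n * 'I_m.+1}) ((tvars ++ rows m.+1 others) ++ avars hvar).
Proof.
apply: uniq_perm; first exact: enum_uniq.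
  rewrite !cat_uniq -!andbA; apply/and5P; split.
  - by rewrite (map_inj_uniq tvar_inj) enum_uniq.
  - apply/hasPn => -[k c]; rewrite mem_rows mem_others => kI.
    by rewrite /= mem_tvars kI.
  - by apply: allpairs_uniq; rewrite ?filter_uniq -?enumT ?enum_uniq// => -[k c] [k' c'] _ _.
  - apply/hasPn => -[k c]; rewrite mem_hvars => /andP[kI /eqP ->].
    by rewrite /= mem_cat mem_tvars mem_rows mem_others (negbTE kI) eqxx.
  - by rewrite (map_inj_uniq hvar_inj) enum_uniq.
move=> [k c]; rewrite mem_enum !mem_cat mem_tvars mem_rows mem_others mem_hvars.
by case: (off I k); case: (c == ord0).
Qed.

Definition tls (u : state) (j : 'I_m.+1) : 'rV[R]_m := tail (pt u (I j)).
Definition hts (u : state) : 'rV[R]_m.+1 := \row_j u (hvar j).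

(* After the substitution the heights hold [w = (s, p)], and the points of the
   tuple are recovered from their tails [t] as points of that hyperplane. *)
Definition tuple_weight (w : 'rV[R]_m.+1) (t : 'I_m.+1 -> 'rV[R]_m) : R :=
  (\det (hom t) != 0)%:R * `|\det (hom t)| *
  facet_wgt m a b (\det (hom t)) (w 0 ord0) (slant (tail w)) *
  \prod_j fbeta m.+1 (beta (I j)) (hv (edot w (hv 1 (t j))) (t j)).

Definition side_weight (w : 'rV[R]_m.+1) (u : state) : R :=
  \prod_(k <- others) ((side w (pt u k) < 0)%R%:R * fbeta m.+1 (beta k) (pt u k)) +
  \prod_(k <- others) ((0 < side w (pt u k))%R%:R * fbeta m.+1 (beta k) (pt u k)).

Lemma tuple_weight_ge0 w t : 0 <= tuple_weight w t.
Proof.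
rewrite !mulr_ge0 ?powR_ge0//; apply: prodr_ge0 => j _; exact: fbeta_ge0.
Qed.

Lemma side_weight_ge0 w u : 0 <= side_weight w u.
Proof. by rewrite addr_ge0//; apply: prodr_ge0 => k _; rewrite mulr_ge0// fbeta_ge0. Qed.

Lemma side_weight_ext w (u u' : state) : (forall k, off I k -> pt u k = pt u' k) -> side_weight w u = side_weight w u'.
Proof.
move=> uu'.
have E (f : 'I_n -> 'rV[R]_m.+1 -> R) :
    \prod_(k <- others) f k (pt u k) = \prod_(k <- others) f k (pt u' k).
  by rewrite big_seq [RHS]big_seq; apply: eq_bigr => k; rewrite mem_others => /uu' ->.
apply: (congr2 +%R).
  exact: (E (fun k x => (side w x < 0)%R%:R * fbeta m.+1 (beta k) x)).
exact: (E (fun k x => (0 < side w x)%R%:R * fbeta m.+1 (beta k) x)).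
Qed.

Lemma measurable_tuple_weight d (T : measurableType d) (w : T -> 'rV[R]_m.+1) (t : T -> 'I_m.+1 -> 'rV[R]_m) :
  (forall j, measurable_fun setT (fun x => w x 0 j)) ->
  (forall i j, measurable_fun setT (fun x => t x i 0 j)) ->
  measurable_fun setT (fun x => tuple_weight (w x) (t x)).
Proof.
move=> mw mt.
have h1 : measurable_fun setT (fun x => \det (hom (t x))).
  by apply: measurable_det => i j; exact: measurable_hom.
have h2 : measurable_fun setT (fun x => slant (tail (w x))).
  by apply: measurable_slant => j; exact: measurable_tail.
have h3 := mw ord0.
apply: measurable_funM; first by rewrite /facet_wgt; meas.
apply: measurable_prodb => j; apply: measurable_fbeta => j'.
apply: measurable_hv => //; apply: measurable_edot => // j''; exact: measurable_hv.
Qed.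

Lemma measurable_side_weight (w : st R ('I_n * 'I_m.+1) -> 'rV[R]_m.+1) :
  (forall j, measurable_fun setT (fun x => w x 0 j)) ->
  measurable_fun setT (fun u : st R ('I_n * 'I_m.+1) => side_weight (w u) u).
Proof.
move=> mw.
have h1 k : measurable_fun setT (fun u : st R ('I_n * 'I_m.+1) => fbeta m.+1 (beta k) (pt u k)).
  by apply: measurable_fbeta => j; exact: measurable_pt.
have h2 k : measurable_fun setT (fun u : st R ('I_n * 'I_m.+1) => side (w u) (pt u k)).
  by apply: measurable_side => // j; exact: measurable_pt.
apply: measurable_funD; apply: measurable_prodb => k; apply: measurable_funM => //;
  have := h2 k => ?; meas.
Qed.

Lemma measurable_hts j : measurable_fun setT (fun u : st R ('I_n * 'I_m.+1) => hts u 0 j).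
Proof.
rewrite [X in measurable_fun _ X](_ : _ = fun u : st R ('I_n * 'I_m.+1) => u (hvar j)); first exact: measurable_coord.
by apply/funext => u; rewrite mxE.
Qed.

Lemma measurable_tls i j : measurable_fun setT (fun u : st R ('I_n * 'I_m.+1) => tls u i 0 j).
Proof. by apply: measurable_tail => j'; exact: measurable_pt. Qed.

Lemma mea_tuple_weight : mea (fun u : state => (tuple_weight (hts u) (tls u))%:E).
Proof.
apply: measurable_EF; apply: measurable_tuple_weight => *; [exact: measurable_hts|exact: measurable_tls].
Qed.

Lemma mea_side_weight : mea (fun u : state => (side_weight (hts u) u)%:E).
Proof. by apply: measurable_EF; apply: measurable_side_weight => *; exact: measurable_hts. Qed.

Lemma tls_off (u v : state) : (forall x, x \notin avars hvar -> u x = v x) -> tls u = tls v.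
Proof.
move=> uv; apply/funext => j; apply/rowP => l; rewrite !mxE; apply: uv.
by rewrite mem_hvars [lift _ _ == _]eq_sym (negbTE (neq_lift _ _)) andbF.
Qed.

Lemma pt_off (u v : state) k : off I k -> (forall x, x \notin avars hvar -> u x = v x) -> pt u k = pt v k.
Proof.
by move=> kI uv; apply/rowP => l; rewrite !mxE; apply: uv; rewrite mem_hvars kI.
Qed.

Lemma prod_off (f : 'I_n -> R) : \prod_k f k = \prod_(k <- others) f k * \prod_j f (I j).
Proof.
rewrite (bigID (off I))/= big_filter; congr (_ * _).
  by rewrite big_enum_cond.
rewrite (eq_bigl (mem (I @: [set: 'I_m.+1]))); last first.
  move=> k; apply/forallPn/imsetP => [[j /negbNE /eqP <-]|[j _ ->]]; exists j; rewrite ?inE// negbK//.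
by rewrite big_imset/=; [apply: eq_bigl => j; rewrite in_setT|move=> ? ? _ _; exact: Ii].
Qed.

Lemma sides_side_weight w u : sides I w u * \prod_(k <- others) fbeta m.+1 (beta k) (pt u k) = side_weight w u.
Proof.
have E (f : 'I_n -> R) : \prod_(k | off I k) f k = \prod_(k <- others) f k.
  by rewrite big_filter big_enum_cond.
by rewrite /sides !E mulrDl -!big_split.
Qed.

(** For fixed tails the heights of points on the hyperplane [(s, p)] are [B (s, p)^T], where [B] has
    the rows [(1, tail)]. So [lin hvar B] takes hyperplane parameters to heights with Jacobian
    [|\det B|], and [graph_param] of the resulting points returns the parameters. *)
Lemma facet_term_subst (v u : state) : tls u = tls v -> hom (tls v) \in unitmx ->
  `|\det (hom (tls v))| * facet_termI (lin hvar (hom (tls v)) u) = tuple_weight (hts u) (tls u) * side_weight (hts u) u.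
Proof.
move=> uv uB; set B := hom (tls v); set u' := lin hvar B u.
have h0 j : u' (hvar j) = edot (hts u) (hv 1 (tls u j)).
  rewrite /u' (lin_in hvar_inj) edotC; apply: eq_bigr => c _.
  by rewrite /B -uv !mxE.
have off' x : x \notin avars hvar -> u' x = u x.
  by move=> xh; rewrite /u' lin_out//; exact: notin_avars.
have ptI j : pt u' (I j) = hv (edot (hts u) (hv 1 (tls u j))) (tls u j).
  rewrite -[LHS]hv_tail -/(tls u' j) (tls_off off'); congr hv.
  by rewrite mxE -[(I j, ord0)]/(hvar j) h0.
have pto k : off I k -> pt u' k = pt u k by move=> kI; apply: pt_off.
have gBE : tail_hom (pt u' \o I) = B by rewrite /B -uv -(tls_off off').
have gp : graph_param (pt u' \o I) = hts u.
  rewrite /graph_param gBE (_ : \col_i _ = B *m (hts u)^T) ?mulKmx ?trmxK//.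
  apply/colP => j; rewrite mxE /= mxE -[(I j, ord0)]/(hvar j) h0 edotC /B -uv [RHS]mxE.
  by apply: eq_bigr => c _; rewrite !mxE.
have sE : sides I (hts u) u' = sides I (hts u) u.
  by rewrite /sides; congr (_ + _); apply: eq_bigr => k kI; rewrite pto.
have prodE : \prod_k fbeta m.+1 (beta k) (pt u' k) =
    \prod_(k <- others) fbeta m.+1 (beta k) (pt u k) *
    \prod_j fbeta m.+1 (beta (I j)) (hv (edot (hts u) (hv 1 (tls u j))) (tls u j)).
  rewrite prod_off; apply: (congr2 *%R).
    rewrite big_seq [RHS]big_seq; apply: eq_bigr => k; rewrite mem_others => kI.
    by rewrite pto.
  by apply: eq_bigr => j _; rewrite ptI.
rewrite /facet_term gBE gp prodE sE -sides_side_weight /tuple_weight uv -/B; ring.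
Qed.

Local Open Scope ereal_scope.

Lemma II_facet_term v : II (avars hvar) (fun u => (facet_termI u)%:E) v =
  II (avars hvar) (fun u : state => (tuple_weight (hts u) (tls u) * side_weight (hts u) u)%:E) v.
Proof.
have [uB|nB] := boolP (hom (tls v) \in unitmx).
  have mT1 := mea_facet_term beta a b I.
  have T10 u : 0 <= (facet_termI u)%:E by rewrite lee_fin; exact: facet_term_ge0.
  rewrite (II_lin _ hvar_inj uB mT1 T10) -II_scale; last 3 first.
  - by apply: (@mea_comp _ _ _ (fun u => (facet_termI u)%:E) (lin hvar (hom (tls v)))) => // x; exact: measurable_lin.
  - by move=> u; exact: T10.
  - by rewrite lee_fin normr_ge0.
  apply: eq_II => u uv; rewrite -EFinM facet_term_subst//; exact: tls_off.
(* For degenerate tails both integrands carry the indicator of a nonzero determinant and vanish. *)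
apply: eq_II => u uv; have E := tls_off uv.
have d0 : \det (hom (tls u)) = 0%R.
  by apply/eqP; move: nB; rewrite E unitmxE unitfE negbK.
have d1 : \det (tail_hom (pt u \o I)) = 0%R := d0.
by rewrite /facet_term /tuple_weight !d1 eqxx !mul0r.
Qed.

(** The heights are innermost for the substitution and are then moved outermost: once they encode
    the hyperplane, the tails of the tuple and the remaining points enter separate factors. *)
Lemma mint_facet_term : mint (fun u => (facet_termI u)%:E) =
  II (avars hvar) (fun v => II tvars (fun u : state => (tuple_weight (hts u) (tls u))%:E) v *
    II (rows m.+1 others) (fun u : state => (side_weight (hts u) u)%:E) v) (fun=> 0%R).
Proof.
have mT1 := mea_facet_term beta a b I.
have T10 u : 0 <= (facet_termI u)%:E by rewrite lee_fin; exact: facet_term_ge0.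
have mA := mea_tuple_weight; have mH := mea_side_weight.
have A0 u : 0 <= (tuple_weight (hts u) (tls u))%:E by rewrite lee_fin tuple_weight_ge0.
have H0 u : 0 <= (side_weight (hts u) u)%:E by rewrite lee_fin side_weight_ge0.
have mAH : mea (fun u : state => (tuple_weight (hts u) (tls u) * side_weight (hts u) u)%:E).
  rewrite /mea (_ : (fun u => _) = fun u : st R ('I_n * 'I_m.+1) => (tuple_weight (hts u) (tls u))%:E * (side_weight (hts u) u)%:E).
    exact: emeasurable_funM.
  by apply/funext => u; rewrite EFinM.
have AH0 u : 0 <= (tuple_weight (hts u) (tls u) * side_weight (hts u) u)%:E by rewrite EFinM mule_ge0.
rewrite /mint (II_perm perm_vars)// II_cat.
rewrite (@II_ext _ _ _ _ _ II_facet_term) -II_cat (II_perm (permEl (perm_catC _ _)))// II_cat.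
apply: eq_II => v _.
rewrite (@II_ext _ _ _ _ (fun u : state => (tuple_weight (hts u) (tls u))%:E * (side_weight (hts u) u)%:E)); last first.
  by move=> u; rewrite EFinM.
have htsE (s : seq ('I_n * 'I_m.+1)) (u u' : state) :
    (forall j, hvar j \notin s) -> (forall x, x \notin s -> u x = u' x) -> hts u = hts u'.
  by move=> hs uu'; apply/rowP => j; rewrite !mxE; exact: uu'.
have nI j : off I (I j) = false by apply/negbTE/forallPn; exists j; rewrite negbK.
apply: (@II_prod _ _ tvars (rows m.+1 others) _ _ v mA mH A0 H0).
  move=> u u' uu'; have -> : tls u = tls u'.
    apply/funext => j; apply/rowP => l; rewrite !mxE; apply: uu'.
    by rewrite mem_rows mem_others nI.
  have -> // : hts u = hts u'.
  by apply: (htsE (rows m.+1 others)) => // j; rewrite mem_rows mem_others nI.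
move=> u u' uu'; have -> : hts u = hts u'.
  by apply: (htsE tvars) => // j; rewrite mem_tvars eqxx andbF.
have E k : off I k -> pt u k = pt u' k.
  by move=> kI; apply/rowP => l; rewrite !mxE; apply: uu'; rewrite mem_tvars kI.
apply: (congr1 EFin); exact: side_weight_ext.
Qed.

End Tuple.

(** * Rotating the hyperplane to a horizontal one *)

Section Rotation.
Variables (R : realType) (m : nat).

(** The first row of [rotQ p] is the unit normal and the other rows are parallel to the hyperplane,
    so only the height of [x] counts. *)
Lemma side_rotQ s p (x : 'rV[R]_m.+1) :
  side (hv s p) (x *m rotQ p) = slant p * (x 0 ord0 - s / slant p).
Proof.
rewrite sideE tail_hv hv0 [in x *m _](hvP x) mul_rotQ edotDr edotZr edot_normal.
have -> : edot (normal p) ((\row_j x 0 (lift ord0 j)) *m tang p) = 0.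
  by rewrite edotC edotE -mulmxA tang_normal mulmx0 mxE.
by have := slant_gt0 p => ?; field; lra.
Qed.

Lemma fbeta_rotQ b p (x : 'rV[R]_m.+1) : fbeta m.+1 b (x *m rotQ p) = fbeta m.+1 b x.
Proof. by rewrite !fbetaE edot_rotQ. Qed.

Lemma Lint_rotQ (G : 'rV[R]_m.+1 -> \bar R) p : mrow G -> (forall x, (0 <= G x)%E) ->
  Lint G = Lint (fun x => G (x *m rotQ p)).
Proof.
move=> mG G0; rewrite (Lint_aff 0 (rotQ_unit p))// norm_det_rotQ mul1e.
by congr Lint; apply/funext => x; rewrite addr0.
Qed.

Let mrow_side (P : R -> bool) b (g : 'rV[R]_m.+1) :
  measurable_fun setT (fun t : R => P t) ->
  mrow (fun x => ((P (side g x))%:R * fbeta m.+1 b x)%:E).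
Proof.
move=> mP; apply: measurable_EF; apply: measurable_funM.
  apply: measurable_indb; apply: measurableT_comp => //.
  by apply: measurable_side => // j; exact: measurable_rv.
by apply: measurable_fbeta => j; exact: measurable_rv.
Qed.

Lemma Lint_side_lt b s (p : 'rV[R]_m) : -1 < b -> s / slant p <= 1 ->
  Lint (fun x => ((side (hv s p) x < 0)%R%:R * fbeta m.+1 b x)%:E) =
  (Fgamma (b + m%:R / 2) (s / slant p))%:E.
Proof.
move=> b1 h1; rewrite (Lint_rotQ p).
- rewrite -(Lint_halfspace m b1 h1); apply: (congr1 (@Lint R _)); apply/funext => x.
  by rewrite side_rotQ fbeta_rotQ pmulr_rlt0 ?slant_gt0// subr_lt0.
- by apply: (mrow_side (P := fun t => t < 0)); meas.
- by move=> x; rewrite lee_fin mulr_ge0// fbeta_ge0.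
Qed.

Lemma Lint_side_gt b s (p : 'rV[R]_m) : -1 < b -> -1 <= s / slant p ->
  Lint (fun x => ((0 < side (hv s p) x)%R%:R * fbeta m.+1 b x)%:E) =
  (Fgamma (b + m%:R / 2) (- (s / slant p)))%:E.
Proof.
move=> b1 h1; rewrite (Lint_rotQ p).
- rewrite -(Lint_halfspaceN m b1 h1); apply: (congr1 (@Lint R _)); apply/funext => x.
  by rewrite side_rotQ fbeta_rotQ pmulr_rgt0 ?slant_gt0// subr_gt0.
- by apply: (mrow_side (P := fun t => 0 < t)); meas.
- by move=> x; rewrite lee_fin mulr_ge0// fbeta_ge0.
Qed.

(** [t] is the tail of the rotated point [(h, y)], which lies on the hyperplane and is therefore
    determined by its tail. Thus [y] is an isometric coordinate on the hyperplane. *)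
Lemma hv_plane s p h (y : 'rV[R]_m) : s = h * slant p ->
  let t := y *m rotA p + (- (h / slant p)) *: p in
  hv (edot (hv s p) (hv 1 t)) t = hv h y *m rotQ p.
Proof.
move=> sh t; set x := _ *m rotQ p.
have tx : tail x = t.
  rewrite /x mul_rotQ tailD tailZ /normal tail_hv scalerN -scaleNr addrC; congr (_ + _).
  have -> : y *m tang p = row_mx (y *m ((slant p)^-1 *: p^T)) (y *m rotA p).
    by rewrite /tang (@mul_mx_row _ 1 m 1 m).
  by rewrite [y *m (_ *: _)]mx11_scalar -/(hv _ _) tail_hv.
have : side (hv s p) x = 0.
  by rewrite side_rotQ hv0 sh mulfK ?subrr ?mulr0// gt_eqF// slant_gt0.
by rewrite /side tx => /eqP; rewrite subr_eq0 => /eqP <-; rewrite -tx hv_tail.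
Qed.

End Rotation.

Lemma hom_entry (R : realType) m k (y : 'I_k -> 'rV[R]_m) i j :
  hom y i j = if unlift ord0 j is Some l then y i 0 l else 1.
Proof. by rewrite mxE; case: (unliftP ord0 j) => [l ->|->]; rewrite ?hvS ?hv0. Qed.

Section Eval.
Variables (R : realType) (m n : nat) (beta : 'I_n -> R) (a b : R).
Hypothesis beta1 : forall i, -1 < beta i.
Variable I : {ffun 'I_m.+1 -> 'I_n}.
Hypothesis Ii : injective I.
Local Notation state := ('I_n * 'I_m.+1 -> R).
Local Notation F k := (Fgamma (beta k + m%:R / 2)).

Lemma hts_const (s : seq ('I_n * 'I_m.+1)) (u v : state) : (forall j, hvar I j \notin s) ->
  (forall x, x \notin s -> u x = v x) -> hts I u = hts I v.
Proof. by move=> hs uv; apply/rowP => j; rewrite !mxE; apply: uv. Qed.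

Lemma hvar_rows j : hvar I j \notin rows m.+1 (others I).
Proof. by rewrite mem_rows mem_others; apply/forallPn; exists j; rewrite negbK. Qed.

Lemma hvar_tvars j : hvar I j \notin tvars I.
Proof. by rewrite mem_tvars eqxx andbF. Qed.

Lemma II_side_weight (v : state) s p : hts I v = hv s p -> -1 <= s / slant p <= 1 ->
  II (rows m.+1 (others I)) (fun u : state => (side_weight beta I (hts I u) u)%:E) v =
  (\prod_(k <- others I) F k (s / slant p) + \prod_(k <- others I) F k (- (s / slant p)))%:E.
Proof.
move=> vE /andP[h1 h2].
have uo : uniq (others I) by rewrite filter_uniq// enum_uniq.
pose f (P : pred R) k x : R := (P (side (hv s p) x))%:R * fbeta m.+1 (beta k) x.
have f0 P k x : 0 <= f P k x by rewrite mulr_ge0// fbeta_ge0.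
have mf (P : pred R) : measurable_fun setT P -> forall k, mrow (fun x => (f P k x)%:E).
  move=> mP k; apply: measurable_EF; apply: measurable_funM.
    apply: measurable_indb; apply: measurableT_comp => //.
    by apply: measurable_side => // j; exact: measurable_rv.
  by apply: measurable_fbeta => j; exact: measurable_rv.
have mlt : measurable_fun setT (fun t : R => t < 0) by meas.
have mgt : measurable_fun setT (fun t : R => 0 < t) by meas.
pose lt0 := fun t : R => t < 0; pose gt0 := fun t : R => 0 < t.
transitivity (II (rows m.+1 (others I)) (fun u : state =>
   (\prod_(k <- others I) f lt0 k (pt u k))%:E + (\prod_(k <- others I) f gt0 k (pt u k))%:E)%E v).
  apply: eq_II => u uv; rewrite (hts_const _ uv) ?vE//; exact: hvar_rows.
rewrite II_add; last 4 first.
- by apply: mea_prod_pt; exact: mf.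
- by apply: mea_prod_pt; exact: mf.
- by move=> u; rewrite lee_fin prodr_ge0.
- by move=> u; rewrite lee_fin prodr_ge0.
rewrite EFinD; apply: (congr2 adde).
  apply: II_rows => //; first exact: mf.
  by move=> k _; exact: Lint_side_lt.
apply: II_rows => //; first exact: mf.
by move=> k _; exact: Lint_side_gt.
Qed.

Definition Dsimplex (y : 'I_m.+1 * 'I_m -> R) : R := \det (hom (pt y)).

(* The integrand of [EDelta_pow], off the null set of degenerate simplices. *)
Definition simplex_weight (y : 'I_m.+1 * 'I_m -> R) : R :=
  (Dsimplex y != 0)%:R * (`|Dsimplex y| / (m`!)%:R) `^ (b + 1) *
  \prod_j fbeta m (beta (I j)) (pt y j).

Lemma measurable_Dsimplex :
  measurable_fun setT (fun y : st R ('I_m.+1 * 'I_m) => Dsimplex y).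
Proof. by apply: measurable_det => i j; apply: measurable_hom => *; exact: measurable_pt. Qed.

Lemma mea_simplex_weight : mea (fun y => (simplex_weight y)%:E).
Proof.
apply: measurable_EF; have h := measurable_Dsimplex; rewrite /simplex_weight.
have h2 k : measurable_fun setT (fun y : st R ('I_m.+1 * 'I_m) => fbeta m (beta (I k)) (pt y k)).
  by apply: measurable_fbeta => j; exact: measurable_pt.
by apply: measurable_funM; [meas|apply: measurable_prodb].
Qed.

Lemma simplex_weight_ge0 y : 0 <= simplex_weight y.
Proof. by rewrite !mulr_ge0 ?powR_ge0//; apply: prodr_ge0 => j _; exact: fbeta_ge0. Qed.

Lemma mint_Dsimplex_null : mint (fun y => (Dsimplex y == 0)%:R%:E) = 0%E.
Proof.
(* Witness: the origin together with the standard basis vectors. *)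
apply: (@II_null_affine _ _ _ _ _ (fun ic => (ic.1 == lift ord0 ic.2)%:R)) => [u [i0 c]|ic|]; [|by rewrite mem_enum|].
  apply: (@det_row_affine _ _ (fun t => hom (pt (upd u (i0, c) t))) i0
    (fun j => if unlift ord0 j is Some j' then (if j' == c then (0, 1) else (u (i0, j'), 0)) else (1, 0))).
    move=> t i j ii0; rewrite !hom_entry; case: unlift => // l.
    by rewrite !mxE !updE !xpair_eqE (negbTE ii0).
  move=> t j; rewrite hom_entry; case: unlift => [l|] /=; last by ring.
  by rewrite mxE updE xpair_eqE eqxx /=; case: (l == c); rewrite /=; ring.
rewrite /Dsimplex det_hom (_ : edges _ = 1%:M) ?det1 ?oner_neq0//.
apply/matrixP => i j; rewrite !mxE /= (inj_eq lift_inj).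
by rewrite subr0.
Qed.

Lemma EDelta_mint : EDelta_pow m.+1 m (fun k => beta (I k)) (b + 1) = mint (fun y => (simplex_weight y)%:E).
Proof.
have h := measurable_Dsimplex.
rewrite /EDelta_pow.
have yE (y : 'I_m.+1 * 'I_m -> R) : (fun kc => pt y kc.1 0 kc.2) = y.
  by apply/funext => -[k c]; rewrite mxE.
rewrite (@pts_int_ae _ _ _ _ (fun x => (simplex_weight (fun kc => x kc.1 0 kc.2))%:E) (fun y => (Dsimplex y == 0)%:R%:E)).
- by rewrite pts_intE; [apply: (congr1 (@mint R _)); apply/funext => y; rewrite yE
    |under eq_fun do rewrite yE; exact: mea_simplex_weight|move=> x; rewrite lee_fin simplex_weight_ge0].
- by apply: measurable_EF; meas.
- by move=> u; rewrite lee_fin.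
- by move=> x; rewrite lee_fin mulr_ge0 ?powR_ge0//; apply: prodr_ge0 => j _; exact: fbeta_ge0.
- by move=> x; rewrite lee_fin simplex_weight_ge0.
- exact: mint_Dsimplex_null.
move=> y /eqP; rewrite eqe pnatr_eq0 eqb0 => D0.
by rewrite yE /simplex_weight D0 mul1r leb_vol_conv// unitmxE unitfE.
Qed.

End Eval.

Section Powers.
Variables (R : realType) (x : R).

Lemma sqrtX k : 0 <= x -> Num.sqrt x ^+ k = x `^ (k%:R / 2).
Proof.
by move=> x0; rewrite -powR12_sqrt// -powR_mulrn ?powR_ge0// -powRrM mulrC.
Qed.

Lemma prod_powR (J : finType) (g : J -> R) : 0 < x ->
  \prod_j x `^ (g j) = x `^ (\sum_j g j).
Proof.
move=> x0; apply/esym; apply: (big_morph (fun e => x `^ e)); last exact: powRr0.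
by move=> e e'; rewrite powRD ?(gt_eqF x0) ?implybT.
Qed.

End Powers.

Lemma measurable_ptaff (R : realType) k l (A : 'M[R]_l) c (i : 'I_k) j :
  measurable_fun setT (fun y : st R ('I_k * 'I_l) => (pt y i *m A + c) 0 j).
Proof.
rewrite (_ : (fun y => _) = fun y : st R ('I_k * 'I_l) => \sum_l' y (i, l') * A l' j + c 0 j).
  apply: measurable_funD => //; apply: measurable_sumb => l'.
  by apply: measurable_funM => //; exact: measurable_coord.
by apply/funext => y; rewrite !mxE; congr (_ + _); apply: eq_bigr => l' _; rewrite !mxE.
Qed.

Section Eval.
Variables (R : realType) (m n : nat) (beta : 'I_n -> R) (a b : R).
Hypothesis beta1 : forall i, -1 < beta i.
Variable I : {ffun 'I_m.+1 -> 'I_n}.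
Hypothesis Ii : injective I.
Local Notation state := ('I_n * 'I_m.+1 -> R).

Definition cbeta_prod : R := \prod_j (cbeta m.+1 (beta (I j)) / cbeta m (beta (I j))).

Definition expo : R := \sum_j beta (I j) + (m.+1%:R - 1) / 2 * (m.+1%:R + b + 1).

Definition radial_const (h : R) : R := (m`!)%:R * cbeta_prod * (`|h| `^ a * (1 - h ^+ 2) `^ expo).

(** With [x = 1 - h^2] the slice of the ball has radius [Num.sqrt x], and each determinant of the
    scaling is [Num.sqrt x ^+ m]. It occurs [m + 1] times as Jacobian of the tails, once in
    [|\det (hom t)|] and [b] times in the facet volume. *)
Lemma expo_split (x : R) : 0 < x ->
  x `^ expo = x `^ (\sum_j beta (I j)) * (Num.sqrt x ^+ m) ^+ m.+2 * (Num.sqrt x ^+ m) `^ b.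
Proof.
move=> x0; have xn0 : x != 0 by rewrite gt_eqF.
rewrite sqrtX ?ltW// -powR_mulrn ?powR_ge0// -!powRrM -!powRD ?xn0 ?implybT//.
by congr (x `^ _); rewrite /expo -!natr1; ring.
Qed.

(** Powers of [1 / r]: [m + 1] from the Jacobians of the tails and one from [|\det (hom t)|]; in the
    facet volume [r] cancels. The factor [|\det (hom t)|] also raises [b] to [b + 1], and expressing
    it by the volume leaves one [m!]. *)
Lemma tuple_weight_rot (y : 'I_m.+1 -> 'rV[R]_m) s p : let r := slant p in let h := s / r in
  let rho := Num.sqrt (1 - h ^+ 2) in h ^+ 2 < 1 ->
  (rho ^+ m / r) ^+ m.+1 *
  tuple_weight beta a b I (hv s p) (fun j => y j *m (rho *: rotA p) + (- (h / r)) *: p) =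
  (r ^- m.+2 * radial_const h) * ((\det (hom y) != 0)%:R * (`|\det (hom y)| / (m`!)%:R) `^ (b + 1) *
  \prod_j fbeta m (beta (I j)) (y j)).
Proof.
move=> r h rho h1.
have r0 : 0 < r by exact: slant_gt0.
have x0 : 0 < 1 - h ^+ 2 by rewrite subr_gt0.
have rho0 : 0 < rho by rewrite sqrtr_gt0.
have fE j : fbeta m.+1 (beta (I j)) (hv (edot (hv s p) (hv 1 (y j *m (rho *: rotA p) + (- (h / r)) *: p)))
    (y j *m (rho *: rotA p) + (- (h / r)) *: p)) =
    cbeta m.+1 (beta (I j)) / cbeta m (beta (I j)) * (1 - h ^+ 2) `^ beta (I j) * fbeta m (beta (I j)) (y j).
  rewrite -scalemxAr scalemxAl (@hv_plane _ _ s p h) ?fbeta_rotQ ?fbeta_slice//.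
  by rewrite /h divfK// gt_eqF.
have pE : \prod_j fbeta m.+1 (beta (I j)) (hv (edot (hv s p) (hv 1 (y j *m (rho *: rotA p) + (- (h / r)) *: p)))
    (y j *m (rho *: rotA p) + (- (h / r)) *: p)) =
    cbeta_prod * (1 - h ^+ 2) `^ (\sum_j beta (I j)) * \prod_j fbeta m (beta (I j)) (y j).
  by rewrite (eq_bigr _ (fun j _ => fE j)) big_split big_split/= prod_powR.
have detA : `|\det (rho *: rotA p)| = rho ^+ m / r.
  by rewrite detZ normrM norm_det_rotA normrX gtr0_norm.
rewrite /tuple_weight pE det_hom_aff hv0 tail_hv -/r.
have [->|D0] := eqVneq (\det (hom y)) 0; first by rewrite mul0r eqxx !mul0r !mulr0.
have A0 : \det (rho *: rotA p) != 0 by rewrite -normr_gt0 detA divr_gt0// exprn_gt0.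
rewrite mulf_neq0// /facet_wgt !normrM detA /radial_const expo_split//.
have f0 : 0 < (m`!)%:R :> R by rewrite ltr0n fact_gt0.
have Dm : 0 < `|\det (hom y)| / (m`!)%:R by rewrite divr_gt0 ?normr_gt0.
rewrite powRD ?(gt_eqF Dm) ?implybT// powRr1 ?ltW//.
have -> : `|s| / r = `|h| by rewrite normrM normfV (gtr0_norm r0).
have -> : r * (`|\det (hom y)| * (rho ^+ m / r)) / (m`!)%:R = rho ^+ m * (`|\det (hom y)| / (m`!)%:R).
  by field; rewrite !gt_eqF.
rewrite powRM ?exprn_ge0 ?ltW//.
rewrite -/rho; set Y := rho ^+ m; rewrite exprMn exprVn [Y ^+ m.+2]exprS [r ^+ m.+2]exprS.
set Z := r ^+ m.+1.
have Z0 : Z != 0 by rewrite expf_neq0// gt_eqF.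
by field; rewrite !gt_eqF// exprn_gt0.
Qed.

Local Open Scope ereal_scope.

(** The substitution is the isometric coordinate of [hv_plane] composed with the scaling by [rho],
    the radius of the slice of the ball. *)
Lemma II_tuple_weight (v : state) s p : hts I v = hv s p -> ((s / slant p) ^+ 2 < 1)%R ->
  II (tvars I) (fun u : state => (tuple_weight beta a b I (hts I u) (tls I u))%:E) v =
  (slant p ^- m.+2 * radial_const (s / slant p))%R%:E * mint (fun y => (simplex_weight beta b I y)%:E).
Proof.
move=> vE h1; set r := slant p in h1 *; set h := (s / r)%R in h1 *.
have r0 : (0 < r)%R by exact: slant_gt0.
pose rho := Num.sqrt (1 - h ^+ 2).
have rho0 : (0 < rho)%R by rewrite sqrtr_gt0 subr_gt0.
have C0 : (0 <= radial_const h)%R.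
  rewrite /radial_const !mulr_ge0 ?powR_ge0// prodr_ge0// => j _.
  by rewrite divr_ge0// ltW// cbeta_gt0.
pose G (y : 'I_m.+1 * 'I_m -> R) := (tuple_weight beta a b I (hv s p) (pt y))%:E.
have mG : mea G.
  by apply: measurable_EF; apply: measurable_tuple_weight => // i j; exact: measurable_pt.
have G0 y : 0 <= G y by rewrite lee_fin tuple_weight_ge0.
transitivity (II (tvars I) (fun u : state => G (u \o tvar I)) v).
  apply: eq_II => u uv; rewrite (hts_const _ uv) ?vE; last exact: hvar_tvars.
  congr (tuple_weight _ _ _ _ _ _)%:E; apply/funext => j; apply/rowP => l; by rewrite !mxE.
rewrite (@II_mint _ _ _ (tvar I))//; last exact: tvar_inj.
have detA : (`|\det (rho *: rotA p)| = rho ^+ m / r)%R.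
  by rewrite detZ normrM norm_det_rotA normrX gtr0_norm.
have uA : (rho *: rotA p)%R \in unitmx.
  by rewrite unitmxE unitfE -normr_gt0 detA divr_gt0// exprn_gt0.
rewrite (@mint_affp _ _ _ _ (- (h / r) *: p)%R _ uA mG G0) detA.
pose y' (y : 'I_m.+1 * 'I_m -> R) kj := (pt y kj.1 *m (rho *: rotA p) + (- (h / r)) *: p)%R 0%R kj.2.
have y'E y : pt (y' y) = (fun j => pt y j *m (rho *: rotA p) + (- (h / r)) *: p)%R.
  by apply/funext => j; apply/rowP => l; rewrite mxE.
have mG' : mea (fun y => G (y' y)).
  by apply: mea_comp => // -[k c]; rewrite /y' /=; apply: measurable_ptaff.
rewrite /mint -!II_scale.
- apply: eq_II => y _; rewrite -!EFinM; apply: (congr1 EFin).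
  by rewrite -/(y' y) y'E; exact: tuple_weight_rot.
- exact: mea_simplex_weight.
- by move=> y; rewrite lee_fin simplex_weight_ge0.
- by rewrite lee_fin mulr_ge0// invr_ge0 exprn_ge0// ltW.
- exact: mG'.
- by move=> y; exact: G0.
- by rewrite lee_fin exprn_ge0// divr_ge0 ?exprn_ge0// ltW.
Qed.

End Eval.

(** * Integration over the hyperplane parameters *)

Section Marginals.
Variable R : realType.
Local Notation mu := (@lebesgue_measure R).

(* For [h > 1] the defining integral of [Fgamma] leaves the support of the density
   and [Fgamma] is not a distribution function, hence the restriction to [h <= 1]. *)
Lemma Fgamma_measurable_ext (g : R) : -1 < g ->
  exists f : R -> R, [/\ measurable_fun setT f, forall h, 0 <= f h &
    forall h, h <= 1 -> Fgamma g h = f h].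
Proof.
move=> g1; have c0 := cbeta_gt0 1 g1.
pose G (u : bool -> R) : \bar R :=
  (((u true ^+ 2 < 1) && (u true < u false))%R%:R * (cbeta 1 g * (1 - u true ^+ 2) `^ g))%R%:E.
have G0 u : (0 <= G u)%E by rewrite lee_fin mulr_ge0// mulr_ge0 ?powR_ge0 ?(ltW c0)//.
have mG : mea G.
  have h1 : measurable_fun setT (fun u : st R bool => u true) by exact: measurable_coord.
  have h2 : measurable_fun setT (fun u : st R bool => u false) by exact: measurable_coord.
  by rewrite /mea /G; meas.
exists (fun h => fine (II [:: true] G (upd (fun=> 0) false h))); split.
- apply: (measurableT_comp (@fine_measurable R setT measurableT)).
  by apply: mea_sec; exact: mea_II.
- by move=> h; apply: fine_ge0; exact: II_ge0.
move=> h h1.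
have -> : II [:: true] G (upd (fun=> 0) false h) = (Fgamma g h)%:E by rewrite Fgamma_int.
by [].
Qed.

End Marginals.

Section Radial.
Variables (R : realType) (J : finType) (P : pred J) (g : J -> R) (a e : R).
Hypothesis g1 : forall k, -1 < g k.
Local Notation mu := (@lebesgue_measure R).
Local Open Scope ereal_scope.

Let sqr_le1 (h : R) : (-1 <= h -> h <= 1 -> h ^+ 2 <= 1)%R.
Proof. by move=> h1 h2; nra. Qed.

(** The weight in [h] is even, so the products at [h] and [-h] have the same integral; this is the
    factor 2. Measurable substitutes for [Fgamma] allow the integral of the sum to be split. *)
Lemma int_both_sides (K : \bar R) (f : R -> \bar R) : 0 <= K -> (forall h, 0 <= f h) ->
  (forall h, (h ^+ 2 < 1)%R -> f h = K * (`|h| `^ a * (1 - h ^+ 2) `^ e *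
    (\prod_(k | P k) Fgamma (g k) h + \prod_(k | P k) Fgamma (g k) (- h)))%R%:E) ->
  (forall h, (1 < h ^+ 2)%R -> f h = 0) ->
  \int[mu]_h f h = K * (2%:E * \int[mu]_(h in `[(-1)%R, 1%R]%classic)
    (`|h| `^ a * (1 - h ^+ 2) `^ e * \prod_(k | P k) Fgamma (g k) h)%R%:E).
Proof.
move=> K0 f0 fin fout.
have /choice[F /all_and3[mF F0 FE]] := fun k => Fgamma_measurable_ext (g1 k).
pose q h : R := ((h ^+ 2 < 1)%R%:R * (`|h| `^ a * (1 - h ^+ 2) `^ e))%R.
have q0 h : (0 <= q h)%R by rewrite /q !mulr_ge0 ?powR_ge0.
have mq : measurable_fun setT q by rewrite /q; meas.
pose G h : \bar R := (q h * \prod_(k | P k) F k h)%R%:E.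
have G0 h : 0 <= G h by rewrite lee_fin mulr_ge0// prodr_ge0.
have mP : measurable_fun setT (fun h => \prod_(k | P k) F k h)%R by exact: measurable_prodb.
have mG : measurable_fun setT G by rewrite /G; meas.
have mGN : measurable_fun setT (fun h : R => G (- h)%R).
  by apply: (measurableT_comp mG); exact: measurable_funN.
have sq (h : R) : h \notin [:: 1%R; (-1)%R] -> (h ^+ 2 != 1)%R.
  by rewrite !inE negb_or sqrf_eq1 => /andP[/negbTE -> /negbTE ->].
have FP h : (h <= 1)%R -> (\prod_(k | P k) Fgamma (g k) h = \prod_(k | P k) F k h)%R.
  by move=> h1; apply: eq_bigr => k _; exact: FE.
transitivity (\int[mu]_h (K * (G h + G (- h)%R))).
  apply: (@integral_off_seq _ [:: 1%R; (-1)%R]) => // [h|h /sq h1]; first by rewrite mule_ge0// adde_ge0.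
  rewrite /G /q sqrrN normrN -EFinD.
  have [hlt|hgt|heq] := ltgtP (h ^+ 2)%R 1%R; last by rewrite heq eqxx in h1.
    have [hl hr] : (h <= 1)%R /\ (- h <= 1)%R by split; nra.
    by rewrite fin// mul1r -mulrDr (FP _ hl) (FP _ hr).
  by rewrite fout// !mul0r addr0 mule0.
rewrite ge0_integralZl//; [|exact: emeasurable_funD|by move=> h _; rewrite adde_ge0].
apply: (congr1 (mule K)); rewrite ge0_integralD//.
have -> : \int[mu]_h G (- h)%R = \int[mu]_h G h.
  rewrite [RHS](@integral_affine _ _ (-1) 0)// ?oppr_eq0 ?oner_eq0//.
  rewrite normrN1 mul1e; apply: eq_integral => h _; by rewrite mulN1r addr0.
have -> : \int[mu]_(h in `[(-1)%R, 1%R]%classic)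
    (`|h| `^ a * (1 - h ^+ 2) `^ e * \prod_(k | P k) Fgamma (g k) h)%R%:E = \int[mu]_h G h.
  rewrite integral_mkcond; apply: (@integral_off_seq _ [:: 1%R; (-1)%R]) => //.
    move=> h; rewrite patchE mem_setE in_itv/=; case: ifP => // /andP[_ h1].
    by rewrite lee_fin !mulr_ge0 ?powR_ge0// prodr_ge0// => k _; rewrite FE.
  move=> h hs; have := sq h hs; move: hs; rewrite !inE negb_or => /andP[n1 n2] h1.
  rewrite patchE mem_setE in_itv/= /G /q.
  have [hlt|hgt|heq] := ltgtP (h ^+ 2)%R 1%R; last by rewrite heq eqxx in h1.
    have [hl hr] : (-1 <= h)%R /\ (h <= 1)%R by split; nra.
    by rewrite hl hr mul1r FP.
  rewrite !mul0r; case: ifP => // /andP[hl hr].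
  by have := lt_le_trans hgt (sqr_le1 hl hr); rewrite ltxx.
by rewrite -[2%R]/(1 + 1)%R EFinD ge0_muleDl// mul1e.
Qed.

End Radial.

Section Final.
Variables (R : realType) (m n : nat) (beta : 'I_n -> R) (a b : R).
Hypothesis beta1 : forall i, -1 < beta i.
Variable I : {ffun 'I_m.+1 -> 'I_n}.
Hypothesis Ii : injective I.
Local Notation state := ('I_n * 'I_m.+1 -> R).
Local Notation mu := (@lebesgue_measure R).
Local Notation F k := (Fgamma (beta k + m%:R / 2)).
Local Notation ED := (mint (fun y => (simplex_weight beta b I y)%:E)).

(** By Cauchy-Schwarz a hyperplane at distance greater than 1 misses the unit ball, where the
    densities live. *)
Lemma tuple_weight_out s p t : 1 < (s / slant p) ^+ 2 -> tuple_weight beta a b I (hv s p) t = 0.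
Proof.
move=> h1; rewrite /tuple_weight (bigD1 ord0)//=.
set x := hv _ (t ord0).
have r0 := slant_gt0 p.
have xs : edot (normal p) x = s.
  have : side (hv s p) x = 0 by rewrite /side /x hv0 tail_hv subrr.
  by rewrite sideE tail_hv hv0 => /eqP; rewrite subr_eq0 => /eqP.
have : 1 < edot x x.
  have := cauchy_schwarz (normal p) x; rewrite xs edot_normal => cs.
  move: h1; rewrite expr_div_n ltr_pdivlMr ?exprn_gt0// mul1r => h1.
  have r2 : 0 < slant p ^+ 2 by rewrite exprn_gt0.
  by have := lt_le_trans h1 cs; rewrite -[X in X < _]mulr1 ltr_pM2l.
by rewrite fbetaE ltNge => /negbTE ->; rewrite mul0r mulr0.
Qed.

Definition fiber_int (v : state) : \bar R :=
  (II (tvars I) (fun u : state => (tuple_weight beta a b I (hts I u) (tls I u))%:E) v *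
   II (rows m.+1 (others I)) (fun u : state => (side_weight beta I (hts I u) u)%:E) v)%E.

(** A function of the hyperplane alone: the variables set to 0 are all integrated out. *)
Definition hyperplane_weight (w : 'I_m.+1 -> R) : \bar R := fiber_int (setv (hvar I) (fun=> 0) w).

Lemma mea_hyperplane_weight : mea hyperplane_weight.
Proof.
have mset k : measurable_fun setT (fun w : st R 'I_m.+1 => setv (hvar I) (fun=> 0) w k).
  by rewrite /setv; case: pickP => [i _|_]; [exact: measurable_coord|].
apply: emeasurable_funM.
  apply: (@mea_comp _ _ _ (II (tvars I) _) (fun w => setv (hvar I) (fun=> 0) w)) => //.
  by apply: mea_II; [exact: mea_tuple_weight|move=> u; rewrite lee_fin tuple_weight_ge0].
apply: (@mea_comp _ _ _ (II (rows m.+1 (others I)) _) (fun w => setv (hvar I) (fun=> 0) w)) => //.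
by apply: mea_II; [exact: mea_side_weight|move=> u; rewrite lee_fin side_weight_ge0].
Qed.

Local Open Scope ereal_scope.

Lemma hyperplane_weight_ge0 w : 0 <= hyperplane_weight w.
Proof. by rewrite mule_ge0// II_ge0// => u; rewrite lee_fin ?tuple_weight_ge0 ?side_weight_ge0. Qed.

Lemma mint_facet_hyperplane : mint (fun u => (facet_term beta a b I u)%:E) = mint hyperplane_weight.
Proof.
rewrite mint_facet_term//.
rewrite -(@II_mint _ _ _ (hvar I) hyperplane_weight (avars (hvar I)) (fun=> 0%R))//.
- apply: eq_II => u u0; rewrite /hyperplane_weight -/(fiber_int u); congr fiber_int.
  apply: (@eq_state _ _ _ (hvar I)) => [i|k kh]; first by rewrite setv_in//; exact: hvar_inj.
  by rewrite setv_out// u0//; apply/mapP => -[i _ ki]; have := kh i; rewrite ki eqxx.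
- exact: hvar_inj.
- exact: mea_hyperplane_weight.
- exact: hyperplane_weight_ge0.
Qed.

Lemma hts_setv (w : 'I_m.+1 -> R) : hts I (setv (hvar I) (fun=> 0%R) w) = rv w.
Proof. by apply/rowP => j; rewrite !mxE setv_in//; exact: hvar_inj. Qed.

Lemma hyperplane_weight_in s (w : 'I_m -> R) : ((s / slant (rv w)) ^+ 2 < 1)%R ->
  hyperplane_weight (scons s w) = (slant (rv w) ^- m.+2)%R%:E * ((radial_const beta a b I (s / slant (rv w)))%:E * ED *
   (\prod_(k | off I k) F k (s / slant (rv w)) + \prod_(k | off I k) F k (- (s / slant (rv w))))%R%:E).
Proof.
move=> h1; have hE : hts I (setv (hvar I) (fun=> 0%R) (scons s w)) = hv s (rv w).
  by rewrite hts_setv rv_scons.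
rewrite /hyperplane_weight /fiber_int (II_tuple_weight a b beta1 Ii hE h1) (II_side_weight beta1 hE); last first.
  by apply/andP; split; nra.
by rewrite EFinM -!muleA !big_filter !big_enum_cond.
Qed.

Lemma hyperplane_weight_out s (w : 'I_m -> R) : (1 < (s / slant (rv w)) ^+ 2)%R -> hyperplane_weight (scons s w) = 0.
Proof.
move=> h1; have hE : hts I (setv (hvar I) (fun=> 0%R) (scons s w)) = hv s (rv w).
  by rewrite hts_setv rv_scons.
rewrite /hyperplane_weight /fiber_int; set A := II _ _ _; have -> : A = 0; last by rewrite mul0e.
rewrite /A -[RHS](II0 (tvars I) (setv (hvar I) (fun=> 0%R) (scons s w))).
apply: eq_II => u uv; rewrite (hts_const _ uv) ?hE; last exact: hvar_tvars.
by rewrite tuple_weight_out.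
Qed.

Let w0 : 'I_m -> R := fun=> 0%R.

Lemma slant_w0 : slant (rv w0) = 1%R.
Proof.
rewrite /slant (_ : rv w0 = 0%R); last by apply/rowP => j; rewrite !mxE.
by rewrite edotE mul0mx mxE addr0 sqrtr1.
Qed.

(** The profile at the horizontal hyperplane [x_0 = h], where [slant] is 1 and [s] is the signed
    distance itself. *)
Let J h := hyperplane_weight (scons h w0).

Lemma mea_J : measurable_fun setT J.
Proof.
have mh k : measurable_fun setT (fun h : R => scons h w0 k).
  by rewrite /scons; case: unlift.
have ms : measurable_fun setT ((fun h => scons h w0) : R -> st R 'I_m.+1) by exact: measurable_st.
exact: (measurableT_comp mea_hyperplane_weight ms).
Qed.

(** Rotation invariance: apart from the power of [slant], only the signed distance matters. Both
    sides have explicit values off [h = 1] and [h = -1]. *)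
Lemma hyperplane_weight_scale (w : 'I_m -> R) h : let r := slant (rv w) in h \notin [:: 1%R; (-1)%R] ->
  hyperplane_weight (scons (r * h) w) = (r ^- m.+2)%R%:E * J h.
Proof.
move=> r hs; have r0 : (0 < r)%R by exact: slant_gt0.
have h1 : (h ^+ 2 != 1)%R by move: hs; rewrite !inE negb_or sqrf_eq1 => /andP[/negbTE -> /negbTE ->].
have E : (r * h / slant (rv w) = h)%R by rewrite mulrAC divff ?mul1r// gt_eqF.
have E0 : (h / slant (rv w0) = h)%R by rewrite slant_w0 divr1.
have [hlt|hgt|heq] := ltgtP (h ^+ 2)%R 1%R; last by rewrite heq eqxx in h1.
  by rewrite /J !hyperplane_weight_in ?E ?E0// slant_w0 expr1n invr1 mul1e.
by rewrite /J !hyperplane_weight_out ?E ?E0// mule0.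
Qed.

(** The substitution [s = r h] contributes one factor [r] and leaves the power [r^-(m+1)] that
    [kappa_slant] integrates. *)
Lemma mint_hyperplane_weight : mint hyperplane_weight = \int[mu]_h J h * Lint (fun p : 'rV[R]_m => (slant p ^- m.+1)%R%:E).
Proof.
have J0 h : 0 <= J h by exact: hyperplane_weight_ge0.
have mJ := mea_J.
rewrite mint_consr; [|exact: mea_hyperplane_weight|exact: hyperplane_weight_ge0].
rewrite -LintZ; last 3 first.
- exact: mrow_slantX.
- by move=> p; rewrite lee_fin invr_ge0 exprn_ge0// ltW// slant_gt0.
- exact: integral_ge0.
apply: eq_II => w _; set r := slant (rv w); have r0 : (0 < r)%R by exact: slant_gt0.
have mP : measurable_fun setT (fun t => hyperplane_weight (scons t w)).
  have mh k : measurable_fun setT (fun h : R => scons h w k).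
    by rewrite /scons; case: unlift.
  have ms : measurable_fun setT ((fun h => scons h w) : R -> st R 'I_m.+1) by exact: measurable_st.
  exact: (measurableT_comp mea_hyperplane_weight ms).
rewrite (@integral_affine _ _ r 0) ?gt_eqF//; last by move=> t; exact: hyperplane_weight_ge0.
rewrite gtr0_norm//.
have -> : \int[mu]_t hyperplane_weight (scons (r * t + 0)%R w) = \int[mu]_t ((r ^- m.+2)%R%:E * J t).
  apply: (@integral_off_seq _ [:: 1%R; (-1)%R]).
  - by move=> t; exact: hyperplane_weight_ge0.
  - by move=> t; rewrite mule_ge0// lee_fin invr_ge0 exprn_ge0// ltW.
  - by move=> t ts; rewrite addr0; exact: hyperplane_weight_scale.
rewrite ge0_integralZl_EFin//; last by rewrite invr_ge0 exprn_ge0// ltW.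
rewrite muleA -EFinM muleC; congr (_ * _%:E).
by rewrite exprS invfM mulrA divff ?mul1r// gt_eqF.
Qed.

Lemma cbeta_prod_ge0 : (0 <= cbeta_prod beta I)%R.
Proof. by apply: prodr_ge0 => j _; rewrite divr_ge0// ltW// cbeta_gt0. Qed.

Lemma int_J : \int[mu]_h J h = ((m`!)%:R * cbeta_prod beta I)%R%:E * ED * (2%:E *
   \int[mu]_(h in `[(-1)%R, 1%R]%classic)
    (`|h| `^ a * (1 - h ^+ 2) `^ expo beta b I * \prod_(k | off I k) F k h)%R%:E).
Proof.
have g1 k : (-1 < beta k + m%:R / 2)%R by rewrite (lt_le_trans (beta1 k))// lerDl divr_ge0.
have ED0 : 0 <= ED by apply: mint_ge0 => y; rewrite lee_fin simplex_weight_ge0.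
have E0 h : (h / slant (rv w0) = h)%R by rewrite slant_w0 divr1.
apply: (int_both_sides (g := fun k => (beta k + m%:R / 2)%R)) => //.
- by rewrite mule_ge0// lee_fin mulr_ge0// cbeta_prod_ge0.
- by move=> h; exact: hyperplane_weight_ge0.
- move=> h h1; rewrite /J hyperplane_weight_in ?E0// slant_w0 expr1n invr1 mul1e /radial_const.
  rewrite [in LHS]EFinM [in RHS](EFinM (_ * _)) -!muleA; congr (_ * _).
  by rewrite muleCA.
- by move=> h h1; rewrite /J hyperplane_weight_out ?E0.
Qed.

(** By [kappa_slant] the 2 from the two sides and the integral over [p] combine to
    [m.+1%:R * kappa m.+1]; the [m!] from the determinant completes the factorial. *)
Theorem mint_facet_term_value : mint (fun u => (facet_term beta a b I u)%:E) =
  ((m.+1`!)%:R * kappa m.+1)%R%:E * ((cbeta_prod beta I)%:E * ED *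
   \int[mu]_(h in `[(-1)%R, 1%R]%classic)
    (`|h| `^ a * (1 - h ^+ 2) `^ expo beta b I * \prod_(k | off I k) F k h)%R%:E).
Proof.
have -> : ((m.+1`!)%:R * kappa m.+1 = (m`!)%:R * (m.+1%:R * kappa m.+1) :> R)%R.
  by rewrite factS natrM mulrCA mulrA.
rewrite mint_facet_hyperplane mint_hyperplane_weight int_J EFinM [in RHS]EFinM kappa_slant.
set L := Lint _; set Q := \int[mu]_(h in _) _.
rewrite -!muleA; congr (_ * _).
by rewrite [L * _]muleC -!muleA [in RHS]muleCA [2%:E * (ED * _)]muleCA.
Qed.

End Final.

Theorem theorem2 (R : realType) (d n : nat) (beta : 'I_n -> R) (a b : R) :
  (2 <= d)%N -> (d.+1 <= n)%N -> (forall i, -1 < beta i) ->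
  (* E T_{a,b}^{d-1,d}(conv(X_1,...,X_n)), X_i independent with density f_{d,beta_i} *)
  pts_int (fun x : 'I_n -> 'rV[R]_d =>
     (Tab a b (conv_pts x) * \prod_(i < n) fbeta d (beta i) (x i))%:E)
  = (((d`!)%:R * kappa (R := R) d)%:E *
    \sum_(i : {ffun 'I_d -> 'I_n} |
            [forall k : 'I_d, forall l : 'I_d, (k < l)%N ==> (i k < i l)%N])
      ((\prod_(k < d) (cbeta d (beta (i k)) / cbeta d.-1 (beta (i k))))%:E
       * EDelta_pow d d.-1 (fun k => beta (i k)) (b + 1)
       * \int[@lebesgue_measure R]_(h in `[(-1)%R, 1%R]%classic)
           (powR `|h| a
            * powR (1 - h ^+ 2)
                (\sum_(k < d) beta (i k) + (d%:R - 1) / 2 * (d%:R + b + 1))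
            * \prod_(k < n | [forall j, i j != k])
                Fgamma (beta k + (d%:R - 1) / 2) h)%R%:E))%E.
Proof.
case: d => // m _ mn beta1; rewrite /= Tab_expectation//.
have dE : (m.+1%:R - 1) / 2 = m%:R / 2 :> R by rewrite -natr1 addrK.
(* The summands may be [+oo], so distributivity is used for nonnegative terms, whose signs are
   checked at the end. *)
rewrite ge0_sume_distrr.
  apply: eq_bigr => I iI; have Ii := increasing_inj iI.
  rewrite (mint_facet_term_value a b beta1 Ii).
  rewrite (EDelta_mint b beta1 I).
  rewrite /expo.
  rewrite dE.
  apply: (congr2 mule); first exact: erefl.
  by apply: (congr2 mule); exact: erefl.
move=> I iI; rewrite EDelta_mint//; apply: mule_ge0; first apply: mule_ge0.
- by rewrite lee_fin; exact: cbeta_prod_ge0.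
- by apply: mint_ge0 => y; rewrite lee_fin simplex_weight_ge0.
apply: integral_ge0 => h; rewrite /= in_itv/= => /andP[_ h1].
rewrite lee_fin mulr_ge0 ?mulr_ge0 ?powR_ge0//; apply: prodr_ge0 => k _.
apply: Fgamma_ge0 => //; rewrite dE.
by rewrite (lt_le_trans (beta1 k))// lerDl divr_ge0.
Qed.
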